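(* Let $S_j$ be local potentials satisfying (A)–(E), let $\omega\in\mathbb{Q}^d$ and let $(p_1,q_1),\dots,(p_d,q_d)$ be principal periods for $\omega$. Assume $W_{p,q}:\mathbb{X}_{p,q}\to\mathbb{R}$ is a Morse function. Then there exists a ghost circle $\Gamma\subset\mathbb{X}_{p,q}$ for the $S_j$ which is a $C^1$ curve in $\mathbb{X}_{p,q}$, contains all minimizers of $W_{p,q}$ on $\mathbb{X}_{p,q}$, and consists of critical points of $W_{p,q}$ of Morse index $0$ and $1$ together with heteroclinic orbits of the negative gradient flow connecting them.
   Context: Notation: $\|i\|=\sum_{k=1}^d|i_k|$, $B_j^r=\{k:\|k-j\|\le r\}$, $(\tau_{k,l}x)_i=x_{i+k}+l$. Local potentials $S_j:\mathbb{R}^{\mathbb{Z}^d}\to\mathbb{R}$, $j\in\mathbb{Z}^d$, satisfy: (A) there is $r\in(0,\infty)$ and $C^2$ functions $s_j:\mathbb{R}^{B_j^r}\to\mathbb{R}$ with $S_j(x)=s_j(x|_{B_j^r})$; (B) $S_j(\tau_{k,l}x)=S_{j+k}(x)$; (C) each $S_j$ is bounded below and $S_j(x)\to\infty$ as $|x_k-x_j|\to\infty$ whenever $\|k-j\|=1$; (D) $\partial_{i,k}S_j\le0$ for $i\ne k$, and $\partial_{i,k}S_i<0$ when $\|i-k\|=1$; (E) $|\partial_{i,k}S_j|\le C$ uniformly. Principal periods: a $\mathbb{Z}$-basis of $I_\omega=\{(k,l):\langle k,\omega\rangle+l=0\}$. With $p$ the matrix with columns $p_j$: $B_p=p([0,1)^d)\cap\mathbb{Z}^d$,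 $\mathbb{X}_{p,q}=\{x:\tau_{p_j,q_j}x=x\ \forall j\}$ (finite-dimensional, identified with $\mathbb{R}^{B_p}$), $W_{p,q}=\sum_{j\in B_p}S_j$ on $\mathbb{X}_{p,q}$; Morse: nondegenerate Hessian at critical points; index = number of negative Hessian eigenvalues. $\mathbb{X}=\{x:\sum_i2^{-\|i\|}|x_i|<\infty\}$, $(\nabla W(x))_i=\sum_{\|j-i\|\le r}\partial_iS_j(x)$, $\Psi_t$ the complete flow of $\dot x=-\nabla W(x)$ on $\mathbb{X}$ (it leaves $\mathbb{X}_{p,q}$ invariant, where it coincides with the negative gradient flow of $W_{p,q}$). A ghost circle is a set $\Gamma\subset\mathbb{R}^{\mathbb{Z}^d}$ that is nonempty, closed and connected (topology of pointwise convergence), strictly ordered (for $x,y\in\Gamma$: $x\ll y$, $x=y$ or $y\ll x$, where $x\ll y$ means $x_i<y_i$ for all $i$), shift-invariant ($\tau_{k,l}\Gamma\subset\Gamma$ for all $(k,l)$), and satisfies $\Psi_t(\Gamma)=\Gamma$ for all $t\in\mathbb{R}$. *)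

(* Defs.v *)
From HB Require Import structures.
From mathcomp Require Import all_boot all_order all_algebra.
From Stdlib Require Import Reals.

Set Implicit Arguments.
Unset Strict Implicit.
Unset Printing Implicit Defensive.

Section Lattice.
Import GRing.Theory Num.Theory.
Local Open Scope ring_scope.
Variable d : nat.

Definition Zd := 'rV[int]_d.

Definition vadd (a b : Zd) : Zd := a + b.
Definition vsub (a b : Zd) : Zd := a - b.

Definition norm1 (k : Zd) : nat := (\sum_(a < d) absz (k 0 a))%N.

Definition in_Iomega (omega : 'rV[rat]_d) (k : Zd) (l : int) : Prop :=
  \sum_(a < d) (k 0 a)%:~R * omega 0 a + l%:~R = 0 :> rat.

Definition pcol (p : 'M[int]_d) (j : 'I_d) : Zd := \row_(i < d) p i j.

Definition principal_periods (omega : 'rV[rat]_d) (p : 'M[int]_d)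
    (q : 'rV[int]_d) : Prop :=
  (forall j : 'I_d, in_Iomega omega (pcol p j) (q ord0 j)) /\
  (forall (k : Zd) (l : int), in_Iomega omega k l ->
     exists n : 'rV[int]_d,
       (k = n *m p^T /\ l = (n *m q^T) 0 0) /\
       (forall n' : 'rV[int]_d, k = n' *m p^T /\ l = (n' *m q^T) 0 0 -> n' = n)).

Definition inBp (p : 'M[int]_d) (k : Zd) : Prop :=
  exists t : 'rV[rat]_d,
    (forall j : 'I_d, 0 <= t 0 j /\ t 0 j < 1) /\
    map_mx (fun z : int => z%:~R : rat) k = t *m (map_mx (fun z : int => z%:~R : rat) p)^T.

Definition box_pt (N : nat) (f : {ffun 'I_d -> 'I_(Nat.add (Nat.mul 2 N) 1)}) : Zd :=
  \row_(a < d) ((f a : nat)%:Z - N%:Z).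

End Lattice.

Arguments box_pt {d} N f.

Definition IntR (z : int) : R :=
  match z with
  | Posz n => INR n
  | Negz n => (- INR (S n))%R
  end.

Open Scope R_scope.

Definition Config (d : nat) := Zd d -> R.

Definition Rsum_seq {I : Type} (s : seq I) (F : I -> R) : R :=
  \big[Rplus/R0]_(i <- s) F i.

Definition in_ball {d : nat} (r : R) (j k : Zd d) : Prop :=
  INR (norm1 (vsub k j)) <= r.

Definition tau {d : nat} (k : Zd d) (l : int) (x : Config d) : Config d :=
  fun i => x (vadd i k) + IntR l.

Definition upd {d : nat} (x : Config d) (i : Zd d) (h : R) : Config d :=
  fun k => if k == i then h else x k.

Definition is_partial {d : nat} (F : Config d -> R) (i : Zd d) (G : Config d -> R) : Prop :=
  forall x : Config d, derivable_pt_lim (fun h => F (upd x i h)) (x i) (G x).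

Definition cont_ball {d : nat} (r : R) (j : Zd d) (F : Config d -> R) : Prop :=
  forall (x : Config d) (eps : R), 0 < eps ->
    exists delta, 0 < delta /\
      forall y : Config d, (forall k, in_ball r j k -> Rabs (y k - x k) < delta) ->
        Rabs (F y - F x) < eps.

Definition condA {d : nat} (r : R) (S : Zd d -> Config d -> R)
    (dS : Zd d -> Zd d -> Config d -> R)
    (d2S : Zd d -> Zd d -> Zd d -> Config d -> R) : Prop :=
  0 < r /\
  (forall (j : Zd d) (x y : Config d),
      (forall k, in_ball r j k -> x k = y k) -> S j x = S j y) /\
  (forall j i, is_partial (S j) i (dS j i)) /\
  (forall j i k, is_partial (dS j i) k (d2S j i k)) /\
  (forall j i, cont_ball r j (dS j i)) /\
  (forall j i k, cont_ball r j (d2S j i k)).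

Definition condB {d : nat} (S : Zd d -> Config d -> R) : Prop :=
  forall (j k : Zd d) (l : int) (x : Config d), S j (tau k l x) = S (vadd j k) x.

Definition condC {d : nat} (S : Zd d -> Config d -> R) : Prop :=
  forall j : Zd d,
    (exists m, forall x, m <= S j x) /\
    (forall k, norm1 (vsub k j) = 1%nat ->
       forall M, exists K, forall x, K < Rabs (x k - x j) -> M < S j x).

Definition condD {d : nat} (d2S : Zd d -> Zd d -> Zd d -> Config d -> R) : Prop :=
  (forall j i k x, i <> k -> d2S j i k x <= 0) /\
  (forall i k x, norm1 (vsub i k) = 1%nat -> d2S i i k x < 0).

Definition condE {d : nat} (d2S : Zd d -> Zd d -> Zd d -> Config d -> R) : Prop :=
  exists C, forall j i k x, Rabs (d2S j i k x) <= C.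

(* floor of r as a nat: ||k|| <= r  <->  ||k|| <= rad r *)
Definition rad (r : R) : nat := Z.to_nat (Int_part r).

Definition gradW {d : nat} (r : R) (dS : Zd d -> Zd d -> Config d -> R)
    (x : Config d) (i : Zd d) : R :=
  \big[Rplus/R0]_(f : {ffun 'I_d -> 'I_(Nat.add (Nat.mul 2 (rad r)) 1)} | Nat.leb (norm1 (box_pt (rad r) f)) (rad r))
     dS (vadd i (box_pt (rad r) f)) i x.

(* the weighted l^1 norm ||z||_X = sum_i 2^{-||i||} |z_i| is <= M *)
Definition normX_le {d : nat} (z : Config d) (M : R) : Prop :=
  forall s : seq (Zd d), uniq s ->
    Rsum_seq s (fun i => (/ 2) ^ (norm1 i) * Rabs (z i)) <= M.

Definition inX {d : nat} (x : Config d) : Prop := exists M, normX_le x M.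

Definition is_flow {d : nat} (r : R) (dS : Zd d -> Zd d -> Config d -> R)
    (Psi : R -> Config d -> Config d) : Prop :=
  forall x : Config d, inX x ->
    Psi 0 x = x /\
    forall t : R, inX (Psi t x) /\
      forall eps, 0 < eps -> exists delta, 0 < delta /\
        forall h, h <> 0 -> Rabs h < delta ->
          normX_le (fun i => (Psi (t + h) x i - Psi t x i) / h
                             + gradW r dS (Psi t x) i) eps.

Definition inXpq {d : nat} (p : 'M[int]_d) (q : 'rV[int]_d) (x : Config d) : Prop :=
  forall j : 'I_d, tau (pcol p j) (q ord0 j) x = x.

Definition tangent {d : nat} (p : 'M[int]_d) (v : Config d) : Prop :=
  forall (j : 'I_d) (i : Zd d), v (vadd i (pcol p j)) = v i.

Definition enumerates_Bp {d : nat} (p : 'M[int]_d) (bp : seq (Zd d)) : Prop :=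
  uniq bp /\ forall k, k \in bp <-> inBp p k.

Definition Wpq {d : nat} (S : Zd d -> Config d -> R) (bp : seq (Zd d)) (x : Config d) : R :=
  Rsum_seq bp (fun j => S j x).

Definition dd {d : nat} (F : Config d -> R) (x v : Config d) (D : R) : Prop :=
  derivable_pt_lim (fun s => F (fun i => x i + s * v i)) 0 D.

Definition critical {d : nat} (p : 'M[int]_d) (q : 'rV[int]_d)
    (W : Config d -> R) (x : Config d) : Prop :=
  inXpq p q x /\ forall v, tangent p v -> dd W x v 0.

Definition hess_is {d : nat} (p : 'M[int]_d) (q : 'rV[int]_d)
    (W : Config d -> R) (x v w : Config d) (h : R) : Prop :=
  exists g : Config d -> R,
    (forall y, inXpq p q y -> dd W y v (g y)) /\ dd g x w h.

Definition nondegenerate {d : nat} (p : 'M[int]_d) (q : 'rV[int]_d)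
    (W : Config d -> R) (x : Config d) : Prop :=
  forall v, tangent p v ->
    (forall w, tangent p w -> hess_is p q W x v w 0) -> forall i, v i = 0.

Definition morse {d : nat} (p : 'M[int]_d) (q : 'rV[int]_d) (W : Config d -> R) : Prop :=
  forall x, critical p q W x -> nondegenerate p q W x.

Definition ipBp {d : nat} (bp : seq (Zd d)) (v w : Config d) : R :=
  Rsum_seq bp (fun k => v k * w k).

(* v is an eigenvector, with eigenvalue lam, of the Hessian matrix of
   W_{p,q} at x (in the coordinates R^{B_p}) *)
Definition hess_eigvec {d : nat} (p : 'M[int]_d) (q : 'rV[int]_d) (bp : seq (Zd d))
    (W : Config d -> R) (x : Config d) (lam : R) (v : Config d) : Prop :=
  tangent p v /\ (exists i, v i <> 0) /\
  forall w, tangent p w -> hess_is p q W x v w (lam * ipBp bp v w).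

Definition lin_indep {d : nat} (m : nat) (vs : 'I_m -> Config d) : Prop :=
  forall c : 'I_m -> R,
    (forall i, \big[Rplus/R0]_(a < m) (c a * vs a i) = 0) -> forall a, c a = 0.

Definition in_span {d : nat} (m : nat) (vs : 'I_m -> Config d) (v : Config d) : Prop :=
  exists c : 'I_m -> R, forall i, v i = \big[Rplus/R0]_(a < m) (c a * vs a i).

(* Morse index of the critical point x is m: the Hessian has exactly m
   negative eigenvalues counted with multiplicity, i.e. the span of the
   eigenvectors with negative eigenvalues has dimension m *)
Definition morse_index {d : nat} (p : 'M[int]_d) (q : 'rV[int]_d) (bp : seq (Zd d))
    (W : Config d -> R) (x : Config d) (m : nat) : Prop :=
  exists vs : 'I_m -> Config d,
    (forall a, exists lam, lam < 0 /\ hess_eigvec p q bp W x lam (vs a)) /\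
    lin_indep vs /\
    (forall lam v, lam < 0 -> hess_eigvec p q bp W x lam v -> in_span vs v).

Definition open_pw {d : nat} (U : Config d -> Prop) : Prop :=
  forall x, U x -> exists (F : seq (Zd d)) (eps : R), 0 < eps /\
    forall y, (forall i, i \in F -> Rabs (y i - x i) < eps) -> U y.

Definition closed_pw {d : nat} (G : Config d -> Prop) : Prop :=
  forall x, (forall (F : seq (Zd d)) (eps : R), 0 < eps ->
               exists y, G y /\ forall i, i \in F -> Rabs (y i - x i) < eps) ->
            G x.

Definition connected_pw {d : nat} (G : Config d -> Prop) : Prop :=
  forall U V : Config d -> Prop, open_pw U -> open_pw V ->
    (forall x, G x -> U x \/ V x) ->
    (forall x, G x -> U x -> V x -> False) ->
    (forall x, G x -> U x) \/ (forall x, G x -> V x).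

Definition sll {d : nat} (x y : Config d) : Prop := forall i, x i < y i.

Definition ghost_circle {d : nat} (Psi : R -> Config d -> Config d)
    (G : Config d -> Prop) : Prop :=
  (exists x, G x) /\
  closed_pw G /\
  connected_pw G /\
  (forall x y, G x -> G y -> sll x y \/ x = y \/ sll y x) /\
  (forall k l x, G x -> G (tau k l x)) /\
  (forall t, (forall x, G x -> G (Psi t x)) /\
             (forall y, G y -> exists x, G x /\ Psi t x = y)).

Definition C1_curve {d : nat} (G : Config d -> Prop) : Prop :=
  exists (gam : R -> Config d) (dgam : R -> Config d),
    (forall i s, derivable_pt_lim (fun u => gam u i) s (dgam s i)) /\
    (forall i, continuity (fun s => dgam s i)) /\
    (forall s, exists i, dgam s i <> 0) /\
    (forall s1 s2, gam s1 = gam s2 -> s1 = s2) /\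
    (forall x, G x <-> exists s, gam s = x).

Definition lim_pinf (f : R -> R) (L : R) : Prop :=
  forall eps, 0 < eps -> exists T, forall t, T < t -> Rabs (f t - L) < eps.
Definition lim_minf (f : R -> R) (L : R) : Prop :=
  forall eps, 0 < eps -> exists T, forall t, t < T -> Rabs (f t - L) < eps.

(* Main.v *)
(* In a fundamental domain the negative gradient flow on [X_{p,q}] is a cooperative,
   irreducible, shift-equivariant gradient flow on [R^N], hence strongly monotone. At a
   critical point the Hessian has a simple lowest eigenvalue with a positive (Perron)
   eigenvector. Minimizers are totally ordered by submodularity, so one chooses a minimizer
   [x], a generator [T] of the shifts modulo the periods with [x << T x], and a maximal chain
   of index-zero points from [x] to [T x] containing all minimizers in between. Between two
   consecutive ones [a << b], the order interval contains other critical points, because the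
   basins of [a] and [b] are open and disjoint; such points are unstable, and one of least
   energy has index one. Starting from it along the positive eigenvector, orbits are monotone
   and converge to [a] and [b]; compactness gives heteroclinic orbits. A positive solution of
   [y' = - M y + o(y)] becomes parallel to the Perron eigenvector, which gives common tangents
   at the critical points. Parametrised by the sum of the coordinates, the union of the
   translates of this chain is a [C^1] curve. *)
Require Import Defs.
From HB Require Import structures.
From mathcomp Require Import all_boot all_order all_algebra.
From mathcomp Require Import ssrZ.
From Stdlib Require Import ZArith Reals Lra Psatz FunctionalExtensionality PropExtensionality Classical ClassicalEpsilon.
Set Implicit Arguments. Unset Strict Implicit. Unset Printing Implicit Defensive.
Open Scope R_scope.
(* The key [%R] denotes the scope of the Stdlib reals here. *)
Delimit Scope ring_scope with rg.

(** * Finite sums, derivatives and compactness *)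

(** Two obstacles shape the argument. Smoothness at the critical points is wanted without invariant
    manifold theory, so the end tangents of the connecting orbits come from a differential
    inequality for the angle to the Perron vector. This vector depends on the critical point alone,
    hence orbits that arrive from opposite sides share a tangent without being compared; a spectral
    gap, obtained from Rayleigh quotients, is all that is used of the rest of the spectrum. The
    second obstacle is the infinite lattice: a Gronwall estimate in the weighted norm gives
    uniqueness, and uniqueness makes the periodic configurations invariant under the given flow. The
    rest takes place in a finite-dimensional system [gsys], known only through directional
    derivatives, so that even the symmetry of the Hessian is proved. Two symmetries save work:
    [x -> - x] reverses the order and keeps the class of systems, and the shifts modulo periods form
    an infinite cyclic group because [omega] is rational. Its generator raises the sum of the
    coordinates by a fixed positive amount, which makes that sum a global parameter. *)

Lemma Rplus_assoc_ssr : associative Rplus.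
Proof. by move=> x y z; rewrite Rplus_assoc. Qed.
HB.instance Definition _ :=
  Monoid.isComLaw.Build R R0 Rplus Rplus_assoc_ssr Rplus_comm Rplus_0_l.
HB.instance Definition _ := Monoid.isMulLaw.Build R R0 Rmult Rmult_0_l Rmult_0_r.
HB.instance Definition _ :=
  Monoid.isAddLaw.Build R Rmult Rplus Rmult_plus_distr_r Rmult_plus_distr_l.

Notation "\rsum_ i F" := (\big[Rplus/R0]_i F)
  (at level 41, F at level 41, i at level 0, right associativity).

Lemma Rabs_bnd a b : Rabs a <= b -> - b <= a <= b.
Proof. by move=> h; have := Rle_abs a; have := Rle_abs (- a); rewrite Rabs_Ropp; lra. Qed.

Section Sums.
Variables (J : Type) (s : seq J) (P : pred J).

Lemma bsum_le (F G : J -> R) : (forall i, P i -> F i <= G i) ->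
  \big[Rplus/R0]_(i <- s | P i) F i <= \big[Rplus/R0]_(i <- s | P i) G i.
Proof. by move=> h; elim/big_ind2: _ => //; [lra | move=> *; lra]. Qed.

Lemma bsum_ge0 (F : J -> R) : (forall i, P i -> 0 <= F i) ->
  0 <= \big[Rplus/R0]_(i <- s | P i) F i.
Proof. by move=> h; elim/big_ind: _ => //; [lra | move=> *; lra]. Qed.

Lemma bsum_abs (F : J -> R) :
  Rabs (\big[Rplus/R0]_(i <- s | P i) F i) <= \big[Rplus/R0]_(i <- s | P i) Rabs (F i).
Proof.
elim/big_ind2: _ => [|x1 x2 y1 y2 h1 h2|i _]; first by rewrite Rabs_R0; lra.
- by apply: Rle_trans (Rabs_triang _ _) _; lra.
- lra.
Qed.

Lemma bsum_opp (F : J -> R) :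
  \big[Rplus/R0]_(i <- s | P i) (- F i) = - \big[Rplus/R0]_(i <- s | P i) F i.
Proof.
elim/big_ind2: _ => [|x1 x2 y1 y2 -> ->|i _] //; lra.
Qed.

Lemma bsum_minus (F G : J -> R) :
  \big[Rplus/R0]_(i <- s | P i) (F i - G i) =
  \big[Rplus/R0]_(i <- s | P i) F i - \big[Rplus/R0]_(i <- s | P i) G i.
Proof. by rewrite /Rminus big_split /= bsum_opp. Qed.

Lemma bsum_add (F G : J -> R) :
  \big[Rplus/R0]_(i <- s | P i) (F i + G i) =
  \big[Rplus/R0]_(i <- s | P i) F i + \big[Rplus/R0]_(i <- s | P i) G i.
Proof. by rewrite big_split. Qed.

Lemma bsum_scal a (F : J -> R) :
  \big[Rplus/R0]_(i <- s | P i) (a * F i) = a * \big[Rplus/R0]_(i <- s | P i) F i.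
Proof. by rewrite big_distrr. Qed.

Lemma bsum_scalr a (F : J -> R) :
  \big[Rplus/R0]_(i <- s | P i) (F i * a) = (\big[Rplus/R0]_(i <- s | P i) F i) * a.
Proof. by rewrite big_distrl. Qed.
End Sums.

Section FinSums.
Variable I : finType.
Implicit Types (F : I -> R).

Lemma rsum_term F i : (forall j, 0 <= F j) -> F i <= \rsum_j F j.
Proof.
move=> h; rewrite (bigD1 i) //=.
have : 0 <= \big[Rplus/R0]_(j | j != i) F j by exact: bsum_ge0.
lra.
Qed.

Lemma rsum_gt0 F i : (forall j, 0 <= F j) -> 0 < F i -> 0 < \rsum_j F j.
Proof. by move=> h hi; have := rsum_term i h; lra. Qed.

Lemma rsum_eq0 F : (forall j, 0 <= F j) -> \rsum_j F j = 0 -> forall i, F i = 0.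
Proof. by move=> h h0 i; have := rsum_term i h; have := h i; lra. Qed.

Lemma rsum_const (c : R) : \big[Rplus/R0]_(i : I) c = INR #|I| * c.
Proof.
rewrite big_const; elim: #|I| => [|n IH]; first by rewrite /=; lra.
by rewrite iterS IH S_INR; lra.
Qed.

Lemma rsum_delta F (i : I) : \rsum_j (if j == i then F j else 0) = F i.
Proof.
rewrite (bigD1 i) //= eqxx big1 ?Rplus_0_r // => j /negbTE -> //.
Qed.
End FinSums.

Lemma derivable_pt_lim_eqf (f g : R -> R) x l :
  (forall t, g t = f t) -> derivable_pt_lim f x l -> derivable_pt_lim g x l.
Proof. by move=> h; apply: derivable_pt_lim_ext. Qed.

Lemma derivable_pt_lim_eql (f : R -> R) x l l' :
  l = l' -> derivable_pt_lim f x l -> derivable_pt_lim f x l'.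
Proof. by move->. Qed.

Lemma derivable_pt_lim_sum (J : Type) (s : seq J) (P : pred J)
    (F : J -> R -> R) (l : J -> R) x :
  (forall i, P i -> derivable_pt_lim (F i) x (l i)) ->
  derivable_pt_lim (fun t => \big[Rplus/R0]_(i <- s | P i) F i t) x
    (\big[Rplus/R0]_(i <- s | P i) l i).
Proof.
move=> h; elim: s => [|a s IH].
  rewrite big_nil; apply: (@derivable_pt_lim_eqf (fct_cte 0)).
    by move=> t; rewrite big_nil.
  exact: derivable_pt_lim_const.
rewrite big_cons; case: ifP => Pa.
  apply: (@derivable_pt_lim_eqf
    (F a + (fun t => \big[Rplus/R0]_(i <- s | P i) F i t))%F).
    by move=> t; rewrite big_cons Pa.
  by apply: derivable_pt_lim_plus; [exact: h | exact: IH].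
apply: derivable_pt_lim_eqf IH => t; by rewrite big_cons Pa.
Qed.

Lemma derivable_pt_lim_cont f x l : derivable_pt_lim f x l -> continuity_pt f x.
Proof. by move=> h; apply: derivable_continuous_pt; exists l. Qed.

Lemma continuity_pt_eps f x : continuity_pt f x <->
  (forall e, 0 < e -> exists d, 0 < d /\ forall y, Rabs (y - x) < d -> Rabs (f y - f x) < e).
Proof.
split=> [h e he|h e he].
  case: (h e he) => d [hd h2]; exists d; split=> // y hy.
  have [->|ne] := Req_dec y x; first by rewrite Rminus_diag Rabs_R0.
  by apply: h2; split => //; split => //; exact: not_eq_sym.
by case: (h e he) => d [hd h2]; exists d; split=> // y [_ hy]; exact: h2.
Qed.

(** [Rmin] and [Rmax] cover both orders of the endpoints and the case [a = b]; increments [h * v a]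
    of unknown sign, possibly zero, occur later. *)
Lemma mvt (f f' : R -> R) (a b : R) :
  (forall c, Rmin a b <= c <= Rmax a b -> derivable_pt_lim f c (f' c)) ->
  exists c, f b - f a = f' c * (b - a) /\ Rmin a b <= c <= Rmax a b.
Proof.
move=> h; have [lt|[eq|gt]] := Rtotal_order a b.
- rewrite Rmin_left ?Rmax_right in h |- *; try lra.
  by case: (MVT_cor2 f f' a b lt h) => c [h1 h2]; exists c; split => //; lra.
- by subst b; exists a; split; [lra|]; rewrite Rmin_left ?Rmax_left; lra.
- rewrite Rmin_right ?Rmax_left in h |- *; try lra.
  by case: (MVT_cor2 f f' b a gt h) => c [h1 h2]; exists c; split; lra.
Qed.

Lemma nondecr_of_deriv (f f' : R -> R) a b : a <= b ->
  (forall c, a <= c <= b -> derivable_pt_lim f c (f' c)) ->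
  (forall c, a <= c <= b -> 0 <= f' c) -> f a <= f b.
Proof.
move=> ab h1 h2; case: (@mvt f f' a b); rewrite Rmin_left ?Rmax_right //.
by move=> c [h3 h4]; have := h2 c h4; nra.
Qed.

(* Gronwall: [u exp(-K t)] is nonincreasing *)
Lemma gronwall (u u' : R -> R) K a b : a <= b ->
  (forall t, a <= t <= b -> derivable_pt_lim u t (u' t)) ->
  (forall t, a <= t <= b -> u' t <= K * u t) ->
  u b <= u a * exp (K * (b - a)).
Proof.
move=> ab hd hu.
have he t : derivable_pt_lim (fun t => exp (- (K * (t - a)))) t (exp (- (K * (t - a))) * - K).
  apply: (@derivable_pt_lim_comp (fun t => - (K * (t - a))) exp); last exact: derivable_pt_lim_exp.
  apply: (@derivable_pt_lim_eqf (mult_real_fct (- K) (id - fct_cte a)%F)).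
    by move=> s; rewrite /mult_real_fct /minus_fct /fct_cte /id; ring.
  apply: (@derivable_pt_lim_eql _ _ (- K * (1 - 0))); first by ring.
  apply: (derivable_pt_lim_scal (id - fct_cte a)%F); apply: derivable_pt_lim_minus; first exact: derivable_pt_lim_id.
  exact: derivable_pt_lim_const.
have := @nondecr_of_deriv (fun t => - (u t * exp (- (K * (t - a)))))
  (fun t => - (u' t * exp (- (K * (t - a))) + u t * (exp (- (K * (t - a))) * - K))) a b ab.
move=> H.
have {}H : - (u a * exp (- (K * (a - a)))) <= - (u b * exp (- (K * (b - a)))).
  apply: H => t ht.
    apply: derivable_pt_lim_opp; apply: derivable_pt_lim_mult; [exact: hd|exact: he].
  have := hu t ht; have := exp_pos (- (K * (t - a))); nra.
rewrite Rminus_diag Rmult_0_r Ropp_0 exp_0 in H.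
have e1 : exp (K * (b - a)) * exp (- (K * (b - a))) = 1.
  by rewrite -exp_plus Rplus_opp_r exp_0.
have p1 := exp_pos (K * (b - a)).
have p2 := exp_pos (- (K * (b - a))).
have : u b * exp (- (K * (b - a))) * exp (K * (b - a)) <= u a * exp (K * (b - a)) by nra.
rewrite Rmult_assoc (Rmult_comm (exp _)) e1; lra.
Qed.

(** Finitely many radii have a positive minimum; the second hypothesis lets each property survive
    the smaller radius. *)
Lemma fin_delta (I : finType) (P : I -> R -> Prop) :
  (forall i, exists d, 0 < d /\ P i d) ->
  (forall i d d', 0 < d' <= d -> P i d -> P i d') -> exists d, 0 < d /\ forall i, P i d.
Proof.
move=> h hm.
have hh (l : seq I) : exists d, 0 < d /\ forall i, i \in l -> P i d.
  elim: l => [|x l [d [dp IH]]]; first by exists 1; split; [lra|].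
  case: (h x) => d' [dp' h'].
  have q : 0 < Rmin d d' by exact: Rmin_glb_lt.
  exists (Rmin d d'); split=> // i; rewrite inE => /orP[/eqP->|hi].
    by apply: hm h'; split=> //; exact: Rmin_r.
  by apply: hm (IH i hi); split=> //; exact: Rmin_l.
by case: (hh (enum I)) => d [dp hd]; exists d; split=> // i; apply: hd; rewrite mem_enum.
Qed.

Definition seq_lim (u : nat -> R) (l : R) := forall e, 0 < e ->
  exists N : nat, forall n : nat, (N <= n)%nat -> Rabs (u n - l) < e.

Definition strict_mono (phi : nat -> nat) := forall n, (phi n < phi n.+1)%nat.

Lemma strict_mono_ge phi : strict_mono phi -> forall n, (n <= phi n)%nat.
Proof.
move=> h; elim=> // n IH; exact: leq_ltn_trans IH (h n).
Qed.

Lemma strict_mono_lt phi : strict_mono phi -> forall n m, (n < m)%nat -> (phi n < phi m)%nat.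
Proof.
move=> h n; elim=> // m IH; rewrite ltnS leq_eqVlt => /orP[/eqP->|/IH lt]; first exact: h.
exact: ltn_trans lt (h m).
Qed.

Lemma strict_mono_comp phi psi : strict_mono phi -> strict_mono psi -> strict_mono (phi \o psi).
Proof. by move=> h1 h2 n; apply: (strict_mono_lt h1); exact: h2. Qed.

Lemma seq_lim_sub u l phi : strict_mono phi -> seq_lim u l -> seq_lim (u \o phi) l.
Proof.
move=> hp h e he; case: (h e he) => N hN; exists N => n hn.
by apply: hN; apply: leq_trans hn (strict_mono_ge hp n).
Qed.

Lemma seq_lim_unique u l1 l2 : seq_lim u l1 -> seq_lim u l2 -> l1 = l2.
Proof.
move=> h1 h2; apply: NNPP => ne.
have he : 0 < Rabs (l1 - l2) / 2 by have := Rabs_pos_lt (l1 - l2); lra.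
case: (h1 _ he) => N1 H1; case: (h2 _ he) => N2 H2.
have := H1 (maxn N1 N2) (leq_maxl _ _); have := H2 (maxn N1 N2) (leq_maxr _ _).
set x := u _; move: (Rabs_triang (l1 - x) (x - l2)); rewrite (Rabs_minus_sym l1 x).
replace (l1 - x + (x - l2)) with (l1 - l2) by ring; lra.
Qed.

Lemma seq_lim_le u l a : seq_lim u l -> (exists N : nat, forall n, (N <= n)%nat -> u n <= a) -> l <= a.
Proof.
move=> h [M hM]; apply: Rnot_lt_le => lt.
case: (h (l - a)) => [|N hN]; first lra.
have := hN (maxn M N) (leq_maxr _ _); have := hM (maxn M N) (leq_maxl _ _).
by move=> h1 /Rabs_def2; lra.
Qed.

Lemma seq_lim_ge u l a : seq_lim u l -> (exists N : nat, forall n, (N <= n)%nat -> a <= u n) -> a <= l.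
Proof.
move=> h [M hM]; apply: Rnot_lt_le => lt.
case: (h (a - l)) => [|N hN]; first lra.
have := hN (maxn M N) (leq_maxr _ _); have := hM (maxn M N) (leq_maxl _ _).
by move=> h1 /Rabs_def2; lra.
Qed.

Lemma bolzano1 (u : nat -> R) (B : R) : (forall n, Rabs (u n) <= B) ->
  exists phi l, strict_mono phi /\ seq_lim (u \o phi) l.
Proof.
move=> hB.
have hc := compact_P3 (- B) B.
case: (@Bolzano_Weierstrass u _ hc) => [n|l hl].
  exact: Rabs_bnd (hB n).
(* The cluster point has terms within [/ INR k.+1] beyond every index [N]; choosing them one after
   another gives the subsequence. *)
have step N (k : nat) : exists m, (N < m)%nat /\ Rabs (u m - l) < / INR k.+1.
  have hk : 0 < / INR k.+1 by apply: Rinv_0_lt_compat; apply: lt_0_INR; apply/ltP.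
  case: (hl (disc l (mkposreal _ hk)) N.+1) => [|m [/leP h1 h2]].
    by exists (mkposreal _ hk) => x.
  by exists m.
pose nxt N k := proj1_sig (constructive_indefinite_description _ (step N k)).
have nxtP N k : (N < nxt N k)%nat /\ Rabs (u (nxt N k) - l) < / INR k.+1.
  by rewrite /nxt; case: constructive_indefinite_description.
pose phi := fix phi n := match n with 0%nat => nxt 0%nat 0%nat | n'.+1 => nxt (phi n') n end.
exists phi, l; split; first by move=> n; case: (nxtP (phi n) n.+1).
have hphi n : Rabs (u (phi n) - l) < / INR n.+1.
  by case: n => [|n]; [case: (nxtP 0%nat 0%nat) | case: (nxtP (phi n) n.+1)].
move=> e he; case: (archimed_cor1 e he) => N [h1 h2]; exists N => n hn.
apply: Rlt_trans (hphi n) _; apply: Rle_lt_trans h1.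
apply: Rinv_le_contravar; first by apply: lt_0_INR.
by apply: le_INR; apply/leP; apply: leq_trans hn _.
Qed.

(** * Finite-dimensional vectors: limits, scalar product, sum and l1 norm *)

Section Vec.
Variable I : finType.
Local Notation V := (I -> R).
Implicit Types x y z v w : V.

Definition vlim (u : nat -> V) (l : V) := forall i, seq_lim (fun n => u n i) (l i).

Lemma bolzano (u : nat -> V) (B : R) : (forall n i, Rabs (u n i) <= B) ->
  exists phi l, strict_mono phi /\ vlim (u \o phi) l.
Proof.
move=> hB.
have H (s : seq I) : exists phi (l : V), strict_mono phi /\
    forall i, i \in s -> seq_lim (fun n => u (phi n) i) (l i).
  elim: s => [|a s [phi [l [h1 h2]]]]; first by exists (fun n => n), (fun _ => 0); split.
  case: (@bolzano1 (fun n => u (phi n) a) B) => [n|psi [la [h3 h4]]]; first exact: hB.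
  exists (phi \o psi), (fun i => if i == a then la else l i).
  split; first exact: strict_mono_comp.
  move=> i; rewrite inE; case: eqP => [->|_] //=.
  by move=> hi; apply: (seq_lim_sub h3 (h2 i hi)).
case: (H (enum I)) => phi [l [h1 h2]]; exists phi, l; split=> // i.
by apply: h2; rewrite mem_enum.
Qed.

Lemma vlim_unif u l : vlim u l -> forall e, 0 < e ->
  exists N : nat, forall n i, (N <= n)%nat -> Rabs (u n i - l i) < e.
Proof.
move=> h e he.
have H (s : seq I) : exists N : nat, forall n i, i \in s -> (N <= n)%nat -> Rabs (u n i - l i) < e.
  elim: s => [|a s [N hN]]; first by exists 0%nat.
  case: (h a e he) => M hM; exists (maxn N M) => n i; rewrite inE geq_max => /orP[/eqP->|hi] /andP[h1 h2].
    exact: hM.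
  exact: hN.
case: (H (enum I)) => N hN; exists N => n i hn; apply: hN => //; by rewrite mem_enum.
Qed.

Definition dot x y := \rsum_i (x i * y i).
Definition sg x := \rsum_i x i.
Definition nrm x := \rsum_i Rabs (x i).

Lemma dotC x y : dot x y = dot y x.
Proof. by apply: eq_bigr => i _; lra. Qed.

Lemma dotDl x y z : dot (fun i => x i + y i) z = dot x z + dot y z.
Proof. by rewrite /dot -big_split; apply: eq_bigr => i _ /=; lra. Qed.
Lemma dotDr x y z : dot z (fun i => x i + y i) = dot z x + dot z y.
Proof. by rewrite dotC dotDl dotC (dotC y). Qed.
Lemma dotZl a x z : dot (fun i => a * x i) z = a * dot x z.
Proof. by rewrite /dot -bsum_scal; apply: eq_bigr => i _ /=; lra. Qed.
Lemma dotZr a x z : dot z (fun i => a * x i) = a * dot z x.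
Proof. by rewrite dotC dotZl dotC. Qed.
Lemma dotNl x z : dot (fun i => - x i) z = - dot x z.
Proof. by rewrite /dot -bsum_opp; apply: eq_bigr => i _ /=; lra. Qed.
Lemma dotNr x z : dot z (fun i => - x i) = - dot z x.
Proof. by rewrite dotC dotNl dotC. Qed.
Lemma dotBl x y z : dot (fun i => x i - y i) z = dot x z - dot y z.
Proof. by rewrite /dot -bsum_minus; apply: eq_bigr => i _ /=; lra. Qed.
Lemma dotBr x y z : dot z (fun i => x i - y i) = dot z x - dot z y.
Proof. by rewrite dotC dotBl dotC (dotC y). Qed.

Lemma dot_ge0 x : 0 <= dot x x.
Proof. by apply: bsum_ge0 => i _; nra. Qed.

Lemma dot_eq0 x : dot x x = 0 -> forall i, x i = 0.
Proof.
move=> h i; have := @rsum_eq0 _ (fun i => x i * x i) (fun j => Rle_0_sqr (x j)) h i; nra.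
Qed.

Lemma dot_gt0 x i : x i <> 0 -> 0 < dot x x.
Proof. by move=> h; case: (dot_ge0 x) => // /esym /dot_eq0 /(_ i). Qed.

Lemma nrm_ge0 x : 0 <= nrm x.
Proof. by apply: bsum_ge0 => i _; exact: Rabs_pos. Qed.

Lemma nrm_coord x i : Rabs (x i) <= nrm x.
Proof. by apply: (@rsum_term _ (fun i => Rabs (x i))) => j; exact: Rabs_pos. Qed.

Lemma nrm_eq0 x : nrm x = 0 -> forall i, x i = 0.
Proof.
move=> h i; have := nrm_coord x i; rewrite h; have := Rabs_pos (x i).
by move=> h1 h2; apply: NNPP => /Rabs_pos_lt; lra.
Qed.

Lemma nrm_gt0 x i : x i <> 0 -> 0 < nrm x.
Proof. by move=> h; case: (nrm_ge0 x) => // /esym /nrm_eq0 /(_ i). Qed.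

Lemma dot_abs x y : Rabs (dot x y) <= nrm x * nrm y.
Proof.
apply: Rle_trans (bsum_abs _ _ _) _.
rewrite /nrm -bsum_scalr; apply: bsum_le => i _; rewrite Rabs_mult.
apply: Rmult_le_compat_l; [exact: Rabs_pos | exact: nrm_coord].
Qed.

Lemma dot_le_nrm2 x : dot x x <= nrm x * nrm x.
Proof. by apply: Rle_trans (dot_abs x x); exact: Rle_abs. Qed.

Lemma nrm_triang x y : nrm (fun i => x i + y i) <= nrm x + nrm y.
Proof. by rewrite /nrm -big_split; apply: bsum_le => i _; exact: Rabs_triang. Qed.

Lemma nrmZ a x : nrm (fun i => a * x i) = Rabs a * nrm x.
Proof. by rewrite /nrm -bsum_scal; apply: eq_bigr => i _; rewrite Rabs_mult. Qed.

Lemma nrm_bound x B : (forall i, Rabs (x i) <= B) -> nrm x <= INR #|I| * B.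
Proof. by move=> h; rewrite -(rsum_const I); apply: bsum_le. Qed.

Lemma nrm_nonneg x : (forall i, 0 <= x i) -> nrm x = sg x.
Proof. by move=> h; apply: eq_bigr => i _; rewrite Rabs_pos_eq. Qed.

(** Cauchy-Schwarz against the constant vector, from the nonnegative double sum of the squares of
    [Rabs (x i) - Rabs (x j)]. *)
Lemma nrm_nrm x : (INR #|I| * dot x x) >= nrm x * nrm x.
Proof.
have : 0 <= \rsum_i \rsum_j ((Rabs (x i) - Rabs (x j)) * (Rabs (x i) - Rabs (x j))).
  by apply: bsum_ge0 => i _; apply: bsum_ge0 => j _; exact: Rle_0_sqr.
have -> : \rsum_i \rsum_j ((Rabs (x i) - Rabs (x j)) * (Rabs (x i) - Rabs (x j))) =
   INR #|I| * dot x x + INR #|I| * dot x x - 2 * (nrm x * nrm x).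
  have a2 a : Rabs a * Rabs a = a * a by rewrite -Rabs_mult Rabs_pos_eq //; nra.
  transitivity (\rsum_i (INR #|I| * (x i * x i) + dot x x - 2 * Rabs (x i) * nrm x)).
    apply: eq_bigr => i _.
    rewrite -(rsum_const I) /dot /nrm -bsum_scal -big_split -bsum_minus; apply: eq_bigr => j _ /=.
    have := a2 (x i); have := a2 (x j); nra.
  rewrite bsum_minus big_split /= rsum_const bsum_scal -/(dot x x).
  have -> : \rsum_i (2 * Rabs (x i) * nrm x) = 2 * (nrm x * nrm x).
    by rewrite bsum_scalr bsum_scal -/(nrm x); ring.
  by [].
lra.
Qed.

Lemma sgD x y : sg (fun i => x i + y i) = sg x + sg y. Proof. by rewrite /sg big_split. Qed.
Lemma sgB x y : sg (fun i => x i - y i) = sg x - sg y. Proof. by rewrite /sg bsum_minus. Qed.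
Lemma sgN x : sg (fun i => - x i) = - sg x. Proof. by rewrite /sg bsum_opp. Qed.
Lemma sgZ a x : sg (fun i => a * x i) = a * sg x. Proof. by rewrite /sg bsum_scal. Qed.

Lemma sg_abs x : Rabs (sg x) <= nrm x. Proof. exact: bsum_abs. Qed.

End Vec.

(** * Cooperative gradient systems *)

Lemma derivable_pt_lim_shift (g : R -> R) a l :
  derivable_pt_lim (fun s => g (a + s)) 0 l <-> derivable_pt_lim g a l.
Proof.
split=> h e he; case: (h e he) => d hd; exists d => k k0 kd.
  by have := hd k k0 kd; rewrite Rplus_0_r Rplus_0_l.
by have := hd k k0 kd; rewrite Rplus_0_r Rplus_0_l.
Qed.

Lemma derivable_pt_lim_addc (g : R -> R) a t l :
  derivable_pt_lim g (t + a) l -> derivable_pt_lim (fun s => g (s + a)) t l.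
Proof.
move=> h e he; case: (h e he) => d hd; exists d => k k0 kd.
have := hd k k0 kd; by rewrite (_ : t + k + a = t + a + k); last ring.
Qed.

Lemma derivable_pt_lim_rev (g : R -> R) t l :
  derivable_pt_lim g (- t) l -> derivable_pt_lim (fun s => g (- s)) t (- l).
Proof.
move=> h e he; case: (h e he) => d hd; exists d => k k0 kd.
have := hd (- k); rewrite Rabs_Ropp => H.
have {}H : Rabs ((g (- t + - k) - g (- t)) / - k - l) < e by apply: H => //; lra.
rewrite -Ropp_plus_distr in H.
rewrite -Rabs_Ropp (_ : - _ = (g (- (t + k)) - g (- t)) / - k - l) //.
by field.
Qed.

(** A two-sided derivative is already determined by the past. This is applied to a component that
    has been zero up to the final time of a comparison argument. *)
Lemma derivable_pt_lim_const_left (g : R -> R) a t l : a < t ->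
  (forall s, a <= s <= t -> g s = 0) -> derivable_pt_lim g t l -> l = 0.
Proof.
move=> at_ hg h; apply: NNPP => nl.
case: (h (Rabs l)) => [|d hd]; first exact: Rabs_pos_lt.
have dp := cond_pos d.
pose k := - Rmin (d / 2) (t - a).
have k1 : - k <= d / 2 by rewrite /k Ropp_involutive; exact: Rmin_l.
have k2 : - k <= t - a by rewrite /k Ropp_involutive; exact: Rmin_r.
have k3 : 0 < - k by rewrite /k Ropp_involutive; apply: Rmin_glb_lt; lra.
have := hd k; rewrite !hg; try lra.
move=> H; have : Rabs ((0 - 0) / k - l) < Rabs l.
  by apply: H; [lra | rewrite Rabs_left; lra].
rewrite (_ : (0 - 0) / k - l = - l) ?Rabs_Ropp; first lra.
by field; lra.
Qed.

(** The square of the negative part is differentiable although the negative part is not; the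
    first-order error lies between [0] and [h * h]. *)
Lemma deriv_neg_part_sq s : derivable_pt_lim (fun s => Rmin s 0 * Rmin s 0) s (2 * Rmin s 0).
Proof.
move=> e he; exists (mkposreal e he) => h h0 /= hd.
have key : 0 <= Rmin (s + h) 0 * Rmin (s + h) 0 - Rmin s 0 * Rmin s 0 - 2 * Rmin s 0 * h <= h * h.
  by rewrite /Rmin; case: Rle_dec => h1; case: Rle_dec => h2; nra.
set D := _ - _ in key.
have hD : Rmin (s + h) 0 * Rmin (s + h) 0 - Rmin s 0 * Rmin s 0 = 2 * Rmin s 0 * h + D by rewrite /D; ring.
rewrite hD (_ : _ - _ = D / h); last by field.
apply: Rle_lt_trans hd; rewrite /Rdiv Rabs_mult Rabs_inv.
have hp := Rabs_pos_lt h h0.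
apply: (Rmult_le_reg_r (Rabs h)) => //.
rewrite Rmult_assoc Rinv_l; last lra.
rewrite Rmult_1_r -Rabs_mult !Rabs_pos_eq; lra || nra.
Qed.

(** * Componentwise order *)

Section Order.
Variable I : finType.
Implicit Types x y z : I -> R.
Definition vle x y := forall i, x i <= y i.
Definition vlt x y := forall i, x i < y i.
Lemma vle_refl x : vle x x. Proof. move=> i; lra. Qed.
Lemma vle_trans y x z : vle x y -> vle y z -> vle x z.
Proof. by move=> h1 h2 i; have := h1 i; have := h2 i; lra. Qed.
Lemma vlt_le x y : vlt x y -> vle x y.
Proof. by move=> h i; have := h i; lra. Qed.
Lemma vlt_le_trans y x z : vlt x y -> vle y z -> vlt x z.
Proof. by move=> h1 h2 i; have := h1 i; have := h2 i; lra. Qed.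
Lemma vle_lt_trans y x z : vle x y -> vlt y z -> vlt x z.
Proof. by move=> h1 h2 i; have := h1 i; have := h2 i; lra. Qed.
Lemma vle_anti x y : vle x y -> vle y x -> x = y.
Proof. by move=> h1 h2; apply: functional_extensionality => i; have := h1 i; have := h2 i; lra. Qed.
Lemma sg_le x y : vle x y -> sg x <= sg y.
Proof. by move=> h; apply: bsum_le. Qed.
Lemma vle_sg_eq x y : vle x y -> sg y <= sg x -> x = y.
Proof.
move=> h1 h2; apply: functional_extensionality => i.
have := @rsum_eq0 _ (fun i => y i - x i) => H.
suff : y i - x i = 0 by lra.
apply: H => [j|]; first by have := h1 j; lra.
rewrite bsum_minus -/(sg y) -/(sg x); have := sg_le h1; lra.
Qed.
Lemma vle_sg_lt x y : vle x y -> x <> y -> sg x < sg y.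
Proof. by move=> h1 h2; apply: Rnot_le_lt => h3; apply: h2; exact: vle_sg_eq. Qed.
Lemma vneq_coord x y : x <> y -> exists i, x i <> y i.
Proof.
move=> h; apply: NNPP => h2; apply: h; apply: functional_extensionality => i.
by apply: NNPP => h3; apply: h2; exists i.
Qed.
End Order.

Definition Mop (I : finType) (M : I -> I -> R) (v : I -> R) : I -> R :=
  fun i => \rsum_j (M i j * v j).

(* [f] is minus the gradient and [H] the Hessian of [W], through directional derivatives;
   the last field is irreducibility, uniformly in the point. *)
Record gsys (I : finType) (W : (I -> R) -> R) (f : (I -> R) -> I -> R)
    (H : (I -> R) -> I -> I -> R) (C : R) : Prop := Gsys {
  gs_W : forall x v, derivable_pt_lim (fun s => W (fun i => x i + s * v i)) 0 (- dot (f x) v);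
  gs_f : forall x v i, derivable_pt_lim (fun s => f (fun j => x j + s * v j) i) 0
           (- \rsum_j (H x i j * v j));
  gs_Hc : forall x e, 0 < e -> exists d, 0 < d /\ forall y, (forall i, Rabs (y i - x i) < d) ->
           forall i j, Rabs (H y i j - H x i j) < e;
  gs_C : forall x i j, Rabs (H x i j) <= C;
  gs_off : forall x i j, i <> j -> H x i j <= 0;
  gs_irr : forall A : I -> Prop, (exists i, A i) -> (exists j, ~ A j) ->
     exists i j, A i /\ ~ A j /\ forall x, H x i j < 0 }.

Definition vopp (I : finType) (x : I -> R) : I -> R := fun i => - x i.

Lemma voppK (I : finType) (x : I -> R) : vopp (vopp x) = x.
Proof. by apply: functional_extensionality => i; rewrite /vopp Ropp_involutive. Qed.

(** Conjugation by [x -> - x] keeps the off-diagonal signs of the Hessian and reverses the order, so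
    every statement about moving up yields its mirror image. *)
Lemma gsys_rev (I : finType) (W : (I -> R) -> R) f H C : gsys W f H C ->
  gsys (fun x => W (vopp x)) (fun x => vopp (f (vopp x))) (fun x => H (vopp x)) C.
Proof.
move=> [h1 h2 h3 h4 h5 h6]; split => //.
- move=> x v; have := h1 (vopp x) (vopp v).
  rewrite /vopp dotNr -dotNl; apply: derivable_pt_lim_eqf => t; congr (W _).
  by apply: functional_extensionality => i; ring.
- move=> x v i; have := h2 (vopp x) (vopp v) i.
  move/derivable_pt_lim_opp.
  rewrite -!bsum_opp => h; apply: derivable_pt_lim_eql; last first.
    apply: derivable_pt_lim_eqf h => t; rewrite /vopp /opp_fct; congr (- f _ _).
    by apply: functional_extensionality => j; ring.
  by apply: eq_bigr => j _; rewrite /vopp; ring.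
- move=> x e he; case: (h3 (vopp x) e he) => d [d0 hd]; exists d; split=> // y hy i j.
  apply: hd => k; rewrite /vopp -Rabs_Ropp.
  by rewrite (_ : - _ = y k - x k) //; ring.
- by move=> x i j; exact: h5.
- move=> A h7 h8; case: (h6 A h7 h8) => i [j [hi [hj hH]]]; exists i, j; do 2!split=> //.
Qed.

Section Dyn.
Variables (I : finType) (W : (I -> R) -> R) (f : (I -> R) -> I -> R).
Variables (H : (I -> R) -> I -> I -> R) (C : R).
Hypothesis HS : gsys W f H C.
Local Notation V := (I -> R).
Implicit Types x y z v w : V.
Local Notation N := (INR #|I|).

Lemma f_line x v i s : derivable_pt_lim (fun s => f (fun j => x j + s * v j) i) s
  (- \rsum_j (H (fun j => x j + s * v j) i j * v j)).
Proof.
apply/derivable_pt_lim_shift.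
apply: derivable_pt_lim_eqf (gs_f HS (fun j => x j + s * v j) v i) => t.
congr (f _ _); apply: functional_extensionality => j; ring.
Qed.

Lemma W_line x v s : derivable_pt_lim (fun s => W (fun j => x j + s * v j)) s
  (- dot (f (fun j => x j + s * v j)) v).
Proof.
apply/derivable_pt_lim_shift.
apply: derivable_pt_lim_eqf (gs_W HS (fun j => x j + s * v j) v) => t.
congr (W _); apply: functional_extensionality => j; ring.
Qed.

Definition seg x y s : V := fun j => x j + s * (y j - x j).

Lemma seg0 x y : seg x y 0 = x.
Proof. by apply: functional_extensionality => j; rewrite /seg; ring. Qed.
Lemma seg1 x y : seg x y 1 = y.
Proof. by apply: functional_extensionality => j; rewrite /seg; ring. Qed.

Lemma f_mvt x y i : exists s, 0 <= s <= 1 /\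
  f y i - f x i = - \rsum_j (H (seg x y s) i j * (y j - x j)).
Proof.
case: (@mvt (fun s => f (seg x y s) i) _ 0 1 (fun c _ => @f_line x (fun j => y j - x j) i c)) => s.
rewrite seg0 seg1 Rmin_left ?Rmax_right; try lra.
by move=> [-> h]; exists s; split=> //; rewrite Rminus_0_r Rmult_1_r.
Qed.

Lemma W_mvt x y : exists s, 0 <= s <= 1 /\
  W y - W x = - dot (f (seg x y s)) (fun j => y j - x j).
Proof.
case: (@mvt (fun s => W (seg x y s)) _ 0 1 (fun c _ => @W_line x (fun j => y j - x j) c)) => s.
rewrite seg0 seg1 Rmin_left ?Rmax_right; try lra.
by move=> [-> h]; exists s; split=> //; rewrite Rminus_0_r Rmult_1_r.
Qed.

Lemma seg_close x y s i : 0 <= s <= 1 -> Rabs (seg x y s i - x i) <= Rabs (y i - x i).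
Proof.
move=> hs; rewrite /seg (_ : _ - _ = s * (y i - x i)); last ring.
rewrite Rabs_mult (Rabs_pos_eq s); last lra.
have := Rabs_pos (y i - x i); nra.
Qed.

Lemma C_ge0 (i : I) : 0 <= C.
Proof. by apply: Rle_trans (gs_C HS (fun _ => 0) i i); exact: Rabs_pos. Qed.

Lemma f_lip x y i : Rabs (f y i - f x i) <= C * nrm (fun j => y j - x j).
Proof.
case: (f_mvt x y i) => s [_ ->]; rewrite Rabs_Ropp.
apply: Rle_trans (bsum_abs _ _ _) _; rewrite -bsum_scal; apply: bsum_le => j _.
rewrite Rabs_mult; apply: Rmult_le_compat_r; [exact: Rabs_pos | exact: (gs_C HS)].
Qed.

Lemma f_cont x e : 0 < e -> exists d, 0 < d /\ forall y,
  (forall i, Rabs (y i - x i) < d) -> forall i, Rabs (f y i - f x i) < e.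
Proof.
move=> he.
have [i0|noI] := pickP (fun _ : I => true); last by exists 1; split; [lra| move=> y _ i; have := noI i].
move=> _; have C0 := C_ge0 i0; have N0 := pos_INR #|I|.
exists (e / (C * N + 1)); split=> [|y hy i].
  by apply: Rdiv_lt_0_compat => //; nra.
apply: Rle_lt_trans (f_lip x y i) _.
have h : nrm (fun j => y j - x j) <= N * (e / (C * N + 1)).
  by apply: nrm_bound => j; apply: Rlt_le.
apply: (@Rle_lt_trans _ (C * (N * (e / (C * N + 1))))); first exact: Rmult_le_compat_l.
have p : 0 < C * N + 1 by nra.
apply: (Rmult_lt_reg_r (C * N + 1)) => //.
have -> : C * (N * (e / (C * N + 1))) * (C * N + 1) = C * N * e by field; lra.
nra.
Qed.

Lemma f_vlim u l : vlim u l -> vlim (fun n => f (u n)) (f l).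
Proof.
move=> h i e he; case: (f_cont l he) => d [d0 hd].
case: (vlim_unif h d0) => M hM; exists M => n hn; apply: hd => j; exact: hM.
Qed.

Lemma W_cont x e : 0 < e -> exists d, 0 < d /\ forall y,
  (forall i, Rabs (y i - x i) < d) -> Rabs (W y - W x) < e.
Proof.
move=> he; case: (@f_cont x 1 ltac:(lra)) => d [d0 hd].
have N0 := pos_INR #|I|.
(* [B] bounds the gradient on the neighbourhood where each coordinate of [f] moves by less than one;
   there [W] is Lipschitz. *)
pose B := nrm (f x) + N.
have B0 : 0 <= B by have := nrm_ge0 (f x); rewrite /B; lra.
have p : 0 < e / (B * N + 1) by apply: Rdiv_lt_0_compat => //; nra.
exists (Rmin d (e / (B * N + 1))); split=> [|y hy]; first exact: Rmin_glb_lt.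
case: (W_mvt x y) => s [hs ->]; rewrite Rabs_Ropp.
apply: Rle_lt_trans (dot_abs _ _) _.
have h1 : nrm (f (seg x y s)) <= B.
  have -> : f (seg x y s) = (fun i => f x i + (f (seg x y s) i - f x i)).
    by apply: functional_extensionality => i; ring.
  apply: Rle_trans (nrm_triang _ _) _; apply: Rplus_le_compat_l.
  rewrite -{1}(Rmult_1_r N); apply: nrm_bound => i; apply: Rlt_le; apply: hd => j.
  apply: Rle_lt_trans (seg_close x y j hs) _.
  by apply: Rlt_le_trans (hy j) (Rmin_l _ _).
have h2 : nrm (fun j => y j - x j) <= N * (e / (B * N + 1)).
  by apply: nrm_bound => j; apply: Rlt_le; apply: Rlt_le_trans (hy j) (Rmin_r _ _).
apply: (@Rle_lt_trans _ (B * (N * (e / (B * N + 1))))).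
  by apply: Rmult_le_compat => //; exact: nrm_ge0.
have q : 0 < B * N + 1 by nra.
apply: (Rmult_lt_reg_r (B * N + 1)) => //.
have -> : B * (N * (e / (B * N + 1))) * (B * N + 1) = B * N * e by field; lra.
nra.
Qed.

Lemma W_vlim u l : vlim u l -> seq_lim (fun n => W (u n)) (W l).
Proof.
move=> h e he; case: (W_cont l he) => d [d0 hd].
case: (vlim_unif h d0) => M hM; exists M => n hn; apply: hd => j; exact: hM.
Qed.

(* Second difference of [W], expanded in both orders. *)
Lemma H_dot_sym x v w : dot v (Mop (H x) w) = dot w (Mop (H x) v).
Proof.
(* The mean value theorem along [v1], for the increment of [W] under [t * w1], and then along [w1],
   for the gradient, places the whole second difference at one point [y] whose distance from [x] is
   of order [t]. *)
have key v1 w1 t : t <> 0 -> exists y, (forall i, Rabs (y i - x i) <= Rabs t * (Rabs (v1 i) + Rabs (w1 i))) /\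
   W (fun i => x i + t * v1 i + t * w1 i) - W (fun i => x i + t * v1 i) - W (fun i => x i + t * w1 i) + W x
   = t * t * dot v1 (Mop (H y) w1).
  move=> t0.
  have hd s : derivable_pt_lim (fun s => W (fun i => (x i + t * w1 i) + s * v1 i) - W (fun i => x i + s * v1 i)) s
     (- dot (f (fun i => (x i + t * w1 i) + s * v1 i)) v1 - - dot (f (fun i => x i + s * v1 i)) v1).
    by apply: derivable_pt_lim_minus; exact: W_line.
  case: (@mvt _ _ 0 t (fun c _ => hd c)) => s [hs1 hs2] {hd}.
  have hd r : derivable_pt_lim (fun r => \rsum_i (f (fun j => x j + s * v1 j + r * w1 j) i * v1 i)) r
     (\rsum_i (- (\rsum_j (H (fun j => x j + s * v1 j + r * w1 j) i j * w1 j)) * v1 i)).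
    apply: derivable_pt_lim_sum => i _.
    by apply: derivable_pt_lim_scal_right; exact: f_line.
  case: (@mvt _ _ 0 t (fun c _ => hd c)) => r [hr1 hr2] {hd}.
  exists (fun j => x j + s * v1 j + r * w1 j); split=> [i|].
    have a1 : Rabs s <= Rabs t /\ Rabs r <= Rabs t.
      move: hs2 hr2; rewrite /Rmin /Rmax; case: Rle_dec => ? ? ?.
        by rewrite !Rabs_pos_eq; lra.
      by rewrite !Rabs_left1; lra.
    rewrite (_ : _ - _ = s * v1 i + r * w1 i); last ring.
    apply: Rle_trans (Rabs_triang _ _) _; rewrite !Rabs_mult.
    have := Rabs_pos (v1 i); have := Rabs_pos (w1 i); nra.
  have e1 : (fun i => x i + t * v1 i + t * w1 i) = (fun i => x i + t * w1 i + t * v1 i).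
    by apply: functional_extensionality => i; ring.
  have e2 : (fun i => x i + t * w1 i) = (fun i => x i + t * w1 i + 0 * v1 i).
    by apply: functional_extensionality => i; ring.
  have e3 : W x = W (fun i => x i + 0 * v1 i).
    by congr (W _); apply: functional_extensionality => i; ring.
  rewrite e1 e2 e3.
  transitivity (W (fun i => x i + t * w1 i + t * v1 i) - W (fun i => x i + t * v1 i) -
     (W (fun i => x i + t * w1 i + 0 * v1 i) - W (fun i => x i + 0 * v1 i))); first by ring.
  rewrite hs1.
  have e4 : (fun j => x j + s * v1 j + 0 * w1 j) = (fun i => x i + s * v1 i).
    by apply: functional_extensionality => i; ring.
  have e5 : (fun j => x j + s * v1 j + t * w1 j) = (fun i => x i + t * w1 i + s * v1 i).
    by apply: functional_extensionality => i; ring.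
  rewrite e4 e5 in hr1.
  have e6 a b : - a - - b = - (a - b) by ring.
  rewrite e6 {1 2}/dot hr1 /dot (_ : \rsum_i (- _ * _) = - \rsum_i (v1 i * Mop (H (fun j => x j + s * v1 j + r * w1 j)) w1 i)).
    ring.
  by rewrite -bsum_opp; apply: eq_bigr => i _; rewrite /Mop; ring.
have hlim v1 w1 e : 0 < e -> exists d, 0 < d /\ forall y, (forall i, Rabs (y i - x i) < d) ->
    Rabs (dot v1 (Mop (H y) w1) - dot v1 (Mop (H x) w1)) < e.
  move=> he; have p : 0 < e / (nrm v1 * nrm w1 + 1).
    by apply: Rdiv_lt_0_compat => //; have := nrm_ge0 v1; have := nrm_ge0 w1; nra.
  case: (gs_Hc HS x p) => d [d0 hd]; exists d; split=> // y hy.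
  rewrite -dotBr; apply: Rle_lt_trans (bsum_abs _ _ _) _.
  apply: (@Rle_lt_trans _ (\rsum_i (Rabs (v1 i) * (e / (nrm v1 * nrm w1 + 1) * nrm w1)))).
    apply: bsum_le => i _; rewrite Rabs_mult; apply: Rmult_le_compat_l; first exact: Rabs_pos.
    rewrite /Mop -bsum_minus; apply: Rle_trans (bsum_abs _ _ _) _.
    rewrite -bsum_scal; apply: bsum_le => j _.
    rewrite (_ : _ - _ = (H y i j - H x i j) * w1 j); last by ring.
    rewrite Rabs_mult; apply: Rmult_le_compat_r; first exact: Rabs_pos.
    by apply: Rlt_le; apply: hd.
  rewrite bsum_scalr -/(nrm v1).
  have n1 := nrm_ge0 v1; have n2 := nrm_ge0 w1.
  have q : 0 < nrm v1 * nrm w1 + 1 by nra.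
  apply: (Rmult_lt_reg_r (nrm v1 * nrm w1 + 1)) => //.
  have -> : nrm v1 * (e / (nrm v1 * nrm w1 + 1) * nrm w1) * (nrm v1 * nrm w1 + 1) = nrm v1 * nrm w1 * e by field; lra.
  nra.
apply: NNPP => ne.
have he : 0 < Rabs (dot v (Mop (H x) w) - dot w (Mop (H x) v)) / 2 by have := Rabs_pos_lt _ (Rminus_eq_contra _ _ ne); lra.
case: (hlim v w _ he) => d1 [d10 hd1]; case: (hlim w v _ he) => d2 [d20 hd2].
pose M := nrm v + nrm w + 1.
have M0 : 0 < M by have := nrm_ge0 v; have := nrm_ge0 w; rewrite /M; lra.
(* Here [t * M] is half the smaller radius, so the intermediate points of both expansions lie in
   both neighbourhoods of [x]. *)
pose t := Rmin d1 d2 / (2 * M).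
have m0 : 0 < Rmin d1 d2 by apply: Rmin_glb_lt.
have t0 : 0 < t by apply: Rdiv_lt_0_compat => //; lra.
have tM : t * M < Rmin d1 d2.
  by rewrite /t (_ : _ * M = Rmin d1 d2 / 2); [lra | field; lra].
have bnd (a b : V) i : nrm a + nrm b <= M -> Rabs t * (Rabs (a i) + Rabs (b i)) < Rmin d1 d2.
  move=> hab; rewrite Rabs_pos_eq; last lra.
  apply: Rle_lt_trans tM; apply: Rmult_le_compat_l; first lra.
  have := nrm_coord a i; have := nrm_coord b i; lra.
case: (key v w t ltac:(lra)) => y1 [hy1 k1]; case: (key w v t ltac:(lra)) => y2 [hy2 k2].
have e0 : (fun i => x i + t * w i + t * v i) = (fun i => x i + t * v i + t * w i).
  by apply: functional_extensionality => i; ring.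
rewrite e0 in k2.
have eqq : dot v (Mop (H y1) w) = dot w (Mop (H y2) v).
  by apply: (Rmult_eq_reg_l (t * t)); [rewrite -k1 -k2; lra | nra].
have h1 : Rabs (dot v (Mop (H y1) w) - dot v (Mop (H x) w)) < Rabs (dot v (Mop (H x) w) - dot w (Mop (H x) v)) / 2.
  apply: hd1 => i; apply: Rle_lt_trans (hy1 i) _; apply: Rlt_le_trans (Rmin_l d1 d2); apply: bnd; rewrite /M; lra.
have h2 : Rabs (dot w (Mop (H y2) v) - dot w (Mop (H x) v)) < Rabs (dot v (Mop (H x) w) - dot w (Mop (H x) v)) / 2.
  apply: hd2 => i; apply: Rle_lt_trans (hy2 i) _; apply: Rlt_le_trans (Rmin_r d1 d2); apply: bnd; rewrite /M; lra.
rewrite eqq in h1; clear - h1 h2.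
have := Rabs_triang (dot v (Mop (H x) w) - dot w (Mop (H y2) v)) (dot w (Mop (H y2) v) - dot w (Mop (H x) v)).
rewrite (Rabs_minus_sym (dot v _)) (_ : _ - _ + _ = dot v (Mop (H x) w) - dot w (Mop (H x) v)); last by ring.
lra.
Qed.
End Dyn.

Lemma le_div_mul a b c : 0 < c -> a <= b / c -> a * c <= b.
Proof.
move=> c0 h; have := Rmult_le_compat_r c _ _ (Rlt_le _ _ c0) h.
by rewrite (_ : b / c * c = b); last by field; lra.
Qed.

(** * Comparison principle and monotonicity of the flow *)

Section Coop.
Variables (I : finType) (W : (I -> R) -> R) (f : (I -> R) -> I -> R).
Variables (H : (I -> R) -> I -> I -> R) (C : R).
Hypothesis HS : gsys W f H C.
Local Notation V := (I -> R).
Implicit Types x y z v w : V.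
Local Notation N := (INR #|I|).

(** In the mean value theorem each component of [f y - f x] has its own intermediate point, so a
    difference of solutions is governed by rows of Hessians at different points and not by one
    matrix. *)
Definition coop_row (i : I) (a : V) := exists x, forall j, a j = - H x i j.

(* The Lyapunov function [sum_i (min(z_i,0))^2] satisfies a Gronwall inequality. *)
Lemma coop_ge0 (z z' : R -> V) T : 0 <= T ->
  (forall t i, 0 <= t <= T -> derivable_pt_lim (fun t => z t i) t (z' t i)) ->
  (forall t i, 0 <= t <= T -> exists a, coop_row i a /\ \rsum_j (a j * z t j) <= z' t i) ->
  (forall i, 0 <= z 0 i) -> forall i, 0 <= z T i.
Proof.
move=> T0 hd hc h0.
pose u t := \rsum_i (Rmin (z t i) 0 * Rmin (z t i) 0).
pose u' t := \rsum_i (2 * Rmin (z t i) 0 * z' t i).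
have u0 t : 0 <= u t by apply: bsum_ge0 => i _; exact: Rle_0_sqr.
have : u T <= u 0 * exp (2 * C * N * (T - 0)).
  apply: (@gronwall u u') => // t ht.
    apply: derivable_pt_lim_sum => i _.
    exact: (derivable_pt_lim_comp (fun t => z t i) (fun s => Rmin s 0 * Rmin s 0) _ _ _ (hd t i ht) (deriv_neg_part_sq _)).
  pose m i := - Rmin (z t i) 0.
  have m0 i : 0 <= m i by rewrite /m /Rmin; case: Rle_dec => ?; lra.
  have mz i : - m i <= z t i by rewrite /m /Rmin; case: Rle_dec => ?; lra.
  have step i : 2 * Rmin (z t i) 0 * z' t i <= 2 * (m i * (C * nrm m)).
    case: (hc t i ht) => a [[x ha] hz].
    have -> : 2 * Rmin (z t i) 0 * z' t i = 2 * (- (m i * z' t i)) by rewrite /m; ring.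
    apply: Rmult_le_compat_l; first lra.
    apply: (@Rle_trans _ (- (m i * \rsum_j (a j * z t j)))).
      by apply: Ropp_le_contravar; apply: Rmult_le_compat_l.
    rewrite -!bsum_scal -bsum_opp; apply: bsum_le => j _.
    rewrite (Rabs_pos_eq (m j)) //.
    have hC := gs_C HS x i j; move/Rabs_bnd: hC; rewrite -(Ropp_involutive (H x i j)) -ha => hC.
    (* Off the diagonal [a j] is nonnegative, so [z t j] may be replaced by its lower bound [- m j];
       on the diagonal the sign is unknown but [m i * z t i] equals [- (m i * m i)]. *)
    have [e|/eqP ne] := eqVneq j i; last first.
      have aj : 0 <= a j by rewrite ha; have := gs_off HS x (not_eq_sym ne); lra.
      have := m0 i; have := mz j; have := m0 j => k1 k2 k3.
      have : a j * - m j <= a j * z t j by apply: Rmult_le_compat_l.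
      have : a j * m j <= C * m j by apply: Rmult_le_compat_r; lra.
      nra.
    subst j; have mm : m i * z t i = - (m i * m i).
      by rewrite /m /Rmin; case: Rle_dec => ?; ring.
    have -> : - (m i * (a i * z t i)) = a i * (m i * m i) by rewrite -(Ropp_involutive (m i * m i)) -mm; ring.
    rewrite (_ : m i * (C * m i) = C * (m i * m i)); last ring.
    by apply: Rmult_le_compat_r; [exact: Rle_0_sqr | lra].
  apply: Rle_trans (bsum_le _ (fun i _ => step i)) _.
  rewrite bsum_scal bsum_scalr.
  have e : \rsum_i m i = nrm m by apply: eq_bigr => i _; rewrite Rabs_pos_eq.
  have um : u t = dot m m by apply: eq_bigr => i _; rewrite /m; ring.
  rewrite e um; have := nrm_nrm m.
  have [i0|noI] := pickP (fun _ : I => true).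
    by move=> _; have := C_ge0 HS i0; have := dot_ge0 m; nra.
  have -> : nrm m = 0 by rewrite /nrm big_pred0.
  have -> : dot m m = 0 by rewrite /dot big_pred0.
  lra.
have -> : u 0 = 0.
  by apply: big1 => i _; rewrite Rmin_right ?Rmult_0_r.
rewrite Rmult_0_l => h i.
have uT : u T = 0 by have := u0 T; lra.
have := @rsum_eq0 _ (fun i => Rmin (z T i) 0 * Rmin (z T i) 0) (fun j => Rle_0_sqr _) uT i.
by rewrite /Rmin; case: Rle_dec => ?; nra.
Qed.

(** A positive coordinate decays at most exponentially, so one that vanishes at [T] has vanished all
    along and has zero velocity there. Irreducibility couples the set of these coordinates to a
    positive one, which forces a positive velocity. *)
Lemma coop_gt0 (z z' : R -> V) T i0 : 0 < T ->
  (forall t i, 0 <= t <= T -> derivable_pt_lim (fun t => z t i) t (z' t i)) ->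
  (forall t i, 0 <= t <= T -> exists a, coop_row i a /\ \rsum_j (a j * z t j) <= z' t i) ->
  (forall i, 0 <= z 0 i) -> 0 < z 0 i0 -> forall i, 0 < z T i.
Proof.
move=> T0 hd hc h0 hi0.
have zge t i : 0 <= t <= T -> 0 <= z t i.
  move=> ht; apply: (@coop_ge0 z z') => //; first lra.
    by move=> s k hs; apply: hd; lra.
  by move=> s k hs; apply: hc; lra.
have offge x i j t : 0 <= t <= T -> j <> i -> 0 <= - H x i j * z t j.
  by move=> ht ne; have := gs_off HS x (not_eq_sym ne); have := zge t j ht; nra.
have grow i t : 0 <= t <= T -> z t i * exp (- C * (T - t)) <= z T i.
  move=> ht.
  suff : - z T i <= - z t i * exp (- C * (T - t)) by lra.
  apply: (@gronwall (fun t => - z t i) (fun t => - z' t i)); first lra.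
    by move=> s hs; apply: derivable_pt_lim_opp; apply: hd; lra.
  move=> s hs; have hs' : 0 <= s <= T by lra.
  case: (hc s i hs') => a [[x ha] hz].
  have : a i * z s i <= \rsum_j (a j * z s j).
    rewrite (bigD1 i) //=.
    have : 0 <= \big[Rplus/R0]_(j | j != i) (a j * z s j).
      by apply: bsum_ge0 => j /eqP ne; rewrite ha; exact: offge.
    lra.
  have := gs_C HS x i i; move/Rabs_bnd; have := zge s i hs'; rewrite ha; nra.
have pos_stay i t : 0 <= t <= T -> 0 < z t i -> 0 < z T i.
  move=> ht hz; apply: Rlt_le_trans (grow i t ht).
  by apply: Rmult_lt_0_compat => //; exact: exp_pos.
apply: NNPP => hn.
have [i hi] : exists i, z T i = 0.
  apply: NNPP => h; apply: hn => i.
  case: (@zge T i ltac:(lra)) => // e; by case: h; exists i.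
case: (gs_irr HS (A := fun i => z T i = 0)).
- by exists i.
- exists i0 => e; have := pos_stay i0 0 ltac:(lra) hi0; lra.
move=> k [j [hk [hj hH]]].
have zk s : 0 <= s <= T -> z s k = 0.
  move=> hs; case: (zge s k hs) => // p; have := pos_stay k s hs p; lra.
have z'k := derivable_pt_lim_const_left T0 zk (hd T k ltac:(lra)).
case: (hc T k ltac:(lra)) => a [[x ha] ]; rewrite z'k => hz.
have : 0 < \rsum_l (a l * z T l).
  apply: (@rsum_gt0 _ _ j) => [l|].
    have [->|/eqP ne] := eqVneq l k; first by rewrite hk; lra.
    by rewrite ha; apply: offge => //; lra.
  rewrite ha; have := hH x; case: (@zge T j ltac:(lra)) => [p|e]; first nra.
  by case: hj.
lra.
Qed.

Variable Phi : R -> V -> V.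
Hypothesis Phi0 : forall x, Phi 0 x = x.
Hypothesis PhiD : forall x t i, derivable_pt_lim (fun t => Phi t x i) t (f (Phi t x) i).

Definition solution (y : R -> V) := forall t i, derivable_pt_lim (fun t => y t i) t (f (y t) i).

Lemma Phi_solution x : solution (fun t => Phi t x). Proof. by move=> t i; exact: PhiD. Qed.

Lemma gap_deriv (y1 y2 : R -> V) t : solution y1 -> solution y2 ->
  derivable_pt_lim (fun t => dot (fun i => y1 t i - y2 t i) (fun i => y1 t i - y2 t i)) t
   (2 * dot (fun i => y1 t i - y2 t i) (fun i => f (y1 t) i - f (y2 t) i)).
Proof.
move=> h1 h2; rewrite /dot -bsum_scal; apply: derivable_pt_lim_sum => i _.
have h : derivable_pt_lim (fun t => y1 t i - y2 t i) t (f (y1 t) i - f (y2 t) i).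
  by apply: derivable_pt_lim_minus.
apply: derivable_pt_lim_eql; last exact: (derivable_pt_lim_mult _ _ _ _ _ h h).
rewrite /=; ring.
Qed.

Lemma gap_bound x y : Rabs (2 * dot (fun i => x i - y i) (fun i => f x i - f y i)) <=
  2 * C * N * N * dot (fun i => x i - y i) (fun i => x i - y i).
Proof.
have [i0|noI] := pickP (fun _ : I => true); last first.
  by rewrite /dot !big_pred0 // !Rmult_0_r Rabs_R0; lra.
move=> _.
rewrite Rabs_mult Rabs_pos_eq; last lra.
have h : nrm (fun i => f x i - f y i) <= N * (C * nrm (fun i => x i - y i)).
  by apply: nrm_bound => i; exact: (f_lip HS).
have := dot_abs (fun i => x i - y i) (fun i => f x i - f y i).
have := nrm_nrm (fun i => x i - y i).
have := nrm_ge0 (fun i => x i - y i).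
have := C_ge0 HS i0; have := pos_INR #|I|.
set n := nrm _ in h *; set D := dot _ _; set E := Rabs _; set F := nrm _ in h *.
move=> N0 C0 n0 h1 h2.
have k1 : F * n <= F * (N * (C * F)) by apply: Rmult_le_compat_l.
have k2 : C * N * (F * F) <= C * N * (N * D) by apply: Rmult_le_compat_l; nra.
nra.
Qed.

(** Gronwall for the squared distance; for [t < s] it is applied in reversed time, so that
    uniqueness and the group law hold for negative times as well. *)
Lemma sol_gap (y1 y2 : R -> V) s t : solution y1 -> solution y2 ->
  dot (fun i => y1 t i - y2 t i) (fun i => y1 t i - y2 t i) <=
  dot (fun i => y1 s i - y2 s i) (fun i => y1 s i - y2 s i) * exp (2 * C * N * N * Rabs (t - s)).
Proof.
move=> h1 h2; have [le|lt] := Rle_lt_dec s t.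
  rewrite Rabs_pos_eq; last lra.
  apply: (@gronwall (fun t => dot (fun i => y1 t i - y2 t i) (fun i => y1 t i - y2 t i)) _ _ s t le) => r hr.
    exact: gap_deriv.
  by apply: Rle_trans (gap_bound _ _); exact: Rle_abs.
rewrite Rabs_left; last lra.
have := (@gronwall (fun r => dot (fun i => y1 (- r) i - y2 (- r) i) (fun i => y1 (- r) i - y2 (- r) i))
   (fun r => - (2 * dot (fun i => y1 (- r) i - y2 (- r) i) (fun i => f (y1 (- r)) i - f (y2 (- r)) i))) (2 * C * N * N) (- s) (- t)).
rewrite !Ropp_involutive (_ : - t - - s = - (t - s)); last ring.
apply; first lra.
  move=> r hr.
  by apply: (derivable_pt_lim_rev (g := fun t => dot (fun i => y1 t i - y2 t i) (fun i => y1 t i - y2 t i))); exact: gap_deriv.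
by move=> r hr; apply: Rle_trans (gap_bound _ _); rewrite -Rabs_Ropp; exact: Rle_abs.
Qed.

Lemma sol_unique (y1 y2 : R -> V) s : solution y1 -> solution y2 -> y1 s = y2 s -> forall t, y1 t = y2 t.
Proof.
move=> h1 h2 e t; have := sol_gap s t h1 h2; rewrite e.
have -> : dot (fun i => y2 s i - y2 s i) (fun i => y2 s i - y2 s i) = 0.
  by apply: big1 => i _; ring.
rewrite Rmult_0_l => h; apply: functional_extensionality => i.
have h0 := dot_ge0 (fun i => y1 t i - y2 t i).
have hz : dot (fun i => y1 t i - y2 t i) (fun i => y1 t i - y2 t i) = 0 by lra.
have := dot_eq0 hz i; rewrite /=; lra.
Qed.

Lemma sol_shift (y : R -> V) a : solution y -> solution (fun t => y (t + a)).
Proof. by move=> h t i; exact: (@derivable_pt_lim_addc (fun t => y t i) a t _ (h _ _)). Qed.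

Lemma Phi_add s t x : Phi (s + t) x = Phi s (Phi t x).
Proof.
apply: (@sol_unique (fun s => Phi (s + t) x) (fun s => Phi s (Phi t x)) 0 _ _ _ s).
- exact: sol_shift (Phi_solution x).
- exact: Phi_solution.
- by rewrite Phi0 Rplus_0_l.
Qed.

Lemma Phi_sol (y : R -> V) : solution y -> forall t, y t = Phi t (y 0).
Proof.
move=> h t; apply: (@sol_unique y (fun t => Phi t (y 0)) 0 h _ _ t); last by rewrite Phi0.
exact: Phi_solution.
Qed.

Lemma PhiK t x : Phi (- t) (Phi t x) = x.
Proof. by rewrite -Phi_add Rplus_opp_l Phi0. Qed.
Lemma PhiVK t x : Phi t (Phi (- t) x) = x.
Proof. by rewrite -Phi_add Rplus_opp_r Phi0. Qed.

Lemma crit_fixed x t : (forall i, f x i = 0) -> Phi t x = x.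
Proof.
move=> h; symmetry; apply: (@Phi_sol (fun _ => x)) => s i.
rewrite h; exact: derivable_pt_lim_const.
Qed.

Lemma Phi_cont t x e : 0 < e -> exists d, 0 < d /\ forall y, (forall i, Rabs (y i - x i) < d) ->
  forall i, Rabs (Phi t y i - Phi t x i) < e.
Proof.
move=> he; pose K := exp (2 * C * N * N * Rabs (t - 0)).
have K0 : 0 < K by exact: exp_pos.
have N0 := pos_INR #|I|.
have dp : 0 < (N * N * K + 1) by nra.
(* [d <= 1] replaces [d * d] by [d], and the second bound keeps [N * N * K * d] below [e * e]. *)
pose d := Rmin 1 (e * e / (N * N * K + 1)).
have d0 : 0 < d by apply: Rmin_glb_lt; [lra | apply: Rdiv_lt_0_compat => //; nra].
exists d; split=> // y hy i.
have := sol_gap 0 t (Phi_solution y) (Phi_solution x); rewrite !Phi0 -/K.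
have h1 : dot (fun i => y i - x i) (fun i => y i - x i) <= N * N * d * d.
  apply: Rle_trans (dot_le_nrm2 _) _.
  have h2 : nrm (fun i => y i - x i) <= N * d by apply: nrm_bound => j; exact: Rlt_le.
  have := nrm_ge0 (fun i => y i - x i); nra.
move=> h2; apply: Rnot_le_lt => h3.
have h4 : e * e <= Rabs (Phi t y i - Phi t x i) * Rabs (Phi t y i - Phi t x i) by nra.
have h5 : Rabs (Phi t y i - Phi t x i) * Rabs (Phi t y i - Phi t x i) <= dot (fun i => Phi t y i - Phi t x i) (fun i => Phi t y i - Phi t x i).
  rewrite -Rabs_mult Rabs_pos_eq; last exact: Rle_0_sqr.
  by apply: (@rsum_term _ (fun i => (Phi t y i - Phi t x i) * (Phi t y i - Phi t x i))) => j; exact: Rle_0_sqr.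
have d1 : d <= 1 by exact: Rmin_l.
have d2 : d <= e * e / (N * N * K + 1) by exact: Rmin_r.
have d3 : d * (N * N * K + 1) <= e * e.
  exact: le_div_mul.
have : N * N * d * d * K <= N * N * K * d.
  have : 0 <= N * N * K * d by apply: Rmult_le_pos; [nra|lra].
  nra.
have : dot (fun i => y i - x i) (fun i => y i - x i) * K <= N * N * d * d * K by nra.
nra.
Qed.

Lemma Phi_vlim t u l : vlim u l -> vlim (fun n => Phi t (u n)) (Phi t l).
Proof.
move=> h i e he; case: (Phi_cont t l he) => d [d0 hd].
case: (vlim_unif h d0) => M hM; exists M => n hn; apply: hd => j; exact: hM.
Qed.

Lemma diff_row x y i : exists a, coop_row i a /\ \rsum_j (a j * (y j - x j)) = f y i - f x i.
Proof.
case: (f_mvt HS x y i) => s [_ e]; exists (fun j => - H (seg x y s) i j); split.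
  by exists (seg x y s).
by rewrite e -bsum_opp; apply: eq_bigr => j _; ring.
Qed.

Lemma Phi_le x y t : vle x y -> 0 <= t -> vle (Phi t x) (Phi t y).
Proof.
move=> h t0 i.
suff : 0 <= Phi t y i - Phi t x i by lra.
apply: (@coop_ge0 (fun t i => Phi t y i - Phi t x i) (fun t i => f (Phi t y) i - f (Phi t x) i)) => // [s k _|s k _|k].
- by apply: derivable_pt_lim_minus; exact: PhiD.
- by case: (diff_row (Phi s x) (Phi s y) k) => a [h1 h2]; exists a; split=> //; lra.
- by rewrite !Phi0; have := h k; lra.
Qed.

Lemma Phi_lt x y t : vle x y -> x <> y -> 0 < t -> vlt (Phi t x) (Phi t y).
Proof.
move=> h ne t0 i.
suff : 0 < Phi t y i - Phi t x i by lra.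
case: (vneq_coord ne) => i0 hi0.
apply: (@coop_gt0 (fun t i => Phi t y i - Phi t x i) (fun t i => f (Phi t y) i - f (Phi t x) i) t i0) => // [s k _|s k _|k|].
- by apply: derivable_pt_lim_minus; exact: PhiD.
- by case: (diff_row (Phi s x) (Phi s y) k) => a [h1 h2]; exists a; split=> //; lra.
- by rewrite !Phi0; have := h k; lra.
- by rewrite !Phi0; have := h i0; lra.
Qed.

Definition crit x := forall i, f x i = 0.

Lemma crit_lt x y : crit x -> crit y -> vle x y -> x <> y -> vlt x y.
Proof.
move=> hx hy h ne; have := Phi_lt h ne Rlt_0_1; by rewrite !crit_fixed.
Qed.

(** The difference [Phi t x - x] has velocity [(f (Phi t x) - f x) + f x]; the bracket is
    cooperative and the last term nonnegative, so the comparison principle applies. *)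
Lemma sub_le x t : (forall i, 0 <= f x i) -> 0 <= t -> vle x (Phi t x).
Proof.
move=> h t0 i.
suff : 0 <= Phi t x i - x i by lra.
apply: (@coop_ge0 (fun t i => Phi t x i - x i) (fun t i => f (Phi t x) i - 0)) => // [s k _|s k _|k].
- by apply: derivable_pt_lim_minus; [exact: PhiD | exact: derivable_pt_lim_const].
- case: (diff_row x (Phi s x) k) => a [h1 h2]; exists a; split=> //; rewrite h2.
  by have := h k; lra.
- by rewrite !Phi0; lra.
Qed.

Lemma super_le x t : (forall i, f x i <= 0) -> 0 <= t -> vle (Phi t x) x.
Proof.
move=> h t0 i.
suff : 0 <= x i - Phi t x i by lra.
apply: (@coop_ge0 (fun t i => x i - Phi t x i) (fun t i => 0 - f (Phi t x) i)) => // [s k _|s k _|k].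
- by apply: derivable_pt_lim_minus; [exact: derivable_pt_lim_const| exact: PhiD].
- case: (diff_row (Phi s x) x k) => a [h1 h2]; exists a; split=> //; rewrite h2.
  by have := h k; lra.
- by rewrite !Phi0; lra.
Qed.

Lemma sub_mono x s t : (forall i, 0 <= f x i) -> 0 <= s <= t -> vle (Phi s x) (Phi t x).
Proof.
move=> h hs; have -> : t = s + (t - s) by ring.
rewrite Phi_add; apply: Phi_le; last lra.
by apply: sub_le => //; lra.
Qed.

(** The orbit is nondecreasing in time, so its forward difference quotients cannot approach a
    negative velocity. *)
Lemma sub_f_ge0 x t : (forall i, 0 <= f x i) -> 0 <= t -> forall i, 0 <= f (Phi t x) i.
Proof.
move=> h t0 i; apply: Rnot_lt_le => lt.
case: (@PhiD x t i (- f (Phi t x) i)) => [|d hd]; first lra.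
have dp := cond_pos d.
have := hd (d / 2) => /=; rewrite (Rabs_pos_eq (d / 2)); last lra.
move=> H1; have {H1} := H1 ltac:(lra) ltac:(lra).
have := @sub_mono x t (t + d / 2) h ltac:(lra) i => hm.
have : 0 <= (Phi (t + d / 2) x i - Phi t x i) / (d / 2).
  by apply: Rle_mult_inv_pos; lra.
move=> h3 /Rabs_def2; lra.
Qed.

Lemma noncrit_Phi x t : ~ crit x -> ~ crit (Phi t x).
Proof.
by move=> h hc; apply: h; rewrite -(PhiK t x) crit_fixed.
Qed.

Lemma sub_lt x s t : (forall i, 0 <= f x i) -> ~ crit x -> 0 <= s < t -> vlt (Phi s x) (Phi t x).
Proof.
have main y r : (forall i, 0 <= f y i) -> ~ crit y -> 0 < r -> vlt y (Phi r y).
  move=> h nc r0.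
  have h1 : vle y (Phi (r / 2) y) by apply: sub_le => //; lra.
  have e : r = r / 2 + r / 2 by field.
  rewrite {1}e Phi_add; apply: (vle_lt_trans h1).
  apply: Phi_lt => //; last lra.
  move=> ey; apply: nc => i.
  (* If the orbit is at [y] again at time [r / 2], monotonicity in time holds it at [y] in between,
     and then its velocity vanishes. *)
  have hc s1 : 0 <= s1 <= r / 2 -> Phi s1 y i - y i = 0.
    move=> hs; have := @sub_le y s1 h ltac:(lra) i.
    have := @sub_mono y s1 (r / 2) h hs i; rewrite -ey; lra.
  have hd : derivable_pt_lim (fun s1 => Phi s1 y i - y i) (r / 2) (f (Phi (r / 2) y) i - 0).
    by apply: derivable_pt_lim_minus; [exact: PhiD | exact: derivable_pt_lim_const].
  by have := @derivable_pt_lim_const_left _ 0 (r / 2) _ ltac:(lra) hc hd; rewrite -ey Rminus_0_r.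
move=> h nc hs; have -> : t = (t - s) + s by ring.
rewrite Phi_add; apply: main; [by apply: sub_f_ge0 => //; lra | exact: noncrit_Phi | lra].
Qed.

(** Only directional derivatives of [W] are given, so the chain rule along an orbit is done by hand:
    the mean value theorem on the chord from [Phi t x] to [Phi (t + h) x], together with the
    continuity of [f]. *)
Lemma W_decr_deriv x t : derivable_pt_lim (fun t => W (Phi t x)) t (- dot (f (Phi t x)) (f (Phi t x))).
Proof.
move=> e he.
set y := Phi t x.
have N0 := pos_INR #|I|.
pose B := nrm (f y).
have B0 : 0 <= B by exact: nrm_ge0.
(* The total error is at most [e1 * (2 * N * B + N * N)]; the bound [e1 <= 1] keeps the difference
   quotient below [B + N] in norm. *)
pose e1 := Rmin 1 (e / (4 * (N * B + N * N + 1))).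
have q : 0 < 4 * (N * B + N * N + 1) by nra.
have e10 : 0 < e1 by apply: Rmin_glb_lt; [lra| exact: Rdiv_lt_0_compat].
case: (f_cont HS y e10) => d1 [d10 hd1].
have hu : exists d2, 0 < d2 /\ forall h, h <> 0 -> Rabs h < d2 -> forall i,
   Rabs (Phi (t + h) x i - y i) < d1 /\ Rabs ((Phi (t + h) x i - y i) / h - f y i) < e1.
  case: (@fin_delta I (fun i d => forall h, h <> 0 -> Rabs h < d ->
   Rabs (Phi (t + h) x i - y i) < d1 /\ Rabs ((Phi (t + h) x i - y i) / h - f y i) < e1)) => [i|i d d' hd hP h h0 hh|d [d0 hd]].
  - have hc := derivable_pt_lim_cont (@PhiD x t i); move/continuity_pt_eps: hc => /(_ d1 d10) [d3 [d30 h3]].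
    case: (@PhiD x t i e1 e10) => d4 h4; have d40 := cond_pos d4.
    exists (Rmin d3 d4); split=> [|h h0 hm]; first exact: Rmin_glb_lt.
    split; last by apply: h4 => //; exact: Rlt_le_trans hm (Rmin_r _ _).
    apply: h3; rewrite (_ : t + h - t = h); last ring.
    exact: Rlt_le_trans hm (Rmin_l _ _).
  - by apply: hP => //; lra.
  by exists d; split=> // h h0 hm i; exact: hd.
case: hu => d2 [d20 hd2]; exists (mkposreal _ d20) => h h0 /= hm.
case: (W_mvt HS y (Phi (t + h) x)) => s [hs ->].
set g := f (seg _ _ _).
have -> : - dot g (fun j => Phi (t + h) x j - y j) / h - - dot (f y) (f y) =
   dot (f y) (f y) - dot g (fun j => (Phi (t + h) x j - y j) / h).
  rewrite (_ : dot g (fun j => (Phi (t + h) x j - y j) / h) = / h * dot g (fun j => Phi (t + h) x j - y j)); first by field.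
  by rewrite -dotZr; apply: eq_bigr => j _; rewrite /Rdiv; ring.
set w := fun j => _ / h.
have -> : dot (f y) (f y) - dot g w = dot (f y) (fun i => f y i - w i) - dot (fun i => g i - f y i) w.
  by rewrite dotBr dotBl; ring.
have hw i : Rabs (w i - f y i) < e1 by case: (hd2 h h0 hm i).
have hg i : Rabs (g i - f y i) < e1.
  apply: hd1 => j; apply: Rle_lt_trans (seg_close _ _ _ hs) _.
  by case: (hd2 h h0 hm j).
have n1 : nrm (fun i => f y i - w i) <= N * e1.
  by apply: nrm_bound => i; rewrite Rabs_minus_sym; exact: Rlt_le.
have n2 : nrm (fun i => g i - f y i) <= N * e1.
  by apply: nrm_bound => i; exact: Rlt_le.
have e11 : e1 <= 1 by exact: Rmin_l.
have n3 : nrm w <= B + N.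
  have -> : w = (fun i => f y i + (w i - f y i)) by apply: functional_extensionality => i; ring.
  apply: Rle_trans (nrm_triang _ _) _; apply: Rplus_le_compat_l.
  rewrite -{1}(Rmult_1_r N); apply: nrm_bound => i; have := hw i; lra.
apply: Rle_lt_trans (Rabs_triang _ _) _; rewrite Rabs_Ropp.
have := dot_abs (f y) (fun i => f y i - w i).
have := dot_abs (fun i => g i - f y i) w.
have e12 : e1 * (4 * (N * B + N * N + 1)) <= e.
  by apply: le_div_mul => //; exact: Rmin_r.
have := nrm_ge0 w; have := nrm_ge0 (fun i => g i - f y i); have := nrm_ge0 (fun i => f y i - w i).
rewrite -/B => p1 p2 p3 p4 p5.
have a1 : B * nrm (fun i => f y i - w i) <= B * (N * e1) by exact: Rmult_le_compat_l.
have a2 : nrm (fun i => g i - f y i) * nrm w <= (N * e1) * (B + N) by exact: Rmult_le_compat.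
have a3 : B * (N * e1) + (N * e1) * (B + N) <= e1 * (2 * (N * B + N * N + 1)).
  have : 0 <= e1 * (N * N) by apply: Rmult_le_pos; nra.
  nra.
lra.
Qed.

End Coop.

(** * Perron eigenvectors *)

Lemma seq_limE u l : seq_lim u l <-> Un_cv u l.
Proof.
split=> h e he; case: (h e he) => N hN; exists N => n hn; apply: hN; exact/leP.
Qed.

Lemma seq_lim_plus u v a b : seq_lim u a -> seq_lim v b -> seq_lim (fun n => u n + v n) (a + b).
Proof. by rewrite !seq_limE; exact: CV_plus. Qed.

Lemma seq_lim_mult u v a b : seq_lim u a -> seq_lim v b -> seq_lim (fun n => u n * v n) (a * b).
Proof. by rewrite !seq_limE; exact: CV_mult. Qed.

Lemma seq_lim_const a : seq_lim (fun _ => a) a.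
Proof. by move=> e he; exists 0%nat => n _; rewrite Rminus_diag Rabs_R0. Qed.

Lemma seq_lim_sum (J : Type) (s : seq J) (P : pred J) (F : nat -> J -> R) l :
  (forall j, seq_lim (fun n => F n j) (l j)) ->
  seq_lim (fun n => \big[Rplus/R0]_(j <- s | P j) F n j) (\big[Rplus/R0]_(j <- s | P j) l j).
Proof.
move=> h; elim: s => [|a s IH].
  by rewrite big_nil => e he; exists 0%nat => n _; rewrite big_nil Rminus_diag Rabs_R0.
have h2 := seq_lim_plus (h a) IH.
rewrite big_cons; case: ifP => Pa e he.
  by case: (h2 e he) => N hN; exists N => n /hN; rewrite big_cons Pa.
by case: (IH e he) => N hN; exists N => n /hN; rewrite big_cons Pa.
Qed.

Lemma seq_lim_dot (I : finType) (u v : nat -> I -> R) a b : vlim u a -> vlim v b ->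
  seq_lim (fun n => dot (u n) (v n)) (dot a b).
Proof. by move=> h1 h2; apply: seq_lim_sum => j; apply: seq_lim_mult. Qed.

Lemma seq_lim_sg (I : finType) (u : nat -> I -> R) a : vlim u a -> seq_lim (fun n => sg (u n)) (sg a).
Proof. by move=> h; apply: seq_lim_sum. Qed.

Lemma seq_min (I : finType) (P : (I -> R) -> Prop) (F : (I -> R) -> R) B :
  (exists x, P x) -> (forall x i, P x -> Rabs (x i) <= B) ->
  (forall u l, (forall n, P (u n)) -> vlim u l -> P l) ->
  (forall u l, vlim u l -> seq_lim (fun n => F (u n)) (F l)) ->
  exists x, P x /\ forall y, P y -> F x <= F y.
Proof.
move=> [x0 hx0] hB hcl hF.
(* [F] is not known to be bounded below; composing with the increasing bounded function [atan] makes
   the supremum exist without moving the minimizers. *)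
case: (completeness (fun z => exists x, P x /\ z = - atan (F x))) => [||m [hm1 hm2]].
- exists (PI / 2) => z [x [_ ->]]; have := atan_bound (F x); lra.
- by exists (- atan (F x0)), x0.
have hs n : exists x, P x /\ - atan (F x) > m - / INR n.+1.
  have p : 0 < / INR n.+1 by apply: Rinv_0_lt_compat; apply: lt_0_INR; apply/ltP.
  apply: NNPP => h; have := hm2 (m - / INR n.+1) => /= H.
  have : m <= m - / INR n.+1; last lra.
  apply: H => z [x [hx ->]]; apply: Rnot_lt_le => lt; apply: h; exists x; split=> //; lra.
pose u n := proj1_sig (constructive_indefinite_description _ (hs n)).
have uP n : P (u n) /\ - atan (F (u n)) > m - / INR n.+1.
  by rewrite /u; case: constructive_indefinite_description.
case: (@bolzano I u B) => [n i|phi [l [hp hl]]]; first by apply: hB; case: (uP n).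
exists l; split; first by apply: (hcl (u \o phi)) => // n; case: (uP (phi n)).
move=> y hy.
suff : atan (F l) <= atan (F y).
  by move=> h; apply: Rnot_lt_le => /atan_increasing; lra.
have h1 : - atan (F y) <= m by apply: hm1; exists y.
suff : atan (F l) <= - m by lra.
apply: Rnot_lt_le => lt.
have [/= N1 h2] : exists N, forall n, (N <= n)%nat -> Rabs (atan (F (u (phi n))) - atan (F l)) < (atan (F l) + m) / 2.
  have hc := derivable_pt_lim_cont (derivable_pt_lim_atan (F l)).
  move/continuity_pt_eps: hc => /(_ ((atan (F l) + m) / 2)) [|d [d0 hd]]; first lra.
  by case: (hF _ _ hl d d0) => N hN; exists N => n /hN; exact: hd.
case: (archimed_cor1 ((atan (F l) + m) / 2)) => [|N2 [h3 h4]]; first lra.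
have h5 := h2 (maxn N1 N2) (leq_maxl _ _).
case: (uP (phi (maxn N1 N2))) => _ h6.
have h7 : / INR (phi (maxn N1 N2)).+1 <= / INR N2.
  apply: Rinv_le_contravar; first exact: lt_0_INR.
  apply: le_INR; apply/leP; apply: leqW; apply: leq_trans (leq_maxr N1 N2) _; exact: strict_mono_ge.
move/Rabs_def2: h5; lra.
Qed.

Section Perron.
Variables (I : finType) (i0 : I) (M : I -> I -> R).
Local Notation V := (I -> R).
Implicit Types v w : V.
Local Notation Mop := (Mop M).
Hypothesis Msym : forall v w, dot v (Mop w) = dot w (Mop v).
Hypothesis Moff : forall i j, i <> j -> M i j <= 0.
Hypothesis Mirr : forall A : I -> Prop, (exists i, A i) -> (exists j, ~ A j) ->
  exists i j, A i /\ ~ A j /\ M i j < 0.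
Definition Q v := dot v (Mop v).

Lemma MopD v w i : Mop (fun k => v k + w k) i = Mop v i + Mop w i.
Proof. by rewrite /Mop -bsum_add; apply: eq_bigr => j _; ring. Qed.
Lemma MopZ a v i : Mop (fun k => a * v k) i = a * Mop v i.
Proof. by rewrite /Mop -bsum_scal; apply: eq_bigr => j _; ring. Qed.

Lemma Mop_lim u l : vlim u l -> vlim (fun n => Mop (u n)) (Mop l).
Proof.
by move=> h i; apply: seq_lim_sum => j; apply: seq_lim_mult => //; exact: seq_lim_const.
Qed.

Lemma Q_lim u l : vlim u l -> seq_lim (fun n => Q (u n)) (Q l).
Proof. by move=> h; apply: seq_lim_dot => //; exact: Mop_lim. Qed.

Lemma QZ a v : Q (fun i => a * v i) = a * a * Q v.
Proof.
rewrite /Q dotZl (_ : Mop (fun i => a * v i) = (fun i => a * Mop v i)) ?dotZr; first ring.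
by apply: functional_extensionality => i; exact: MopZ.
Qed.

Lemma QD v w : Q (fun i => v i + w i) = Q v + 2 * dot w (Mop v) + Q w.
Proof.
rewrite /Q (_ : Mop (fun i => v i + w i) = (fun i => Mop v i + Mop w i)); last first.
  by apply: functional_extensionality => i; exact: MopD.
rewrite dotDl !dotDr (Msym v w); ring.
Qed.

(** Used twice: [w = 0] yields the lowest eigenvalue, and the positive eigenvector in place of [w]
    yields the gap above it. *)
Lemma rayleigh_min w : (exists v, dot v v = 1 /\ dot v w = 0) ->
  exists v0, dot v0 v0 = 1 /\ dot v0 w = 0 /\ forall v, dot v w = 0 -> Q v0 * dot v v <= Q v.
Proof.
move=> hex.
case: (@seq_min I (fun v => dot v v = 1 /\ dot v w = 0) Q 1 hex).
- move=> x i [h _].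
  have : x i * x i <= dot x x.
    by apply: (@rsum_term _ (fun i => x i * x i)) => j; exact: Rle_0_sqr.
  by rewrite h => h1; apply: Rabs_le; nra.
- move=> u l hu hl; split.
    apply: seq_lim_unique (seq_lim_dot hl hl) _.
    by move=> e he; exists 0%nat => n _; case: (hu n) => -> _; rewrite Rminus_diag Rabs_R0.
  apply: seq_lim_unique (seq_lim_dot hl (b := w) _) _; first by move=> i; exact: seq_lim_const.
  by move=> e he; exists 0%nat => n _; case: (hu n) => _ ->; rewrite Rminus_diag Rabs_R0.
- exact: Q_lim.
move=> v0 [[h1 h2] h3]; exists v0; do 2!split=> //; move=> v hv.
case: (dot_ge0 v) => [p|/esym e]; last first.
  have hz := dot_eq0 e; rewrite e Rmult_0_r /Q.
  have -> : dot v (Mop v) = 0 by apply: big1 => i _; rewrite hz Rmult_0_l.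
  lra.
have p2 : 0 < sqrt (dot v v) by exact: sqrt_lt_R0.
have p3 : sqrt (dot v v) * sqrt (dot v v) = dot v v by apply: sqrt_sqrt; lra.
have := h3 (fun i => / sqrt (dot v v) * v i).
have e2 : / sqrt (dot v v) * / sqrt (dot v v) = / dot v v.
  by rewrite -Rinv_mult p3.
rewrite !dotZl dotZr QZ hv Rmult_0_r -Rmult_assoc e2 Rinv_l; last lra.
move=> H; have {H} := H (conj erefl erefl) => H.
have := Rmult_le_compat_r _ _ _ (Rlt_le _ _ p) H.
by rewrite (_ : / dot v v * Q v * dot v v = Q v); last by field; lra.
Qed.

(** First-order condition at a minimum, tested in the direction of the residual [g]: the form along
    [v0 + s * g] gives [0 <= 2 * s * a + s * s * b] with [a = dot g g], for all [s]. *)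
Lemma min_eigen lam v0 : (forall v, lam * dot v v <= Q v) -> Q v0 = lam * dot v0 v0 ->
  forall i, Mop v0 i = lam * v0 i.
Proof.
move=> hmin h0.
pose g i := Mop v0 i - lam * v0 i.
have gE i : g i = Mop v0 i - lam * v0 i by [].
clearbody g.
suff h : dot g g = 0 by move=> i; have := dot_eq0 h i; rewrite gE; lra.
have a0 := dot_ge0 g.
have hg : dot g (Mop v0) = dot g g + lam * dot g v0.
  by rewrite -dotZr -dotDr; apply: eq_bigr => i _; rewrite gE; ring.
pose b := Q g - lam * dot g g.
have b0 : 0 <= b by have := hmin g; rewrite /b; lra.
have key s : 0 <= 2 * s * dot g g + s * s * b.
  have := hmin (fun i => v0 i + s * g i).
  rewrite QD QZ dotDl !dotDr !dotZl !dotZr h0 hg (dotC v0 g) /b; lra.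
(* Nearly the minimizing [s]; the [+ 1] avoids dividing by zero when [b = 0]. *)
have := key (- dot g g / (b + 1)).
set a := dot g g in a0 *; move=> h.
have h2 : 0 <= - (a * a) * (b + 2).
  have e : (2 * (- a / (b + 1)) * a + - a / (b + 1) * (- a / (b + 1)) * b) * ((b + 1) * (b + 1)) = - (a * a) * (b + 2).
    by field; lra.
  by rewrite -e; apply: Rmult_le_pos => //; nra.
nra.
Qed.

Definition vabs v : V := fun i => Rabs (v i).

Lemma dot_vabs v : dot (vabs v) (vabs v) = dot v v.
Proof.
by apply: eq_bigr => i _; rewrite /vabs -Rabs_mult Rabs_pos_eq //; exact: Rle_0_sqr.
Qed.

(** Off-diagonal entries are nonpositive, so aligning the signs of the coordinates can only lower
    the form. Hence the absolute value of a minimizer is a minimizer. *)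
Lemma Q_vabs v : Q (vabs v) <= Q v.
Proof.
apply: bsum_le => i _; rewrite -!bsum_scal; apply: bsum_le => j _.
rewrite /vabs; have [->|/eqP ne] := eqVneq i j.
  have E : Rabs (v j) * Rabs (v j) = v j * v j by rewrite -Rabs_mult Rabs_pos_eq //; exact: Rle_0_sqr.
  by apply: Req_le; transitivity (M j j * (Rabs (v j) * Rabs (v j))); [ring | rewrite E; ring].
have := Moff ne; have : v i * v j <= Rabs (v i) * Rabs (v j) by rewrite -Rabs_mult; exact: Rle_abs.
nra.
Qed.

(** At a zero coordinate the eigenvalue equation is a vanishing sum of terms of one sign;
    irreducibility links the zero set to a positive coordinate and makes one term nonzero. *)
Lemma eigen_pos lam v i1 : (forall i, 0 <= v i) -> 0 < v i1 ->
  (forall i, Mop v i = lam * v i) -> forall i, 0 < v i.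
Proof.
move=> h0 h1 he i; apply: Rnot_le_lt => hi.
case: (Mirr (A := fun k => v k = 0)).
- by exists i; have := h0 i; lra.
- by exists i1; lra.
move=> k [j [hk [hj hM]]].
have := he k; rewrite hk Rmult_0_r /Mop => hz.
have : 0 < \rsum_l (- (M k l * v l)).
  apply: (@rsum_gt0 _ _ j) => [l|].
    have [->|/eqP ne] := eqVneq l k; first by rewrite hk; lra.
    by have := Moff (not_eq_sym ne); have := h0 l; nra.
  by case: (h0 j) => [p|e]; [nra | case: hj].
rewrite bsum_opp; lra.
Qed.

(** [lam] is the lowest eigenvalue, [e] its positive eigenvector and [g] a lower bound for the
    distance to the rest of the spectrum. The normalisation [sg e = 1] fits the parametrisation by
    the sum and gives [e i <= 1]. *)
Definition perron_data lam (e : V) g :=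
  [/\ 0 < g, (forall i, 0 < e i), sg e = 1, (forall i, Mop e i = lam * e i) &
   (forall v, lam * dot v v <= Q v) /\ (forall v, dot v e = 0 -> (lam + g) * dot v v <= Q v)].

Lemma perron : exists lam e g, perron_data lam e g.
Proof.
have dl : dot (fun j => if j == i0 then 1 else 0) (fun j => if j == i0 then 1 else 0) = 1.
  rewrite /dot -[RHS](@rsum_delta _ (fun _ => 1) i0).
  by apply: eq_bigr => j _; case: eqP => _; ring.
case: (@rayleigh_min (fun _ => 0)) => [|v0 [h1 [_ h2]]].
  exists (fun j => if j == i0 then 1 else 0); split=> //.
  by apply: big1 => j _; ring.
have {}h2 v : Q v0 * dot v v <= Q v by apply: h2; apply: big1 => j _; ring.
set lam := Q v0 in h2.
have eigabs v : Q v = lam * dot v v -> forall i, Mop (vabs v) i = lam * vabs v i.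
  move=> h; apply: min_eigen => //; apply: Rle_antisym.
    by rewrite dot_vabs -h; exact: Q_vabs.
  exact: h2.
have abspos v : Q v = lam * dot v v -> (exists i, v i <> 0) -> forall i, 0 < vabs v i.
  move=> h [i hi]; apply: (@eigen_pos lam _ i) => [k||k].
  - exact: Rabs_pos.
  - exact: Rabs_pos_lt.
  - exact: eigabs.
have Q0 : Q v0 = lam * dot v0 v0 by rewrite h1 Rmult_1_r.
have nz0 : exists i, v0 i <> 0.
  apply: NNPP => h; have : dot v0 v0 = 0; last lra.
  by apply: big1 => i _; have -> : v0 i = 0; [apply: NNPP => hi; apply: h; exists i | ring].
pose c := sg (vabs v0).
have c0 : 0 < c.
  apply: (@rsum_gt0 _ _ i0) => [j|]; [exact: Rabs_pos | exact: abspos].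
pose e i := / c * vabs v0 i.
have epos i : 0 < e i by apply: Rmult_lt_0_compat; [exact: Rinv_0_lt_compat | exact: abspos].
have ee i : Mop e i = lam * e i by rewrite /e MopZ eigabs //; ring.
have se : sg e = 1 by rewrite /e sgZ -/c; field; lra.
suff [g [g0 hg]] : exists g, 0 < g /\ forall v, dot v e = 0 -> (lam + g) * dot v v <= Q v.
  by exists lam, e, g; split.
(* In dimension one nothing nonzero is orthogonal to [e], and any positive gap serves. *)
have [hex|hne] := classic (exists v, dot v v = 1 /\ dot v e = 0); last first.
  exists 1; split; [lra|] => v hv.
  case: (dot_ge0 v) => [p|/esym hz].
    case: hne; exists (fun i => / sqrt (dot v v) * v i).
    rewrite !dotZl dotZr hv -Rmult_assoc -Rinv_mult sqrt_sqrt; last lra.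
    by split; [field; lra | ring].
  rewrite hz Rmult_0_r; have := h2 v; rewrite hz; lra.
case: (rayleigh_min hex) => w [w1 [w2 w3]].
exists (Q w - lam); split; last first.
  by move=> v hv; have := w3 v hv; lra.
have := h2 w; rewrite w1 Rmult_1_r; case; first lra.
move=> el; have Qw : Q w = lam * dot w w by rewrite w1; lra.
have ew := min_eigen h2 Qw.
have nzw : exists i, w i <> 0.
  apply: NNPP => h; have : dot w w = 0; last lra.
  by apply: big1 => i _; have -> : w i = 0; [apply: NNPP => hi; apply: h; exists i | ring].
(* If the second minimum [w] had eigenvalue [lam] too, then [vabs w + w] would be a nonnegative
   eigenvector, nonzero and hence positive everywhere. But [w], being orthogonal to a positive
   vector, has a negative coordinate, where this sum is zero. *)
have signs (t : V) : dot t e = 0 -> (exists i, t i <> 0) -> exists i, t i < 0.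
  move=> ht [i hi]; apply: NNPP => h.
  have hh j : 0 <= t j by apply: Rnot_lt_le => h3; apply: h; exists j.
  have : 0 < dot t e; last lra.
  apply: (@rsum_gt0 _ _ i) => [j|]; first by have := hh j; have := epos j; nra.
  have := hh i; have := epos i => ? ?; apply: Rmult_lt_0_compat => //; lra.
case: (signs w w2 nzw) => i hi.
case: (signs (fun i => - w i)) => [|| j hj].
- by rewrite dotNl w2; ring.
- by case: nzw => k hk; exists k; lra.
have := @eigen_pos lam (fun k => vabs w k + w k) j.
move=> H; have : 0 < vabs w i + w i.
  apply: H => [k||k].
  - by rewrite /vabs; have := Rle_abs (- w k); rewrite Rabs_Ropp; lra.
  - by have := Rabs_pos (w j); rewrite /vabs; lra.
  - by rewrite MopD ew eigabs //; ring.
rewrite /vabs Rabs_left //; lra.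
Qed.

(** Two positive vectors are never orthogonal, so their eigenvalues agree; the gap then annihilates
    the component of [e'] orthogonal to [e]. *)
Lemma perron_unique lam e g lam' (e' : V) : perron_data lam e g ->
  (forall i, 0 < e' i) -> sg e' = 1 -> (forall i, Mop e' i = lam' * e' i) ->
  lam' = lam /\ e' = e.
Proof.
move=> [g0 ep se ee [_ hg]] ep' se' ee'.
have p : 0 < dot e' e.
  apply: (@rsum_gt0 _ _ i0) => [j|]; [apply: Rlt_le|]; exact: Rmult_lt_0_compat.
have q : 0 < dot e e.
  apply: (@rsum_gt0 _ _ i0) => [j|]; [apply: Rlt_le|]; exact: Rmult_lt_0_compat.
have Me : Mop e = fun i => lam * e i by apply: functional_extensionality.
have Me' : Mop e' = fun i => lam' * e' i by apply: functional_extensionality.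
have el : lam' = lam.
  have := Msym e e'; rewrite Me Me' !dotZr (dotC e e') => h.
  by apply: (Rmult_eq_reg_r (dot e' e)) => //; lra.
split=> //.
pose c := dot e' e / dot e e.
pose w i := e' i + - c * e i.
have hw : dot w e = 0 by rewrite dotDl dotZl /c; field; lra.
have wz : dot w w = 0.
  have hq : Q w = lam * dot w w.
    rewrite /Q (_ : Mop w = fun i => lam * w i) ?dotZr //.
    by apply: functional_extensionality => i; rewrite MopD MopZ ee ee' el /w; ring.
  have := hg w hw; rewrite hq; have := dot_ge0 w; nra.
have hc : e' = fun i => c * e i.
  by apply: functional_extensionality => i; have := dot_eq0 wz i; rewrite /w; lra.
have : sg e' = c * sg e by rewrite hc sgZ.
rewrite se se' Rmult_1_r => c1; rewrite hc -c1.
by apply: functional_extensionality => i; ring.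
Qed.
End Perron.

Lemma vpos_min (I : finType) (e : I -> R) : (forall i, 0 < e i) -> exists m, 0 < m /\ forall i, m <= e i.
Proof.
move=> h; apply: (@fin_delta I (fun i m => m <= e i)) => [i|i m m' hm hi]; last lra.
by exists (e i); split; [exact: h | lra].
Qed.

(** * Expansion of the field at a critical point *)

Section Local.
Variables (I : finType) (i0 : I) (W : (I -> R) -> R) (f : (I -> R) -> I -> R).
Variables (H : (I -> R) -> I -> I -> R) (C : R).
Hypothesis HS : gsys W f H C.
Local Notation V := (I -> R).
Implicit Types x y z v w : V.
Local Notation N := (INR #|I|).

Lemma perron_at z : exists lam e g, perron_data (H z) lam e g.
Proof.
apply: (perron i0).
- exact: (H_dot_sym HS z).
- exact: (gs_off HS z).
- by move=> A h1 h2; case: (gs_irr HS h1 h2) => i [j [a [b c]]]; exists i, j.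
Qed.

Lemma perron_at_unique z lam e g lam' e' : perron_data (H z) lam e g ->
  (forall i, 0 < e' i) -> sg e' = 1 -> (forall i, Mop (H z) e' i = lam' * e' i) ->
  lam' = lam /\ e' = e.
Proof. by apply: (perron_unique i0); exact: (H_dot_sym HS z). Qed.

Lemma expand z eta : 0 < eta -> exists d, 0 < d /\ forall w, (forall i, Rabs (w i) < d) ->
  forall i, Rabs (f (fun j => z j + w j) i - f z i + Mop (H z) w i) <= eta * nrm w.
Proof.
move=> h; case: (gs_Hc HS z h) => d [d0 hd]; exists d; split=> // w hw i.
case: (f_mvt HS z (fun j => z j + w j) i) => s [hs ->].
rewrite /Mop -bsum_opp -bsum_add -bsum_scal.
apply: Rle_trans (bsum_abs _ _ _) _; apply: bsum_le => j _.
rewrite (_ : _ + _ = (H (seg z (fun j => z j + w j) s) i j - H z i j) * - w j); last by ring.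
rewrite Rabs_mult Rabs_Ropp; apply: Rmult_le_compat_r; first exact: Rabs_pos.
apply: Rlt_le; apply: hd => k; apply: Rle_lt_trans (seg_close _ _ _ hs) _.
by rewrite (_ : z k + w k - z k = w k); last ring.
Qed.

(** On the line through [z] along [e] the field is [- s * lam * e] up to an error below half its
    smallest coordinate. All coordinates thus have one sign, which makes these points strict sub- or
    supersolutions. *)
Lemma push z lam e : (forall i, f z i = 0) -> (forall i, 0 < e i) ->
  (forall i, Mop (H z) e i = lam * e i) -> lam <> 0 ->
  exists d, 0 < d /\ forall s, s <> 0 -> Rabs s < d -> forall i, f (fun j => z j + s * e j) i * (s * lam) < 0.
Proof.
move=> hz ep ee l0.
case: (vpos_min ep) => m [m0 hm].
have ne : 0 < nrm e by apply: (@nrm_gt0 _ _ i0); have := ep i0; lra.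
have la := Rabs_pos_lt _ l0.
have heta : 0 < Rabs lam * m / (2 * nrm e) by apply: Rdiv_lt_0_compat; nra.
case: (expand z heta) => d [d0 hd].
exists (d / nrm e); split=> [|s s0 hs i]; first exact: Rdiv_lt_0_compat.
have sd : Rabs s * nrm e < d.
  have := Rmult_lt_compat_r _ _ _ ne hs; by rewrite (_ : d / nrm e * nrm e = d); last by field; lra.
have := hd (fun j => s * e j).
have sa := Rabs_pos_lt _ s0.
move=> Hx; have {Hx}: Rabs (f (fun j => z j + s * e j) i - f z i + Mop (H z) (fun j => s * e j) i) <= Rabs lam * m / (2 * nrm e) * nrm (fun j => s * e j).
  apply: Hx => j; rewrite Rabs_mult; apply: Rle_lt_trans sd; apply: Rmult_le_compat_l; [lra | exact: nrm_coord].
rewrite hz MopZ ee nrmZ.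
have -> : Rabs lam * m / (2 * nrm e) * (Rabs s * nrm e) = Rabs lam * Rabs s * m / 2 by field; lra.
set F := f _ i => h1.
have h2 : Rabs (F + s * (lam * e i)) < Rabs (s * lam) * e i.
  apply: (@Rle_lt_trans _ (Rabs lam * Rabs s * m / 2)).
    by rewrite (_ : F + s * (lam * e i) = F - 0 + s * (lam * e i)); last ring.
  rewrite Rabs_mult; have := hm i; have : 0 < Rabs lam * Rabs s by exact: Rmult_lt_0_compat.
  nra.
have := ep i; move: h2; rewrite (_ : s * (lam * e i) = (s * lam) * e i); last ring.
have : s * lam <> 0 by apply: Rmult_integral_contrapositive.
set q := s * lam => q0.
rewrite /(Rabs q); case: Rcase_abs => hq /Rabs_def2 [h3 h4] h5; nra.
Qed.
End Local.

(** * Critical points in order intervals *)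

Definition tlim_p (I : finType) (x : R -> I -> R) (l : I -> R) :=
  forall e, 0 < e -> exists T, forall t, T < t -> forall i, Rabs (x t i - l i) < e.
Definition tlim_m (I : finType) (x : R -> I -> R) (l : I -> R) :=
  forall e, 0 < e -> exists T, forall t, t < T -> forall i, Rabs (x t i - l i) < e.

(** The sign of the lowest eigenvalue separates index zero from index at least one; the latter is
    called [unstable]. *)
Definition stable (I : finType) (f : (I -> R) -> I -> R) (H : (I -> R) -> I -> I -> R) z :=
  crit f z /\ exists lam e g, perron_data (H z) lam e g /\ 0 < lam.
Definition unstable (I : finType) (f : (I -> R) -> I -> R) (H : (I -> R) -> I -> I -> R) z :=
  crit f z /\ exists lam e g, perron_data (H z) lam e g /\ lam < 0.
Definition nondeg (I : finType) (f : (I -> R) -> I -> R) (H : (I -> R) -> I -> I -> R) :=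
  forall z, crit f z -> forall v, (forall i, Mop (H z) v i = 0) -> forall i, v i = 0.

Section Mono.
Variables (I : finType) (i0 : I) (W : (I -> R) -> R) (f : (I -> R) -> I -> R).
Variables (H : (I -> R) -> I -> I -> R) (C : R).
Hypothesis HS : gsys W f H C.
Local Notation V := (I -> R).
Implicit Types x y z v w : V.
Local Notation N := (INR #|I|).
Variable Phi : R -> V -> V.
Hypothesis Phi0 : forall x, Phi 0 x = x.
Hypothesis PhiD : forall x t i, derivable_pt_lim (fun t => Phi t x i) t (f (Phi t x) i).
Hypothesis HM : nondeg f H.
Local Notation crit := (crit f).
Local Notation stable := (stable f H).
Local Notation unstable := (unstable f H).

Lemma perron_e_le1 M lam e g i : @perron_data I M lam e g -> e i <= 1.
Proof.
move=> [_ ep <- _ _]; apply: (@rsum_term _ e) => j; exact: Rlt_le.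
Qed.

Lemma stable_or_unstable z : crit z -> stable z \/ unstable z.
Proof.
move=> hz; case: (perron_at i0 HS z) => lam [e [g hp]].
have [lt|[e0|gt]] := Rtotal_order lam 0.
- by right; split=> //; exists lam, e, g.
- case: hp => _ ep _ ee _; have := HM hz (v := e); rewrite e0 in ee.
  by move=> h; have := ep i0; rewrite h; [lra | move=> i; rewrite ee; ring].
- by left; split=> //; exists lam, e, g.
Qed.

Lemma W_le x s t : s <= t -> W (Phi t x) <= W (Phi s x).
Proof.
move=> st; suff : - W (Phi s x) <= - W (Phi t x) by lra.
apply: (@nondecr_of_deriv (fun t => - W (Phi t x)) (fun t => - - dot (f (Phi t x)) (f (Phi t x)))) => // r _.
  apply: derivable_pt_lim_opp; exact: (W_decr_deriv HS PhiD).
by rewrite Ropp_involutive; exact: dot_ge0.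
Qed.

(** No loss of energy over unit time forces zero velocity at some moment, and an orbit critical at
    one moment is constant. This is the test by which limits and minimizers are recognised as
    critical. *)
Lemma W_stat x : W x <= W (Phi 1 x) -> crit x.
Proof.
move=> h.
case: (MVT_cor2 _ _ 0 1 Rlt_0_1 (fun c _ => W_decr_deriv HS PhiD x c)) => c.
rewrite Phi0 => -[hc _].
have h1 : dot (f (Phi c x)) (f (Phi c x)) = 0 by have := dot_ge0 (f (Phi c x)); lra.
have h2 : crit (Phi c x) by exact: dot_eq0.
by apply: NNPP => h3; exact: (noncrit_Phi HS Phi0 PhiD h3 h2).
Qed.

(** LaSalle's principle along integer times, in the invariant order interval of two critical points.
    The energy bound is kept because the index-one argument compares levels. *)
Lemma omega_point a b x : crit a -> crit b -> vle a x -> vle x b ->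
  exists y phi, crit y /\ vle a y /\ vle y b /\ W y <= W x /\ strict_mono phi /\
    vlim (fun n => Phi (INR (phi n)) x) y.
Proof.
move=> ha hb ax xb.
have box t : 0 <= t -> vle a (Phi t x) /\ vle (Phi t x) b.
  move=> t0; split.
    by rewrite -(crit_fixed HS Phi0 PhiD t ha); exact: (Phi_le HS Phi0 PhiD).
  by rewrite -(crit_fixed HS Phi0 PhiD t hb); exact: (Phi_le HS Phi0 PhiD).
have bB n i : Rabs (Phi (INR n) x i) <= nrm a + nrm b.
  case: (box (INR n) (pos_INR n)) => /(_ i) h1 /(_ i) h2.
  have := nrm_coord a i; have := nrm_coord b i => /Rabs_bnd ? /Rabs_bnd ?.
  by have := nrm_ge0 a; have := nrm_ge0 b => ? ?; apply: Rabs_le; lra.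
case: (bolzano (u := fun n => Phi (INR n) x) bB) => phi [y [hp hl]].
exists y, phi; do !split=> //.
- apply: W_stat.
  have l1 := W_vlim HS (Phi_vlim HS Phi0 PhiD 1 hl).
  have l2 : seq_lim (fun n => W (Phi (INR (phi n.+1)) x)) (W y).
    move=> e he; case: (W_vlim HS hl he) => M hM; exists M => n hn.
    by apply: (hM n.+1); apply: leqW.
  (* A loss of energy from [y] to [Phi 1 y] would show along the sequence, but
     [phi n + 1 <= phi n.+1] bounds the later energies by those after one time unit, and they have
     limit [W y]. *)
  apply: Rnot_lt_le => lt.
  case: (l1 ((W y - W (Phi 1 y)) / 2)) => [|M1 h1]; first lra.
  case: (l2 ((W y - W (Phi 1 y)) / 2)) => [|M2 h2]; first lra.
  have := h1 (maxn M1 M2) (leq_maxl _ _); have := h2 (maxn M1 M2) (leq_maxr _ _).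
  set n := maxn _ _; rewrite /= -(Phi_add HS Phi0 PhiD).
  have := @W_le x (1 + INR (phi n)) (INR (phi n.+1)).
  rewrite Rplus_comm -S_INR => hw; have {}hw := hw (le_INR _ _ (elimT leP (hp n))).
  move=> /Rabs_def2 ? /Rabs_def2; lra.
- move=> i; apply: seq_lim_ge (hl i) _; exists 0%nat => n _.
  by case: (box _ (pos_INR (phi n))) => h _; apply: h.
- move=> i; apply: seq_lim_le (hl i) _; exists 0%nat => n _.
  by case: (box _ (pos_INR (phi n))) => _; apply.
- apply: seq_lim_le (W_vlim HS hl) _; exists 0%nat => n _ /=.
  by rewrite -{2}(Phi0 x); apply: W_le; exact: pos_INR.
Qed.

(** A nondecreasing bounded orbit converges as a whole and not only along a subsequence; the limit
    is fixed by [Phi 1] and therefore critical. *)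
Lemma sub_limit x b : (forall i, 0 <= f x i) -> crit b -> vle x b ->
  exists y, crit y /\ vle x y /\ vle y b /\ tlim_p (fun t => Phi t x) y /\
    forall t, 0 <= t -> vle (Phi t x) y.
Proof.
move=> hx hb xb.
have mono s t : 0 <= s <= t -> vle (Phi s x) (Phi t x) by exact: (sub_mono HS Phi0 PhiD).
have box t : 0 <= t -> vle x (Phi t x) /\ vle (Phi t x) b.
  move=> t0; split; first exact: (sub_le HS Phi0 PhiD).
  by rewrite -(crit_fixed HS Phi0 PhiD t hb); exact: (Phi_le HS Phi0 PhiD).
have bB n i : Rabs (Phi (INR n) x i) <= nrm x + nrm b.
  case: (box (INR n) (pos_INR n)) => /(_ i) h1 /(_ i) h2.
  have := nrm_coord x i; have := nrm_coord b i => /Rabs_bnd ? /Rabs_bnd ?.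
  by have := nrm_ge0 x; have := nrm_ge0 b => ? ?; apply: Rabs_le; lra.
case: (bolzano (u := fun n => Phi (INR n) x) bB) => phi [y [hp hl]].
have below t : 0 <= t -> vle (Phi t x) y.
  move=> t0 i; apply: seq_lim_ge (hl i) _.
  case: (INR_unbounded t) => n hn; exists n => m hm /=.
  apply: mono; split=> //; apply: Rle_trans (Rlt_le _ _ hn) _.
  by apply: le_INR; apply/leP; apply: leq_trans hm _; exact: strict_mono_ge.
have lim : tlim_p (fun t => Phi t x) y.
  move=> e he; case: (vlim_unif hl he) => M hM; exists (INR (phi M)) => t ht i.
  have := hM M i (leqnn M) => /= h1.
  have ht0 := pos_INR (phi M).
  have h2 := below t ltac:(lra) i.
  have h3 := mono (INR (phi M)) t ltac:(lra) i.
  rewrite Rabs_left1; last lra.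
  by move/Rabs_def2: h1; lra.
have hfix : Phi 1 y = y.
  apply: functional_extensionality => i.
  apply: (seq_lim_unique (Phi_vlim HS Phi0 PhiD 1 hl i)).
  move=> e he; case: (lim e he) => T hT.
  case: (INR_unbounded T) => n hn; exists n => m hm /=.
  rewrite -(Phi_add HS Phi0 PhiD); apply: hT.
  have : INR n <= INR (phi m) by apply: le_INR; apply/leP; apply: leq_trans hm _; exact: strict_mono_ge.
  lra.
exists y; split; first by apply: W_stat; rewrite hfix; lra.
split; first by rewrite -{1}(Phi0 x); apply: below; lra.
split=> //; move=> i; apply: seq_lim_le (hl i) _; exists 0%nat => n _.
by case: (box _ (pos_INR (phi n))) => _; apply.
Qed.

Lemma vlt_room x y : vlt x y -> exists m, 0 < m /\ forall i, x i + m <= y i.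
Proof.
move=> h; case: (@vpos_min _ (fun i => y i - x i)) => [i|m [m0 hm]]; first by have := h i; lra.
by exists m; split=> // i; have := hm i; lra.
Qed.

(** At an unstable [y] the points [y - s * e] are supersolutions. One of them lies above [x] and
    would keep the orbit of [x] away from [y]. *)
Lemma sub_limit_stable x y : (forall i, 0 <= f x i) -> ~ crit x -> crit y ->
  tlim_p (fun t => Phi t x) y -> (forall t, 0 <= t -> vle (Phi t x) y) -> stable y.
Proof.
move=> hx nx cy hl hle; case: (stable_or_unstable cy) => // -[_ [lam [e [g [hp l0]]]]].
have xy : vlt x y.
  rewrite -(Phi0 x); apply: (@vlt_le_trans _ (Phi 1 x)); last by apply: hle; lra.
  by apply: (sub_lt HS Phi0 PhiD hx nx); lra.
case: (vlt_room xy) => m [m0 hm].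
case: (hp) => _ ep _ ee _.
case: (push i0 HS cy ep ee) => [|d [d0 hd]]; first lra.
pose s := Rmin (d / 2) m.
have s0 : 0 < s by apply: Rmin_glb_lt; lra.
have sd : s <= d / 2 by exact: Rmin_l.
have sm : s <= m by exact: Rmin_r.
have hf i : f (fun j => y j + - s * e j) i <= 0.
  have := hd (- s) ltac:(lra); rewrite Rabs_Ropp Rabs_pos_eq; last lra.
  move=> /(_ ltac:(lra) i); have : 0 < - s * lam by nra.
  nra.
have xle : vle x (fun j => y j + - s * e j).
  move=> i; have := hm i; have := perron_e_le1 i hp; have := ep i; nra.
have := ep i0 => e0.
case: (hl (s * e i0)) => [|T hT]; first nra.
have t0 : 0 <= Rmax T 0 + 1 by have := Rmax_r T 0; lra.
have := hT (Rmax T 0 + 1) _ i0 => /(_ ltac:(have := Rmax_l T 0; lra)) /Rabs_def2.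
have := (Phi_le HS Phi0 PhiD xle t0) i0.
have := (super_le HS Phi0 PhiD hf t0) i0.
lra.
Qed.

(** Points just above an unstable [z] climb to a stable point that is still at most [y]. Hence above
    an unstable point and up to any higher critical one there is a stable point, possibly the higher
    point itself. *)
Lemma unstable_up z lam e g y : crit z -> perron_data (H z) lam e g -> lam < 0 ->
  crit y -> vlt z y ->
  exists d, 0 < d /\ forall s, 0 < s < d -> (forall i, 0 < f (fun j => z j + s * e j) i) /\
    exists y', stable y' /\ vlt z y' /\ vle (fun j => z j + s * e j) y' /\ vle y' y /\ tlim_p (fun t => Phi t (fun j => z j + s * e j)) y'.
Proof.
move=> cz hp l0 cy zy.
case: (vlt_room zy) => m [m0 hm].
case: (hp) => _ ep _ ee _.
case: (push i0 HS cz ep ee) => [|d [d0 hd]]; first lra.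
exists (Rmin d m); split=> [|s [s0 sd]]; first exact: Rmin_glb_lt.
have sd1 := Rlt_le_trans _ _ _ sd (Rmin_l d m).
have sd2 := Rlt_le_trans _ _ _ sd (Rmin_r d m).
have hf i : 0 < f (fun j => z j + s * e j) i.
  have := hd s ltac:(lra); rewrite Rabs_pos_eq; last lra.
  move=> /(_ ltac:(lra) i); have : s * lam < 0 by nra.
  nra.
split=> //.
have hf' i := Rlt_le _ _ (hf i).
have xle : vle (fun j => z j + s * e j) y.
  move=> i; have := hm i; have := perron_e_le1 i hp; have := ep i; nra.
case: (sub_limit hf' cy xle) => y' [c' [h1 [h2 [h3 h4]]]].
exists y'; split; last first.
  split; last by [].
  by move=> i; have := h1 i; have := ep i; nra.
apply: (@sub_limit_stable (fun j => z j + s * e j)) => //.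
by move=> h; have := hf i0; rewrite h; lra.
Qed.

(** By compactness of the sphere nondegeneracy is quantitative, [k * dot w w <= dot (H w) (H w)],
    while at a second critical point the expansion makes [H w] small relative to [w]. *)
Lemma isolated z : crit z -> exists rho, 0 < rho /\ forall y, crit y ->
  (forall i, Rabs (y i - z i) < rho) -> y = z.
Proof.
move=> cz.
have [k [k0 hk]] : exists k, 0 < k /\ forall w, k * dot w w <= dot (Mop (H z) w) (Mop (H z) w).
  case: (@seq_min I (fun v => dot v v = 1) (fun w => dot (Mop (H z) w) (Mop (H z) w)) 1).
  - exists (fun j => if j == i0 then 1 else 0).
    rewrite /dot -[RHS](@rsum_delta _ (fun _ => 1) i0).
    by apply: eq_bigr => j _; case: eqP => _; ring.
  - move=> x i h; have : x i * x i <= dot x x.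
      by apply: (@rsum_term _ (fun i => x i * x i)) => j; exact: Rle_0_sqr.
    by rewrite h => h1; apply: Rabs_le; nra.
  - move=> u l hu hl; apply: seq_lim_unique (seq_lim_dot hl hl) _.
    by move=> e he; exists 0%nat => n _; rewrite hu Rminus_diag Rabs_R0.
  - by move=> u l hl; apply: seq_lim_dot; exact: Mop_lim.
  move=> v [v1 hv]; exists (dot (Mop (H z) v) (Mop (H z) v)); split.
    case: (dot_ge0 (Mop (H z) v)) => // /esym h0.
    have hz := HM cz (dot_eq0 h0); move: v1.
    have -> : dot v v = 0 by apply: big1 => i _; rewrite hz; ring.
    lra.
  move=> w; case: (dot_ge0 w) => [p|/esym e]; last by rewrite e Rmult_0_r; exact: dot_ge0.
  have MZ a u : Mop (H z) (fun i => a * u i) = fun i => a * Mop (H z) u i.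
    by apply: functional_extensionality => i; exact: MopZ.
  have := hv (fun i => / sqrt (dot w w) * w i).
  have e2 : / sqrt (dot w w) * / sqrt (dot w w) = / dot w w.
    by rewrite -Rinv_mult sqrt_sqrt; lra.
  rewrite MZ !dotZl !dotZr -!Rmult_assoc e2 Rinv_l; last lra.
  move=> /(_ erefl) h; have := Rmult_le_compat_r _ _ _ (Rlt_le _ _ p) h.
  by rewrite (_ : / dot w w * _ * dot w w = dot (Mop (H z) w) (Mop (H z) w)); last by field; lra.
have N0 := pos_INR #|I|.
(* Three factors [N] arise from passing between the l1 norm and the scalar product; [eta <= 1] turns
   the square of [eta] into [eta]. *)
pose eta := Rmin 1 (k / (2 * (N * N * N + 1))).
have n3 : 0 <= N * N * N by do 2!apply: Rmult_le_pos => //.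
have eta0 : 0 < eta by apply: Rmin_glb_lt; [lra | apply: Rdiv_lt_0_compat; lra].
case: (expand HS z eta0) => d [d0 hd]; exists d; split=> // y cy hy.
pose w i := y i - z i.
have yE : y = (fun j => z j + w j) by apply: functional_extensionality => j; rewrite /w; ring.
have hw i : Rabs (Mop (H z) w i) <= eta * nrm w.
  have := hd w hy i; rewrite -yE cy cz.
  by rewrite (_ : 0 - 0 + Mop (H z) w i = Mop (H z) w i) //; ring.
have h1 : nrm (Mop (H z) w) <= N * (eta * nrm w) by exact: nrm_bound.
have h2 := dot_le_nrm2 (Mop (H z) w).
have h3 := nrm_nrm w; have h4 := hk w.
have h5 : eta * (2 * (N * N * N + 1)) <= k by apply: le_div_mul; [lra | exact: Rmin_r].
have h6 : eta <= 1 by exact: Rmin_l.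
have n0 := nrm_ge0 w; have n1 := nrm_ge0 (Mop (H z) w).
have D0 := dot_ge0 w.
have h7 : nrm (Mop (H z) w) * nrm (Mop (H z) w) <= (N * (eta * nrm w)) * (N * (eta * nrm w)).
  by apply: Rmult_le_compat.
have h8 : (N * (eta * nrm w)) * (N * (eta * nrm w)) <= N * N * eta * (nrm w * nrm w).
  have -> : (N * (eta * nrm w)) * (N * (eta * nrm w)) = eta * (N * N * eta * (nrm w * nrm w)) by ring.
  have : 0 <= N * N * eta * (nrm w * nrm w) by apply: Rmult_le_pos; [apply: Rmult_le_pos; [nra|lra] | nra].
  nra.
have h9 : N * N * eta * (nrm w * nrm w) <= N * N * eta * (N * dot w w).
  by apply: Rmult_le_compat_l; [apply: Rmult_le_pos; [nra|lra] | lra].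
have h10 : dot w w = 0.
  apply: Rle_antisym => //; apply: Rnot_lt_le => lt.
  have : eta * (N * N * N) * dot w w < k * dot w w.
    by apply: Rmult_lt_compat_r => //; nra.
  nra.
by apply: functional_extensionality => i; have := dot_eq0 h10 i; rewrite /w; lra.
Qed.

(** If no list exhausted them, choosing repeatedly a critical point outside the list of the earlier
    ones would give distinct bounded critical points, whose limit point is critical and not
    isolated. *)
Lemma finite_crit a b : exists L : list V, forall y, crit y -> vle a y -> vle y b -> List.In y L.
Proof.
apply: NNPP => hn.
have hs (L : list V) : exists y, crit y /\ vle a y /\ vle y b /\ ~ List.In y L.
  apply: NNPP => h; apply: hn; exists L => y h1 h2 h3; apply: NNPP => h4.
  by apply: h; exists y.
pose nx L := proj1_sig (constructive_indefinite_description _ (hs L)).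
have nxP L : crit (nx L) /\ vle a (nx L) /\ vle (nx L) b /\ ~ List.In (nx L) L.
  by rewrite /nx; case: constructive_indefinite_description.
pose ls := fix ls n := match n with 0%nat => nil | n'.+1 => nx (ls n') :: ls n' end.
pose u n := nx (ls n).
have uin n m : (n < m)%nat -> List.In (u n) (ls m).
  elim: m => // m IH; rewrite ltnS leq_eqVlt => /orP[/eqP->|/IH h]; [by left | by right].
have une n m : (n < m)%nat -> u m <> u n.
  by move=> /uin h e; case: (nxP (ls m)) => _ [_ [_]]; rewrite -/(u m) e.
have bB n i : Rabs (u n i) <= nrm a + nrm b.
  case: (nxP (ls n)) => _ [/(_ i) h1 [/(_ i) h2 _]].
  have := nrm_coord a i; have := nrm_coord b i => /Rabs_bnd ? /Rabs_bnd ?.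
  by have := nrm_ge0 a; have := nrm_ge0 b => ? ?; apply: Rabs_le; rewrite /u; lra.
case: (bolzano bB) => phi [y [hp hl]].
have cy : crit y.
  move=> i; apply: seq_lim_unique (f_vlim HS hl i) _ => e he; exists 0%nat => n _.
  by rewrite /=; case: (nxP (ls (phi n))) => -> _; rewrite Rminus_diag Rabs_R0.
case: (isolated cy) => rho [r0 hr].
case: (vlim_unif hl r0) => M hM.
have e n : (M <= n)%nat -> u (phi n) = y.
  by move=> hn'; apply: hr; [case: (nxP (ls (phi n))) | move=> i; exact: hM].
by apply: (une (phi M) (phi M.+1)) (hp M) _; rewrite !e.
Qed.
End Mono.

(** * Order reversal *)

Lemma vopp_le (I : finType) (x y : I -> R) : vle x y <-> vle (vopp y) (vopp x).
Proof. by split=> h i; have := h i; rewrite /vopp; lra. Qed.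
Lemma vopp_lt (I : finType) (x y : I -> R) : vlt x y <-> vlt (vopp y) (vopp x).
Proof. by split=> h i; have := h i; rewrite /vopp; lra. Qed.
Lemma vopp_inj (I : finType) (x y : I -> R) : vopp x = vopp y -> x = y.
Proof. by move=> h; rewrite -(voppK x) h voppK. Qed.

Section Rev.
Variables (I : finType) (f : (I -> R) -> I -> R) (H : (I -> R) -> I -> I -> R).
Local Notation V := (I -> R).
Variable Phi : R -> V -> V.
Definition frev x := vopp (f (vopp x)).
Definition Hrev x := H (vopp x).
Definition Phirev t x := vopp (Phi t (vopp x)).

Lemma Phirev0 : (forall x, Phi 0 x = x) -> forall x, Phirev 0 x = x.
Proof. by move=> h x; rewrite /Phirev h voppK. Qed.

Lemma PhirevD :
  (forall x t i, derivable_pt_lim (fun t => Phi t x i) t (f (Phi t x) i)) ->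
  forall x t i, derivable_pt_lim (fun t => Phirev t x i) t (frev (Phirev t x) i).
Proof.
by move=> h x t i; rewrite /frev /Phirev voppK; apply: derivable_pt_lim_opp; exact: h.
Qed.

Lemma crit_rev z : crit f z -> crit frev (vopp z).
Proof. by move=> h i; rewrite /frev voppK /vopp h Ropp_0. Qed.
Lemma crit_rev' z : crit frev z -> crit f (vopp z).
Proof. by move=> h i; have := h i; rewrite /frev {1}/vopp; lra. Qed.

Lemma nondeg_rev : nondeg f H -> nondeg frev Hrev.
Proof. by move=> h z /crit_rev' hz v hv; exact: (h _ hz). Qed.

Lemma stable_rev z : stable f H z <-> stable frev Hrev (vopp z).
Proof.
split=> -[hc hp].
  by split; [exact: crit_rev | rewrite /Hrev voppK].
by split; [rewrite -(voppK z); exact: crit_rev' | rewrite /Hrev voppK in hp].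
Qed.
Lemma unstable_rev z : unstable f H z <-> unstable frev Hrev (vopp z).
Proof.
split=> -[hc hp].
  by split; [exact: crit_rev | rewrite /Hrev voppK].
by split; [rewrite -(voppK z); exact: crit_rev' | rewrite /Hrev voppK in hp].
Qed.

Lemma tlim_p_rev (x : R -> V) l : tlim_p (fun t => vopp (x t)) (vopp l) <-> tlim_p x l.
Proof.
split=> h e he; case: (h e he) => T hT; exists T => t ht i; have := hT t ht i;
  by rewrite /vopp (_ : - x t i - - l i = - (x t i - l i)) ?Rabs_Ropp //; ring.
Qed.
Lemma tlim_m_rev (x : R -> V) l : tlim_m (fun t => vopp (x t)) (vopp l) <-> tlim_m x l.
Proof.
split=> h e he; case: (h e he) => T hT; exists T => t ht i; have := hT t ht i;
  by rewrite /vopp (_ : - x t i - - l i = - (x t i - l i)) ?Rabs_Ropp //; ring.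
Qed.
End Rev.

(** Connectedness of the unit interval by a supremum, stated as the existence of a point in neither
    set. It serves for paths between two basins and for the connectedness of the ghost circle. *)
Lemma connected01 (U V : R -> Prop) :
  (forall s, 0 <= s <= 1 -> U s -> exists d, 0 < d /\ forall r, 0 <= r <= 1 -> Rabs (r - s) < d -> U r) ->
  (forall s, 0 <= s <= 1 -> V s -> exists d, 0 < d /\ forall r, 0 <= r <= 1 -> Rabs (r - s) < d -> V r) ->
  (forall s, 0 <= s <= 1 -> U s -> V s -> False) -> U 0 -> V 1 ->
  exists s, 0 <= s <= 1 /\ ~ U s /\ ~ V s.
Proof.
move=> hU hV dis u0 v1.
case: (completeness (fun s => 0 <= s <= 1 /\ U s)) => [||m [m1 m2]].
- by exists 1 => s [hs _]; lra.
- by exists 0; split; [lra|].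
have m01 : 0 <= m <= 1.
  by split; [apply: m1; split=> //; lra | apply: m2 => s [hs _]; lra].
exists m; split=> //; split=> h.
- case: (hU m m01 h) => d [d0 hd].
  have [lt|ge] := Rlt_le_dec m 1; last first.
    have e : m = 1 by lra.
    by subst m; exact: (dis 1).
  pose r := Rmin (m + d / 2) 1.
  have r1 : r <= m + d / 2 by exact: Rmin_l.
  have r2 : r <= 1 by exact: Rmin_r.
  have r3 : m < r by apply: Rmin_glb_lt; lra.
  have : r <= m; last lra.
  by apply: m1; split; [lra | apply: hd; [lra | rewrite Rabs_pos_eq; lra]].
- case: (hV m m01 h) => d [d0 hd].
  have : m <= m - d / 2; last lra.
  apply: m2 => s [hs us]; apply: Rnot_lt_le => lt.
  apply: (dis s hs us); apply: hd => //.
  have := m1 s (conj hs us) => ?; rewrite Rabs_left1; lra.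
Qed.

(** * Consecutive stable points and the critical points between them *)

Section Gap.
Variables (I : finType) (i0 : I) (W : (I -> R) -> R) (f : (I -> R) -> I -> R).
Variables (H : (I -> R) -> I -> I -> R) (C : R).
Hypothesis HS : gsys W f H C.
Local Notation V := (I -> R).
Implicit Types x y z v w : V.
Local Notation N := (INR #|I|).
Variable Phi : R -> V -> V.
Hypothesis Phi0 : forall x, Phi 0 x = x.
Hypothesis PhiD : forall x t i, derivable_pt_lim (fun t => Phi t x i) t (f (Phi t x) i).
Hypothesis HM : nondeg f H.
Local Notation crit := (crit f).
Local Notation stable := (stable f H).
Local Notation unstable := (unstable f H).

Lemma unstable_down z lam e g y : crit z -> perron_data (H z) lam e g -> lam < 0 ->
  crit y -> vlt y z ->
  exists d, 0 < d /\ forall s, 0 < s < d ->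
    exists y', stable y' /\ vlt y' z /\ vle y' (fun j => z j + - s * e j) /\ vle y y' /\ tlim_p (fun t => Phi t (fun j => z j + - s * e j)) y'.
Proof.
move=> cz hp l0 cy yz.
have hp' : perron_data (Hrev H (vopp z)) lam e g by rewrite /Hrev voppK.
case: (@unstable_up I i0 _ _ _ C (gsys_rev HS) (Phirev Phi) (Phirev0 Phi0) (PhirevD PhiD) (nondeg_rev HM)
  (vopp z) lam e g (vopp y) (crit_rev cz) hp' l0 (crit_rev cy)) => [|d [d0 hd]].
  by move/vopp_lt: yz.
exists d; split=> // s hs; case: (hd s hs) => _ [y' [h1 [h2 [h3 [h4 h5]]]]].
have e1 : (fun j => z j + - s * e j) = vopp (fun j => vopp z j + s * e j).
  by apply: functional_extensionality => j; rewrite /vopp; ring.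
exists (vopp y'); split; first by apply/stable_rev; rewrite voppK.
split; first by apply/vopp_lt; rewrite voppK.
split; first by rewrite e1; apply/vopp_le; rewrite !voppK.
split; first by apply/vopp_le; rewrite voppK.
by rewrite e1; apply/tlim_p_rev; rewrite voppK; exact: h5.
Qed.

Definition gap a b := [/\ stable a, stable b, vlt a b &
  forall y, stable y -> vle a y -> vle y b -> y = a \/ y = b].

(** The basins of [a] and [b] cut out disjoint open sets on the path, one at each end, so some [c s]
    lies in neither. Its orbit accumulates at a critical point other than [a] and [b], of energy at
    most [W (c s)]. *)
Lemma gap_connect a b (c : R -> V) : gap a b -> (forall i, continuity (fun s => c s i)) ->
  (forall s, 0 <= s <= 1 -> vle a (c s) /\ vle (c s) b) ->
  (forall e, 0 < e -> exists t, 0 <= t /\ forall i, Phi t (c 0) i < a i + e) ->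
  (forall e, 0 < e -> exists t, 0 <= t /\ forall i, b i - e < Phi t (c 1) i) ->
  exists s y, 0 <= s <= 1 /\ crit y /\ vlt a y /\ vlt y b /\ W y <= W (c s).
Proof.
move=> [[ca [la [ea [ga [ha la0]]]]] [cb [lb [eb [gb [hb lb0]]]]] ab gp] cc box h0 h1.
case: (ha) => _ epa _ eea _; case: (hb) => _ epb _ eeb _.
case: (push i0 HS ca epa eea) => [|da [da0 hda]]; first lra.
case: (push i0 HS cb epb eeb) => [|db [db0 hdb]]; first lra.
case: (vlt_room ab) => m [m0 hm].
(* Entering the region below the supersolution [a'] or above the subsolution [b'] is irreversible
   and an open condition, which replaces convergence. The bound [m / 4] and [e i <= 1] keep [a']
   strictly below [b']. *)
pose s0 := Rmin (Rmin (da / 2) (db / 2)) (m / 4).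
have s00 : 0 < s0 by apply: Rmin_glb_lt; [apply: Rmin_glb_lt|]; lra.
have sda : s0 <= da / 2 by apply: Rle_trans (Rmin_l _ _) (Rmin_l _ _).
have sdb : s0 <= db / 2 by apply: Rle_trans (Rmin_l _ _) (Rmin_r _ _).
have sm : s0 <= m / 4 by exact: Rmin_r.
pose a' j := a j + s0 * ea j.
pose b' j := b j + - s0 * eb j.
have fa i : f a' i <= 0.
  have := hda s0 ltac:(lra); rewrite Rabs_pos_eq; last lra.
  move=> /(_ ltac:(lra) i); have : 0 < s0 * la by nra.
  rewrite -/a'; nra.
have fb i : 0 <= f b' i.
  have := hdb (- s0) ltac:(lra); rewrite Rabs_Ropp Rabs_pos_eq; last lra.
  move=> /(_ ltac:(lra) i); have : - s0 * lb < 0 by nra.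
  rewrite -/b'; nra.
have ab' : vlt a' b'.
  move=> i; have := hm i; have := perron_e_le1 i ha; have := perron_e_le1 i hb.
  by have := epa i; have := epb i; rewrite /a' /b'; nra.
pose U x := exists t, 0 <= t /\ vlt (Phi t x) a'.
pose D x := exists t, 0 <= t /\ vlt b' (Phi t x).
have near t s k : 0 < k -> exists d, 0 < d /\ forall r, Rabs (r - s) < d -> forall i,
    Rabs (Phi t (c r) i - Phi t (c s) i) < k.
  move=> k0; case: (Phi_cont HS Phi0 PhiD t (c s) k0) => d1 [d10 hd1].
  case: (@fin_delta I (fun i d => forall r, Rabs (r - s) < d -> Rabs (c r i - c s i) < d1)).
  - by move=> i; have := cc i s; move/continuity_pt_eps => /(_ d1 d10).
  - by move=> i d d' hd hP r hr; apply: hP; lra.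
  by move=> d [d0 hd]; exists d; split=> // r hr; apply: hd1 => i; exact: hd.
have openU s : U (c s) -> exists d, 0 < d /\ forall r, 0 <= r <= 1 -> Rabs (r - s) < d -> U (c r).
  move=> [t [t0 ht]]; case: (vlt_room ht) => k [k0 hk]; case: (near t s k k0) => d [d0 hd].
  exists d; split=> // r _ hr; exists t; split=> // i.
  by have := hd r hr i; have := hk i => ? /Rabs_def2; lra.
have openD s : D (c s) -> exists d, 0 < d /\ forall r, 0 <= r <= 1 -> Rabs (r - s) < d -> D (c r).
  move=> [t [t0 ht]]; case: (vlt_room ht) => k [k0 hk]; case: (near t s k k0) => d [d0 hd].
  exists d; split=> // r _ hr; exists t; split=> // i.
  by have := hd r hr i; have := hk i => ? /Rabs_def2; lra.
have stayU x t s : vle (Phi t x) a' -> t <= s -> vle (Phi s x) a'.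
  move=> h ts; have -> : s = (s - t) + t by ring.
  rewrite (Phi_add HS Phi0 PhiD).
  have st : 0 <= s - t by lra.
  apply: vle_trans (Phi_le HS Phi0 PhiD h st) _.
  exact: (super_le HS Phi0 PhiD).
have stayD x t s : vle b' (Phi t x) -> t <= s -> vle b' (Phi s x).
  move=> h ts; have -> : s = (s - t) + t by ring.
  rewrite (Phi_add HS Phi0 PhiD).
  have st : 0 <= s - t by lra.
  apply: vle_trans (Phi_le HS Phi0 PhiD h st).
  exact: (sub_le HS Phi0 PhiD).
have [s [hs [nU nD]]] : exists s, 0 <= s <= 1 /\ ~ U (c s) /\ ~ D (c s).
  apply: connected01.
  - by move=> s _; exact: openU.
  - by move=> s _; exact: openD.
  - move=> s _ [t1 [t10 hu]] [t2 [t20 hv]].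
    have k1 := stayU _ _ _ (vlt_le hu) (Rmax_l t1 t2).
    have k2 := stayD _ _ _ (vlt_le hv) (Rmax_r t1 t2).
    by have := k1 i0; have := k2 i0; have := ab' i0; lra.
  - case: (vpos_min epa) => k [k0 hk].
    case: (h0 (s0 * k)) => [|t [t0 ht]]; first nra.
    exists t; split=> // i; have := ht i; have := hk i; rewrite /a'; nra.
  - case: (vpos_min epb) => k [k0 hk].
    case: (h1 (s0 * k)) => [|t [t0 ht]]; first nra.
    exists t; split=> // i; have := ht i; have := hk i; rewrite /b'; nra.
case: (box s hs) => b1 b2.
case: (omega_point HS Phi0 PhiD ca cb b1 b2) => y [phi [cy [ay [yb [hW [hp hl]]]]]].
have close e : 0 < e -> exists t, 0 <= t /\ forall i, Rabs (Phi t (c s) i - y i) < e.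
  move=> he; case: (vlim_unif hl he) => M hM; exists (INR (phi M)).
  by split; [exact: pos_INR | move=> i; exact: (hM M i (leqnn M))].
have ya : a <> y.
  move=> e; apply: nU; case: (vpos_min epa) => k [k0 hk].
  case: (close (s0 * k)) => [|t [t0 ht]]; first nra.
  exists t; split=> // i; have := ht i; rewrite -e; have := hk i; rewrite /a' => ? /Rabs_def2; nra.
have yb' : y <> b.
  move=> e; apply: nD; case: (vpos_min epb) => k [k0 hk].
  case: (close (s0 * k)) => [|t [t0 ht]]; first nra.
  exists t; split=> // i; have := ht i; rewrite e; have := hk i; rewrite /b' => ? /Rabs_def2; nra.
exists s, y; split=> //; split=> //.
split; first exact: (crit_lt HS Phi0 PhiD ca cy).
by split; first exact: (crit_lt HS Phi0 PhiD cy cb).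
Qed.

Definition interior a b y := [/\ crit y, vlt a y & vlt y b].

Lemma interior_unstable a b y : gap a b -> interior a b y -> unstable y.
Proof.
move=> [_ _ _ gp] [cy ay yb]; case: (stable_or_unstable i0 HS HM cy) => // sy.
by case: (gp y sy (vlt_le ay) (vlt_le yb)) => e; subst y; [have := ay i0 | have := yb i0]; lra.
Qed.

Lemma gap_interior a b : gap a b -> exists y, interior a b y.
Proof.
move=> hg; have [[ca _] [cb _] ab _] := hg.
case: (@gap_connect a b (seg a b) hg) => [i||e he|e he|s [y [_ [cy [ay [yb _]]]]]].
- apply: derivable_continuous => t; exists (b i - a i); rewrite /seg.
  apply: (@derivable_pt_lim_eqf (fct_cte (a i) + mult_real_fct (b i - a i) Ranalysis1.id)%F).
    by move=> r; rewrite /plus_fct /fct_cte /mult_real_fct /Ranalysis1.id; ring.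
  apply: (@derivable_pt_lim_eql _ _ (0 + (b i - a i) * 1)); first ring.
  apply: derivable_pt_lim_plus; first exact: derivable_pt_lim_const.
  by apply: derivable_pt_lim_scal; exact: derivable_pt_lim_id.
- by move=> s hs; split=> i; have := ab i; rewrite /seg; nra.
- exists 0; split; first lra; move=> i; rewrite seg0 Phi0; lra.
- exists 0; split; first lra; move=> i; rewrite seg1 Phi0; lra.
by exists y.
Qed.

Lemma W_mvt_strict x v s : 0 < s -> exists r, 0 < r < s /\
  W (fun j => x j + s * v j) - W x = - dot (f (fun j => x j + r * v j)) v * s.
Proof.
move=> s0.
case: (MVT_cor2 (fun s => W (fun j => x j + s * v j)) _ 0 s s0 (fun c _ => W_line HS x v c)) => r [h1 h2].
exists r; split=> //; rewrite Rminus_0_r in h1; rewrite -h1; congr (_ - W _).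
by apply: functional_extensionality => j; ring.
Qed.

(** The radius is uniform over all bounded directions on which the form is at most [- m]; a whole
    path of directions has to stay below the level of [z] at once. *)
Lemma W_below z m B : crit z -> 0 < m -> exists d, 0 < d /\ forall u s, 0 < s < d -> nrm u <= B ->
  dot u (Mop (H z) u) <= - m -> W (fun j => z j + s * u j) < W z.
Proof.
move=> cz m0; have N0 := pos_INR #|I|.
pose B1 := Rmax B 1; have B11 : 1 <= B1 by exact: Rmax_r.
have NB0 : 0 <= N * B1 * B1 by apply: Rmult_le_pos; [nra | lra].
have heta : 0 < m / (2 * (N * B1 * B1 + 1)).
  by apply: Rdiv_lt_0_compat => //; lra.
set eta := _ / _ in heta.
case: (expand HS z heta) => d [d0 hd].
exists (d / B1); split=> [|u s [s0 sd] uB hQ]; first by apply: Rdiv_lt_0_compat; lra.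
have {}uB : nrm u <= B1 by apply: Rle_trans uB (Rmax_l _ _).
have sB : s * B1 < d.
  have := Rmult_lt_compat_r B1 _ _ ltac:(lra) sd; by rewrite (_ : d / B1 * B1 = d); last by field; lra.
case: (@W_mvt_strict z u s s0) => r [[r0 rs] hW].
suff : 0 < dot (f (fun j => z j + r * u j)) u by nra.
have hf i : Rabs (f (fun j => z j + r * u j) i - f z i + Mop (H z) (fun j => r * u j) i) <= eta * nrm (fun j => r * u j).
  apply: hd => j; rewrite Rabs_mult Rabs_pos_eq; last lra.
  have := nrm_coord u j; have := Rabs_pos (u j); nra.
pose rr i := f (fun j => z j + r * u j) i + r * Mop (H z) u i.
have rrb i : Rabs (rr i) <= eta * (r * B1).
  have := hf i; rewrite cz MopZ nrmZ (Rabs_pos_eq r); last lra.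
  rewrite (_ : _ - 0 + _ = rr i); last by rewrite /rr; ring.
  move=> h; apply: Rle_trans h _; apply: Rmult_le_compat_l; first lra.
  by apply: Rmult_le_compat_l; lra.
have -> : dot (f (fun j => z j + r * u j)) u = dot rr u - r * dot u (Mop (H z) u).
  by rewrite (dotC u) -dotZl -dotBl; apply: eq_bigr => i _; rewrite /rr; ring.
have h1 : Rabs (dot rr u) <= N * (eta * (r * B1)) * B1.
  apply: Rle_trans (dot_abs _ _) _; apply: Rmult_le_compat; try exact: nrm_ge0; last by [].
  exact: nrm_bound.
have h2 : eta * (2 * (N * B1 * B1 + 1)) = m.
  by rewrite /eta; field; lra.
have h3 : N * (eta * (r * B1)) * B1 < r * m.
  rewrite (_ : N * (eta * (r * B1)) * B1 = r * (eta * (N * B1 * B1))); last ring.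
  apply: Rmult_lt_compat_l => //; nra.
move/Rabs_bnd: h1; nra.
Qed.

(** A negative lowest eigenvalue and a nonnegative form on the orthogonal complement of its
    eigenvector leave exactly one negative eigenvalue. *)
Definition index1 z := crit z /\ exists lam e g, [/\ perron_data (H z) lam e g, lam < 0 &
  forall v, dot v e = 0 -> 0 <= dot v (Mop (H z) v)].

(* Among the interior critical points one of least energy has index one: otherwise
   a small half circle in the negative cone would join the two basins below its level. *)
Lemma gap_index1 a b : gap a b -> exists z, interior a b z /\ index1 z.
Proof.
move=> hg; have [[ca _] [cb _] ab gp] := hg.
case: (gap_interior hg) => y0 hy0.
case: (finite_crit i0 HS HM a b) => L hL.
have [z [hz zmin]] : exists z, interior a b z /\ forall y, interior a b y -> W z <= W y.
  have hh (l : list V) y1 : interior a b y1 ->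
     exists z, interior a b z /\ W z <= W y1 /\ forall y, interior a b y -> List.In y l -> W z <= W y.
    elim: l => [|x l IH] hy1; first by exists y1; split=> //; split; [lra|].
    case: (IH hy1) => z [h1 [h1' h2]].
    have [[hx lt]|hx] := classic (interior a b x /\ W x < W z).
      exists x; split=> //; split; first lra.
      move=> y hy [<-|hin]; first lra.
      by have := h2 y hy hin; lra.
    exists z; split=> //; split=> // y hy [e|hin]; last exact: h2.
    by subst y; apply: Rnot_lt_le => lt; apply: hx.
  case: (hh L y0 hy0) => z [h1 [_ h2]]; exists z; split=> // y [cy ay yb].
  by apply: h2 => //; apply: hL => //; exact: vlt_le.
exists z; split=> //.
have [cz az zb] := hz.
case: (interior_unstable hg hz) => _ [lam [e [g [hp l0]]]].
split=> //; exists lam, e, g; split=> // v hv; apply: Rnot_lt_le => Qv.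
case: (hp) => _ ep _ ee _.
have Me : Mop (H z) e = fun i => lam * e i by apply: functional_extensionality.
have De : 0 < dot e e by apply: (@dot_gt0 _ _ i0); have := ep i0; lra.
pose m := Rmin (- (lam * dot e e)) (- dot v (Mop (H z) v)).
have m0 : 0 < m by apply: Rmin_glb_lt; nra.
have m1 : m <= - (lam * dot e e) by exact: Rmin_l.
have m2 : m <= - dot v (Mop (H z) v) by exact: Rmin_r.
case: (@W_below z m (nrm e + nrm v) cz m0) => d1 [d10 hd1].
case: (unstable_up i0 HS Phi0 PhiD HM cz hp l0 cb zb) => d2 [d20 hd2].
case: (unstable_down cz hp l0 ca az) => d3 [d30 hd3].
case: (vlt_room az) => k1 [k10 hk1]; case: (vlt_room zb) => k2 [k20 hk2].
pose B := nrm e + nrm v + 1.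
have B0 : 1 <= B by have := nrm_ge0 e; have := nrm_ge0 v; rewrite /B; lra.
(* Small enough for the path to lie below the level of [z] ([d1]), for its ends to flow to [b] and
   [a] ([d2], [d3]), and for it to remain between [a] and [b] ([k1], [k2]). *)
pose s := Rmin (Rmin d1 (Rmin d2 d3)) (Rmin (k1 / B) (k2 / B)) / 2.
have t0 : 0 < Rmin (Rmin d1 (Rmin d2 d3)) (Rmin (k1 / B) (k2 / B)).
  by do !apply: Rmin_glb_lt => //; apply: Rdiv_lt_0_compat; lra.
have s0 : 0 < s by rewrite /s; lra.
have st : s < Rmin (Rmin d1 (Rmin d2 d3)) (Rmin (k1 / B) (k2 / B)) by rewrite /s; lra.
have sd1 : s < d1 by apply: Rlt_le_trans st (Rle_trans _ _ _ (Rmin_l _ _) (Rmin_l _ _)).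
have sd2 : s < d2.
  by apply: Rlt_le_trans st (Rle_trans _ _ _ (Rmin_l _ _) (Rle_trans _ _ _ (Rmin_r _ _) (Rmin_l _ _))).
have sd3 : s < d3.
  by apply: Rlt_le_trans st (Rle_trans _ _ _ (Rmin_l _ _) (Rle_trans _ _ _ (Rmin_r _ _) (Rmin_r _ _))).
have sk1 : s * B <= k1.
  by apply: le_div_mul; [lra | apply: Rlt_le; apply: Rlt_le_trans st (Rle_trans _ _ _ (Rmin_r _ _) (Rmin_l _ _))].
have sk2 : s * B <= k2.
  by apply: le_div_mul; [lra | apply: Rlt_le; apply: Rlt_le_trans st (Rle_trans _ _ _ (Rmin_r _ _) (Rmin_r _ _))].
(* Half circle from [- e] to [e] through [v]. As [e] is an eigenvector orthogonal to [v], the cross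
   terms vanish and the form is a convex combination of its values at [e] and [v], hence at most
   [- m]. *)
pose u t j := - cos (PI * t) * e j + sin (PI * t) * v j.
have ub t j : Rabs (u t j) <= Rabs (e j) + Rabs (v j).
  have hc : Rabs (cos (PI * t)) <= 1 by apply: Rabs_le; exact: COS_bound.
  have hs : Rabs (sin (PI * t)) <= 1 by apply: Rabs_le; exact: SIN_bound.
  apply: Rle_trans (Rabs_triang _ _) _; rewrite !Rabs_mult Rabs_Ropp.
  have := Rabs_pos (e j); have := Rabs_pos (v j); nra.
have un t : nrm (u t) <= nrm e + nrm v.
  by rewrite /nrm -bsum_add; apply: bsum_le => j _; exact: ub.
have uQ t : dot (u t) (Mop (H z) (u t)) <= - m.
  have hMu : Mop (H z) (u t) = fun i => - cos (PI * t) * (lam * e i) + sin (PI * t) * Mop (H z) v i.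
    by apply: functional_extensionality => i; rewrite /u MopD !MopZ ee.
  have hev : dot e (Mop (H z) v) = 0.
    by rewrite (H_dot_sym HS z e v) Me dotZr hv; ring.
  rewrite hMu /u dotDl !dotDr !dotZl !dotZr hev hv.
  have := sin2_cos2 (PI * t); rewrite /Rsqr.
  set cc := cos _; set ss := sin _ => e1.
  have -> : - cc * (- cc * (lam * dot e e)) + - cc * (ss * 0) + (ss * (- cc * (lam * 0)) + ss * (ss * dot v (Mop (H z) v)))
    = cc * cc * (lam * dot e e) + ss * ss * dot v (Mop (H z) v) by ring.
  have := Rle_0_sqr cc; have := Rle_0_sqr ss; rewrite /Rsqr; nra.
case: (@gap_connect a b (fun t j => z j + s * u t j) hg) => [i|t ht|eps he|eps he|t [y [_ [cy [ay [yb hW]]]]]].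
- apply: continuity_plus; first by apply: continuity_const => ? ?.
  apply: continuity_scal; rewrite /u.
  have cP : continuity (fun t => PI * t).
    by apply: continuity_scal; apply: derivable_continuous; exact: derivable_id.
  apply: continuity_plus; apply: continuity_mult.
  + apply: continuity_opp; apply: (continuity_comp (fun t => PI * t) cos) => //; exact: continuity_cos.
  + by apply: continuity_const => ? ?.
  + apply: (continuity_comp (fun t => PI * t) sin) => //; exact: continuity_sin.
  + by apply: continuity_const => ? ?.
- have hb i : Rabs (s * u t i) <= s * B.
    rewrite Rabs_mult Rabs_pos_eq; last lra.
    apply: Rmult_le_compat_l; first lra.
    by have := ub t i; have := nrm_coord e i; have := nrm_coord v i; rewrite /B; lra.
  by split=> i; have := hb i; have := hk1 i; have := hk2 i => ? ? /Rabs_bnd; lra.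
- have e1 : (fun j => z j + s * u 0 j) = (fun j => z j + - s * e j).
    by apply: functional_extensionality => j; rewrite /u Rmult_0_r cos_0 sin_0; ring.
  case: (hd3 s (conj s0 sd3)) => y' [h1 [h2 [h3 [h4 h5]]]].
  have ya : y' = a.
    case: (gp y' h1 h4 (vlt_le (vlt_le_trans h2 (vlt_le zb)))) => // e2.
    by subst y'; have := h2 i0; have := zb i0; lra.
  rewrite e1; case: (h5 eps he) => T hT; exists (Rmax T 0 + 1); split; first by have := Rmax_r T 0; lra.
  move=> i; have := hT (Rmax T 0 + 1) ltac:(have := Rmax_l T 0; lra) i.
  by rewrite ya => /Rabs_def2; lra.
- have e1 : (fun j => z j + s * u 1 j) = (fun j => z j + s * e j).
    by apply: functional_extensionality => j; rewrite /u Rmult_1_r cos_PI sin_PI; ring.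
  case: (hd2 s (conj s0 sd2)) => _ [y' [h1 [h2 [h3 [h4 h5]]]]].
  have yb : y' = b.
    case: (gp y' h1 (vlt_le (vlt_le_trans az (vlt_le h2))) h4) => // e2.
    by subst y'; have := h2 i0; have := az i0; lra.
  rewrite e1; case: (h5 eps he) => T hT; exists (Rmax T 0 + 1); split; first by have := Rmax_r T 0; lra.
  move=> i; have := hT (Rmax T 0 + 1) ltac:(have := Rmax_l T 0; lra) i.
  by rewrite yb => /Rabs_def2; lra.
have h1 := hd1 (u t) s (conj s0 sd1) (un t) (uQ t).
have hy : interior a b y by [].
have := zmin y hy; lra.
Qed.

(** For [y] strictly above [z], climbing from [z] below [y] reaches a stable point of the gap; it
    lies above [z], so it is [b], and [y] is squeezed against it. *)
Lemma gap_above a b z y : gap a b -> interior a b z -> crit y -> vle z y -> vle y b -> y = z \/ y = b.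
Proof.
move=> hg hz cy zy yb; have [_ [cb _] ab gp] := hg; have [cz az zb] := hz.
have [->|ne] := classic (y = z); first by left.
right.
have lt : vlt z y by apply: (crit_lt HS Phi0 PhiD) => // e; apply: ne.
case: (interior_unstable hg hz) => _ [lam [e [g [hp l0]]]].
case: (unstable_up i0 HS Phi0 PhiD HM cz hp l0 cy lt) => d [d0 hd].
case: (hd (d / 2)) => [|_ [y' [h1 [h2 [_ [h4 _]]]]]]; first lra.
case: (gp y' h1 (vlt_le (vlt_le_trans az (vlt_le h2))) (vle_trans h4 yb)) => e2.
  by subst y'; have := h2 i0; have := az i0; lra.
by subst y'; exact: vle_anti.
Qed.

Lemma gap_below a b z y : gap a b -> interior a b z -> crit y -> vle a y -> vle y z -> y = z \/ y = a.
Proof.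
move=> hg hz cy ay yz; have [[ca _] _ ab gp] := hg; have [cz az zb] := hz.
have [->|ne] := classic (y = z); first by left.
right.
have lt : vlt y z by apply: (crit_lt HS Phi0 PhiD).
case: (interior_unstable hg hz) => _ [lam [e [g [hp l0]]]].
case: (unstable_down cz hp l0 cy lt) => d [d0 hd].
case: (hd (d / 2)) => [|y' [h1 [h2 [_ [h4 _]]]]]; first lra.
case: (gp y' h1 (vle_trans ay h4) (vlt_le (vlt_le_trans h2 (vlt_le zb)))) => e2.
  by subst y'; exact: vle_anti.
by subst y'; have := h2 i0; have := zb i0; lra.
Qed.
End Gap.

(** * Heteroclinic orbits and their tangents *)

Section Het.
Variables (I : finType) (i0 : I) (W : (I -> R) -> R) (f : (I -> R) -> I -> R).
Variables (H : (I -> R) -> I -> I -> R) (C : R).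
Hypothesis HS : gsys W f H C.
Local Notation V := (I -> R).
Implicit Types x y z v w : V.
Local Notation N := (INR #|I|).
Variable Phi : R -> V -> V.
Hypothesis Phi0 : forall x, Phi 0 x = x.
Hypothesis PhiD : forall x t i, derivable_pt_lim (fun t => Phi t x i) t (f (Phi t x) i).
Hypothesis HM : nondeg f H.
Local Notation crit := (crit f).

Lemma sub_limit_m x a : (forall t i, 0 <= f (Phi t x) i) -> (forall t, vle a (Phi t x)) ->
  exists y, crit y /\ vle a y /\ (forall t, vle y (Phi t x)) /\ tlim_m (fun t => Phi t x) y.
Proof.
move=> hx ax.
have mono s t : s <= t -> vle (Phi s x) (Phi t x).
  move=> st; have -> : t = (t - s) + s by ring.
  by rewrite (Phi_add HS Phi0 PhiD); apply: (sub_le HS Phi0 PhiD) => //; lra.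
have bB n i : Rabs (Phi (- INR n) x i) <= nrm x + nrm a.
  have := ax (- INR n) i; have := mono (- INR n) 0 ltac:(have := pos_INR n; lra) i; rewrite Phi0.
  have := nrm_coord x i; have := nrm_coord a i => /Rabs_bnd ? /Rabs_bnd ?.
  by have := nrm_ge0 x; have := nrm_ge0 a => ? ? ? ?; apply: Rabs_le; lra.
case: (bolzano (u := fun n => Phi (- INR n) x) bB) => phi [y [hp hl]].
have big t : exists n : nat, forall m, (n <= m)%nat -> - INR (phi m) < t.
  case: (INR_unbounded (- t)) => n hn; exists n => m hm.
  have : INR n <= INR (phi m) by apply: le_INR; apply/leP; apply: leq_trans hm _; exact: strict_mono_ge.
  lra.
have below t : vle y (Phi t x).
  move=> i; apply: seq_lim_le (hl i) _.
  case: (big t) => n hn; exists n => m hm /=; apply: mono; exact: Rlt_le (hn m hm).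
have lim : tlim_m (fun t => Phi t x) y.
  move=> e he; case: (vlim_unif hl he) => M hM; exists (- INR (phi M)) => t ht i.
  have := hM M i (leqnn M) => /= h1.
  have h2 := below t i.
  have h3 := mono t (- INR (phi M)) ltac:(lra) i.
  rewrite Rabs_pos_eq; last lra.
  by move/Rabs_def2: h1; lra.
have hfix : Phi 1 y = y.
  apply: functional_extensionality => i.
  apply: (seq_lim_unique (Phi_vlim HS Phi0 PhiD 1 hl i)).
  move=> e he; case: (lim e he) => T hT.
  case: (big (T - 1)) => n hn; exists n => m hm /=.
  by rewrite -(Phi_add HS Phi0 PhiD); apply: hT; have := hn m hm; lra.
exists y; split; first by apply: (W_stat HS Phi0 PhiD); rewrite hfix; lra.
split; last by [].
by move=> i; apply: seq_lim_ge (hl i) _; exists 0%nat => n _; apply: ax.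
Qed.

Lemma tlim_sg (x : R -> V) l : tlim_p x l -> forall e, 0 < e -> exists T, forall t, T < t -> Rabs (sg (x t) - sg l) < e.
Proof.
move=> h e he; have N0 := pos_INR #|I|.
case: (h (e / (N + 1))) => [|T hT]; first by apply: Rdiv_lt_0_compat; lra.
exists T => t ht; rewrite -sgB; apply: Rle_lt_trans (sg_abs _) _.
apply: (@Rle_lt_trans _ (N * (e / (N + 1)))).
  by apply: nrm_bound => i; apply: Rlt_le; exact: hT.
apply: (Rmult_lt_reg_r (N + 1)); first lra.
rewrite (_ : N * (e / (N + 1)) * (N + 1) = N * e); [nra | by field; lra].
Qed.

Lemma sg_Phi_deriv x t : derivable_pt_lim (fun t => sg (Phi t x)) t (sg (f (Phi t x))).
Proof. by apply: derivable_pt_lim_sum => i _; exact: PhiD. Qed.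

(* The orbits leaving [z] along the positive eigenvector are stopped at a fixed
   level of [sg]; a limit of the stopping points lies on the heteroclinic orbit. *)
Lemma het_up z b : unstable f H z -> crit b -> vlt z b ->
  (forall y, crit y -> vle z y -> vle y b -> y = z \/ y = b) ->
  exists x, [/\ (forall t, vlt z (Phi t x) /\ vlt (Phi t x) b),
    (forall t i, 0 <= f (Phi t x) i), ~ crit x & tlim_m (fun t => Phi t x) z /\ tlim_p (fun t => Phi t x) b].
Proof.
move=> [cz [lam [e [g [hp l0]]]]] cb zb hno.
have sgzb : sg z < sg b.
  apply: vle_sg_lt; first exact: vlt_le.
  by move=> eq; subst b; have := zb i0; lra.
pose s := (sg z + sg b) / 2.
case: (unstable_up i0 HS Phi0 PhiD HM cz hp l0 cb zb) => d [d0 hd].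
case: (hp) => _ ep se ee _.
pose d' := Rmin d (s - sg z).
have d'0 : 0 < d' by apply: Rmin_glb_lt => //; rewrite /s; lra.
(* The shift by two keeps [eps n] strictly below [d'] also for [n = 0]. As [sg e = 1], the sum of
   [zn n] is [sg z + eps n], below the level [s]. *)
pose eps (n : nat) := d' / INR n.+2.
have epsb n : 0 < eps n < d'.
  have h2 : 1 < INR n.+2 by apply: lt_1_INR; apply/ltP.
  split; first by apply: Rdiv_lt_0_compat; lra.
  apply: (Rmult_lt_reg_r (INR n.+2)); first lra.
  rewrite (_ : eps n * INR n.+2 = d'); [nra | by rewrite /eps; field; lra].
pose zn n j := z j + eps n * e j.
have sgzn n : sg (zn n) = sg z + eps n by rewrite /zn sgD sgZ se; ring.
have hzn n : (forall i, 0 < f (zn n) i) /\ tlim_p (fun t => Phi t (zn n)) b /\ vle z (zn n) /\ vle (zn n) b.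
  have [e1 e2] := epsb n.
  case: (hd (eps n)) => [|h1 [y' [[cy' _] [h3 [h4 [h5 h6]]]]]].
    by split=> //; apply: Rlt_le_trans e2 (Rmin_l _ _).
  have yb : y' = b by case: (hno y' cy' (vlt_le h3) h5) => // eq; subst y'; have := h3 i0; lra.
  subst y'; split=> //; split=> //; split=> // i; rewrite /zn; have := ep i; nra.
have mono n r t : 0 <= r <= t -> vle (Phi r (zn n)) (Phi t (zn n)).
  by apply: (sub_mono HS Phi0 PhiD) => i; case: (hzn n) => /(_ i); lra.
have boxn n t : 0 <= t -> vle z (Phi t (zn n)) /\ vle (Phi t (zn n)) b /\ forall i, 0 <= f (Phi t (zn n)) i.
  move=> t0; case: (hzn n) => h1 [_ [h2 h3]]; split.
    by rewrite -(crit_fixed HS Phi0 PhiD t cz); exact: (Phi_le HS Phi0 PhiD).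
  split; first by rewrite -(crit_fixed HS Phi0 PhiD t cb); exact: (Phi_le HS Phi0 PhiD).
  by apply: (sub_f_ge0 HS Phi0 PhiD) => // i; exact: Rlt_le.
have hit n : exists t, 0 <= t /\ sg (Phi t (zn n)) = s.
  case: (hzn n) => _ [h1 _].
  case: (tlim_sg h1 (e := sg b - s)) => [|T hT]; first by rewrite /s; lra.
  pose T1 := Rmax T 0 + 1.
  have T10 : 0 < T1 by have := Rmax_r T 0; rewrite /T1; lra.
  have hT1 : s < sg (Phi T1 (zn n)).
    by have := hT T1 ltac:(have := Rmax_l T 0; rewrite /T1; lra) => /Rabs_def2; lra.
  case: (@IVT_cor (fun t => sg (Phi t (zn n)) - s) 0 T1) => [|||t [ht1 ht2]].
  - move=> t; apply: derivable_pt_lim_cont; apply: derivable_pt_lim_minus; first exact: sg_Phi_deriv.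
    exact: derivable_pt_lim_const.
  - lra.
  - rewrite Phi0 sgzn; have [_ e2] := epsb n.
    have : eps n < s - sg z by apply: Rlt_le_trans e2 (Rmin_r _ _).
    nra.
  by exists t; split; lra.
pose tn n := proj1_sig (constructive_indefinite_description _ (hit n)).
have tnP n : 0 <= tn n /\ sg (Phi (tn n) (zn n)) = s.
  by rewrite /tn; case: constructive_indefinite_description.
pose xn n := Phi (tn n) (zn n).
have bB n i : Rabs (xn n i) <= nrm z + nrm b.
  case: (boxn n (tn n)) => [|/(_ i) h1 [/(_ i) h2 _]]; first by case: (tnP n).
  have := nrm_coord z i; have := nrm_coord b i => /Rabs_bnd ? /Rabs_bnd ?.
  by have := nrm_ge0 z; have := nrm_ge0 b => ? ?; apply: Rabs_le; rewrite /xn; lra.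
case: (bolzano bB) => phi [x [hphi hl]].
have zlim : vlim zn z.
  move=> i r hr; case: (archimed_cor1 (r / d')) => [|M [h1 h2]]; first exact: Rdiv_lt_0_compat.
  exists M => n hn; rewrite /zn (_ : z i + eps n * e i - z i = eps n * e i); last ring.
  have [e1 _] := epsb n; have e2 := ep i; have e3 := perron_e_le1 i hp.
  rewrite Rabs_pos_eq; last nra.
  have hM : 0 < INR M by exact: lt_0_INR.
  have h3 : eps n <= d' * / INR M.
    apply: Rmult_le_compat_l; first lra.
    apply: Rinv_le_contravar => //; apply: le_INR; apply/leP; apply: leq_trans hn _; exact: (leqW (leqnSn _)).
  have h4 : d' * / INR M < r.
    have := Rmult_lt_compat_l d' _ _ d'0 h1; by rewrite (_ : d' * (r / d') = r); last by field; lra.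
  nra.
(* At a fixed time the orbits of [zn n] tend to the constant orbit [z], whose sum is below [s], so
   the hitting times diverge. The limit point therefore inherits its bounds and the sign of its
   velocity for all negative times. *)
have late T : exists M : nat, forall n, (M <= n)%nat -> T < tn n.
  have [T0|T0] := Rlt_le_dec T 0; first by exists 0%nat => n _; case: (tnP n); lra.
  have h1 := seq_lim_sg (Phi_vlim HS Phi0 PhiD T zlim).
  rewrite (crit_fixed HS Phi0 PhiD T cz) in h1.
  case: (h1 (s - sg z)) => [|M hM]; first by rewrite /s; lra.
  exists M => n hn; apply: Rnot_le_lt => le; have := hM n hn.
  case: (tnP n) => t1 t2; have := sg_le (mono n (tn n) T (conj t1 le)).
  by rewrite t2 => ? /Rabs_def2; lra.
have inbox t : vle z (Phi t x) /\ vle (Phi t x) b /\ forall i, 0 <= f (Phi t x) i.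
  have hl2 := Phi_vlim HS Phi0 PhiD t hl.
  have hl3 := f_vlim HS hl2.
  case: (late (- t)) => M hM.
  have hb n : (M <= n)%nat -> vle z (Phi t (xn (phi n))) /\ vle (Phi t (xn (phi n))) b /\ forall i, 0 <= f (Phi t (xn (phi n))) i.
    move=> hn; rewrite /xn -(Phi_add HS Phi0 PhiD); apply: boxn.
    by have := hM (phi n) (leq_trans hn (strict_mono_ge hphi n)); lra.
  split; first by move=> i; apply: seq_lim_ge (hl2 i) _; exists M => n /hb [h _]; exact: h.
  split; first by move=> i; apply: seq_lim_le (hl2 i) _; exists M => n /hb [_ [h _]]; exact: h.
  by move=> i; apply: seq_lim_ge (hl3 i) _; exists M => n /hb [_ [_ h]]; exact: h.
have sgx : sg x = s.
  apply: seq_lim_unique (seq_lim_sg hl) _ => r hr; exists 0%nat => n _ /=.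
  by case: (tnP (phi n)) => _; rewrite -/(xn _) => ->; rewrite Rminus_diag Rabs_R0.
have box0 := inbox 0; rewrite Phi0 in box0; case: box0 => zx [xb fx].
have ncx : ~ crit x.
  by move=> cx; case: (hno x cx zx xb) => eq; subst x; rewrite sgx /s in sgzb *; move: sgx; rewrite /s; lra.
have fpos t i : 0 <= f (Phi t x) i by case: (inbox t) => _ [_]; apply.
have strict r t : r < t -> vlt (Phi r x) (Phi t x).
  move=> rt; have -> : t = (t - r) + r by ring.
  rewrite (Phi_add HS Phi0 PhiD) -{1}(Phi0 (Phi r x)).
  apply: (sub_lt HS Phi0 PhiD) => //; [exact: (noncrit_Phi HS Phi0 PhiD) | lra].
exists x; split=> //.
- move=> t; split.
    apply: (@vle_lt_trans _ (Phi (t - 1) x)); first by case: (inbox (t - 1)).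
    by apply: strict; lra.
  apply: (@vlt_le_trans _ (Phi (t + 1) x)); last by case: (inbox (t + 1)) => _ [].
  by apply: strict; lra.
split.
- case: (@sub_limit_m x z) => // [t|y [cy [h1 [h2 h3]]]]; first by case: (inbox t).
  have yx := h2 0; rewrite Phi0 in yx.
  case: (hno y cy h1 (vle_trans yx xb)) => eq; subst y => //.
  by have := sg_le yx; rewrite sgx /s; lra.
- case: (sub_limit HS Phi0 PhiD fx cb xb) => y [cy [h1 [h2 [h3 _]]]].
  case: (hno y cy (vle_trans zx h1) h2) => eq; subst y => //.
  by have := sg_le h1; rewrite sgx /s; lra.
Qed.
End Het.

(* The squared distance of the direction of [y] to the Perron direction, measured by
   [theta], contracts under [y' = - M y + o(y)] as long as [y] stays nonnegative. *)
Section Tang.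
Variables (I : finType) (i0 : I) (M : I -> I -> R).
Local Notation V := (I -> R).
Local Notation N := (INR #|I|).
Hypothesis Msym : forall v w : V, dot v (Mop M w) = dot w (Mop M v).
Variables (lam : R) (e : V) (g : R).
Hypothesis hp : perron_data M lam e g.

(** The squared tangent of the angle between [y] and [e], divided by [dot e e]. It is invariant
    under scaling, so the exponential growth or decay of [y] does not enter. *)
Definition theta (y : V) := dot y y / (dot y e * dot y e) - / dot e e.

Lemma dot_ee : 0 < dot e e.
Proof. by case: hp => _ ep _ _ _; apply: (@dot_gt0 _ _ i0); have := ep i0; lra. Qed.

Lemma dot_ye (y : V) : (forall i, 0 <= y i) -> 0 < sg y -> 0 < dot y e.
Proof.
case: hp => _ ep _ _ _ y0 sy.
case: (vpos_min ep) => m [m0 hm].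
apply: (@Rlt_le_trans _ (m * sg y)); first nra.
by rewrite /sg -bsum_scal; apply: bsum_le => i _; have := y0 i; have := hm i; nra.
Qed.

Lemma dot_ye_le (y : V) : (forall i, 0 <= y i) -> dot y e <= sg y.
Proof.
by move=> y0; apply: bsum_le => i _; have := y0 i; have := perron_e_le1 i hp; nra.
Qed.

Definition wpart (y : V) : V := fun i => y i + - (dot y e / dot e e) * e i.

Lemma wpart_orth y : dot (wpart y) e = 0.
Proof. by have := dot_ee; rewrite /wpart dotDl dotZl => h; field; lra. Qed.

Lemma wpart_sq y : dot y e <> 0 -> dot (wpart y) (wpart y) = dot y e * dot y e * theta y.
Proof.
move=> h; have hE := dot_ee.
rewrite {2}/wpart dotDr dotZr wpart_orth Rmult_0_r Rplus_0_r /wpart dotDl dotZl (dotC e y) /theta.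
by field; lra.
Qed.

Lemma theta_ge0 y : dot y e <> 0 -> 0 <= theta y.
Proof.
move=> h; have := dot_ge0 (wpart y); rewrite wpart_sq // => h2.
have : 0 < dot y e * dot y e by nra.
nra.
Qed.

(** The deviation depends only on the part of [y] orthogonal to [e]; the factor [2 * (1 + N)] comes
    from [(u - v)^2 <= 2 u^2 + 2 v^2] and Cauchy-Schwarz for the sum of that part. *)
Lemma theta_dir (y : V) i : (forall i, 0 <= y i) -> 0 < sg y ->
  (y i - sg y * e i) * (y i - sg y * e i) <= 2 * (1 + N) * theta y * (sg y * sg y).
Proof.
move=> y0 sy; have a0 := dot_ye y0 sy; have al := dot_ye_le y0.
have th := @theta_ge0 y ltac:(lra).
have hw := @wpart_sq y ltac:(lra).
case: (hp) => _ ep se _ _.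
have e1 : y i - sg y * e i = wpart y i - sg (wpart y) * e i.
  by rewrite /wpart sgD sgZ se; ring.
have h1 : wpart y i * wpart y i <= dot (wpart y) (wpart y).
  by apply: (@rsum_term _ (fun i => wpart y i * wpart y i)) => j; exact: Rle_0_sqr.
have h2 : sg (wpart y) * sg (wpart y) <= N * dot (wpart y) (wpart y).
  have := nrm_nrm (wpart y); have := sg_abs (wpart y).
  have : sg (wpart y) * sg (wpart y) = Rabs (sg (wpart y)) * Rabs (sg (wpart y)).
    by rewrite -Rabs_mult Rabs_pos_eq //; exact: Rle_0_sqr.
  by have := Rabs_pos (sg (wpart y)); nra.
have h3 : dot (wpart y) (wpart y) <= theta y * (sg y * sg y).
  by rewrite hw (Rmult_comm _ (theta y)); apply: Rmult_le_compat_l => //; nra.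
rewrite e1; have N0 := pos_INR #|I|.
have ei := ep i; have ei1 := perron_e_le1 i hp.
set w := wpart y i in h1 *; set sw := sg _ in h2 *.
have h4 : (w - sw * e i) * (w - sw * e i) <= 2 * (w * w) + 2 * (sw * sw).
  have : 0 <= (w + sw * e i) * (w + sw * e i) by exact: Rle_0_sqr.
  have : (sw * e i) * (sw * e i) <= sw * sw.
    have -> : (sw * e i) * (sw * e i) = (sw * sw) * (e i * e i) by ring.
    have : e i * e i <= 1 by nra.
    by have := Rle_0_sqr sw; rewrite /Rsqr; nra.
  nra.
have : N * dot (wpart y) (wpart y) <= N * (theta y * (sg y * sg y)) by apply: Rmult_le_compat_l.
nra.
Qed.

Lemma theta_deriv (y y' : R -> V) t : (forall i, derivable_pt_lim (fun t => y t i) t (y' t i)) ->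
  dot (y t) e <> 0 ->
  derivable_pt_lim (fun t => theta (y t)) t
   (2 * (dot (y t) (y' t) * dot (y t) e - dot (y t) (y t) * dot (y' t) e) / (dot (y t) e * dot (y t) e * dot (y t) e)).
Proof.
move=> hd h0.
have h1 : derivable_pt_lim (fun t => dot (y t) (y t)) t (2 * dot (y t) (y' t)).
  rewrite /dot -bsum_scal; apply: derivable_pt_lim_sum => i _.
  apply: derivable_pt_lim_eql; last exact: (derivable_pt_lim_mult _ _ _ _ _ (hd i) (hd i)).
  by rewrite /=; ring.
have h2 : derivable_pt_lim (fun t => dot (y t) e) t (dot (y' t) e).
  by apply: derivable_pt_lim_sum => i _; apply: derivable_pt_lim_scal_right.
have h3 := derivable_pt_lim_mult _ _ _ _ _ h2 h2.
have h4 : (fun t => dot (y t) e * dot (y t) e) t <> 0 by rewrite /=; nra.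
have h5 := derivable_pt_lim_div _ _ _ _ _ h1 h3 h4.
have h6 := derivable_pt_lim_minus _ _ _ _ _ h5 (derivable_pt_lim_const (/ dot e e) t).
apply: derivable_pt_lim_eql h6; rewrite /mult_fct /Rsqr; field; lra.
Qed.

(** In the derivative of the quotient the terms with [lam] cancel and the gap remains:
    [theta' <= - 2 * g * theta + eta * K1]. Gronwall then gives a forced part of order [eta] and a
    decaying part; on nonnegative vectors [theta] is bounded, so [K] is independent of the start. *)
Lemma tang_bound : exists K, 0 < K /\ forall (y y' : R -> V) eta s t, 0 < eta -> s <= t ->
  (forall r, s <= r <= t -> [/\ (forall i, derivable_pt_lim (fun t => y t i) r (y' r i)),
     (forall i, 0 <= y r i), 0 < sg (y r) & forall i, Rabs (y' r i + Mop M (y r) i) <= eta * sg (y r)]) ->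
  theta (y t) <= eta * K + K * exp (- (2 * g * (t - s))).
Proof.
case: (hp) => g0 ep se ee [_ hgap].
case: (vpos_min ep) => m [m0 hm].
have N0 := pos_INR #|I|.
pose k := / m.
have k0 : 0 < k by exact: Rinv_0_lt_compat.
have key (y : V) : (forall i, 0 <= y i) -> 0 < sg y -> sg y <= k * dot y e.
  move=> y0 sy; apply: (Rmult_le_reg_l m) => //.
  rewrite -Rmult_assoc /k Rinv_r; last lra.
  rewrite Rmult_1_l /sg -bsum_scal; apply: bsum_le => i _.
  by have := y0 i; have := hm i; nra.
(* The two terms bound the effect of the remainder on [dot y y] and on [dot y e]; the powers of [k]
   come from [sg y <= k * dot y e]. *)
pose K1 := 2 * N * k * k + 2 * k * k * k * N.
have K10 : 0 <= K1.
  have a1 : 0 <= N * (k * k) by apply: Rmult_le_pos; nra.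
  have a2 : 0 <= k * (N * (k * k)) by apply: Rmult_le_pos; lra.
  by rewrite /K1; lra.
exists (K1 / (2 * g) + k * k + 1); split.
  have : 0 <= K1 / (2 * g) by apply: Rle_mult_inv_pos; lra.
  nra.
move=> y y' eta s t eta0 st hy.
(* Subtracting the equilibrium of the forced linear inequality makes it homogeneous. *)
pose u r := theta (y r) - eta * K1 / (2 * g).
pose u' r := 2 * (dot (y r) (y' r) * dot (y r) e - dot (y r) (y r) * dot (y' r) e) / (dot (y r) e * dot (y r) e * dot (y r) e) - 0.
have hu : u t <= u s * exp (- (2 * g) * (t - s)).
  apply: (@gronwall u u') => // r hr; case: (hy r hr) => h1 h2 h3 h4; have a0 := dot_ye h2 h3.
    apply: derivable_pt_lim_minus; last exact: derivable_pt_lim_const.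
    by apply: theta_deriv => //; lra.
  pose Rr i := y' r i + Mop M (y r) i.
  have hyR : dot (y r) (y' r) = dot (y r) Rr - dot (y r) (Mop M (y r)).
    by rewrite -dotBr; apply: eq_bigr => i _; rewrite /Rr; ring.
  have Me : Mop M e = fun i => lam * e i by apply: functional_extensionality.
  have heR : dot (y' r) e = dot Rr e - lam * dot (y r) e.
    have -> : lam * dot (y r) e = dot (Mop M (y r)) e by rewrite (dotC (Mop M (y r))) Msym Me dotZr.
    by rewrite -dotBl; apply: eq_bigr => i _; rewrite /Rr; ring.
  have hw := @wpart_sq (y r) ltac:(lra); have ho := wpart_orth (y r).
  have hQ : dot (y r) (Mop M (y r)) = Q M (wpart (y r)) + lam * (dot (y r) e * dot (y r) e) / dot e e.
    have -> : dot (y r) (Mop M (y r)) = Q M (fun i => wpart (y r) i + (dot (y r) e / dot e e) * e i).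
      rewrite /Q; have <- : y r = fun i => wpart (y r) i + (dot (y r) e / dot e e) * e i; last by [].
      by apply: functional_extensionality => i; rewrite /wpart; ring.
    rewrite (QD Msym) QZ dotZl (Msym e) /Q Me !dotZr ho.
    by field; have := dot_ee; lra.
  have hg := hgap _ ho; rewrite hw in hg.
  have hyy : dot (y r) (y r) = dot (y r) e * dot (y r) e * (theta (y r) + / dot e e).
    by rewrite /theta; field; have := dot_ee; lra.
  have kk := key _ h2 h3.
  have nR : nrm Rr <= N * (eta * sg (y r)) by exact: nrm_bound.
  have n1 : Rabs (dot (y r) Rr) <= sg (y r) * (N * (eta * sg (y r))).
    apply: Rle_trans (dot_abs _ _) _; rewrite (nrm_nonneg h2).
    by apply: Rmult_le_compat_l; lra.
  have n2 : Rabs (dot Rr e) <= N * (eta * sg (y r)).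
    apply: Rle_trans (dot_abs _ _) _.
    by rewrite (nrm_nonneg (x := e)) ?se ?Rmult_1_r // => i; exact: Rlt_le.
  have n3 : dot (y r) (y r) <= sg (y r) * sg (y r).
    by apply: Rle_trans (dot_le_nrm2 _) _; rewrite (nrm_nonneg h2); lra.
  have n4 := dot_ge0 (y r).
  move: hQ hg; rewrite /u' /u; set a := dot (y r) e in a0 heR hyy kk *.
  set S := sg (y r) in h3 kk nR n1 n2 n3 *.
  set Qw := Q M _; set q := dot (y r) (Mop M (y r)) in hyR *.
  set th := theta (y r) in hyy *; set A := dot (y r) Rr in hyR n1 *; set B := dot Rr e in heR n2 *.
  set E := dot e e in hyy *; have E0 : 0 < E by exact: dot_ee.
  move=> hQ hg.
  have -> : 2 * (dot (y r) (y' r) * a - dot (y r) (y r) * dot (y' r) e) / (a * a * a) - 0 =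
     (2 * A - 2 * q) / (a * a) - 2 * (th + / E) * (B - lam * a) / a.
    by rewrite hyR heR hyy; field; lra.
  have hq : (2 * A - 2 * q) / (a * a) <= 2 * A / (a * a) - 2 * lam / E - 2 * (lam + g) * th.
    rewrite hQ.
    have : - 2 * Qw / (a * a) <= - 2 * (lam + g) * th.
      apply: (Rmult_le_reg_r (a * a)); first nra.
      rewrite (_ : - 2 * Qw / (a * a) * (a * a) = - 2 * Qw); [nra | field; lra].
    have -> : (2 * A - 2 * (Qw + lam * (a * a) / E)) / (a * a) = 2 * A / (a * a) + - 2 * Qw / (a * a) - 2 * lam / E.
      by field; lra.
    lra.
  have hA : 2 * A / (a * a) <= 2 * N * k * k * eta.
    apply: (Rmult_le_reg_r (a * a)); first nra.
    rewrite (_ : 2 * A / (a * a) * (a * a) = 2 * A); last by field; lra.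
    have SS : S * S <= (k * a) * (k * a) by apply: Rmult_le_compat; lra.
    have Ne : 0 <= N * eta by apply: Rmult_le_pos; lra.
    have := Rmult_le_compat_l _ _ _ Ne SS.
    move/Rabs_bnd: n1; nra.
  have hB : - (2 * (th + / E) * B / a) <= 2 * k * k * k * N * eta.
    apply: (Rmult_le_reg_r (a * a * a)); first by apply: Rmult_lt_0_compat; nra.
    rewrite (_ : - (2 * (th + / E) * B / a) * (a * a * a) = - (2 * dot (y r) (y r) * B)); last by rewrite hyy; field; lra.
    have b1 : - B <= N * (eta * S) by move/Rabs_bnd: n2; lra.
    have b2 : dot (y r) (y r) * - B <= dot (y r) (y r) * (N * (eta * S)) by apply: Rmult_le_compat_l.
    have NS : 0 <= N * (eta * S) by apply: Rmult_le_pos => //; nra.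
    have b3 : dot (y r) (y r) * (N * (eta * S)) <= (S * S) * (N * (eta * S)) by apply: Rmult_le_compat_r.
    have b4 : S * S <= (k * a) * (k * a) by apply: Rmult_le_compat; lra.
    have b5 : (S * S) * S <= ((k * a) * (k * a)) * (k * a) by apply: Rmult_le_compat; nra.
    have Ne : 0 <= N * eta by apply: Rmult_le_pos; lra.
    have := Rmult_le_compat_l _ _ _ Ne b5; nra.
  have -> : 2 * (th + / E) * (B - lam * a) / a = 2 * (th + / E) * B / a - 2 * lam * th - 2 * lam / E.
    by field; lra.
  rewrite (_ : - (2 * g) * (th - eta * K1 / (2 * g)) = - 2 * g * th + eta * K1); last by field; lra.
  rewrite /K1; lra.
case: (hy s (conj (Rle_refl s) st)) => _ h2 h3 _.
have a0 := dot_ye h2 h3.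
have ths : theta (y s) <= k * k.
  have kk := key _ h2 h3.
  have n3 : dot (y s) (y s) <= sg (y s) * sg (y s).
    by apply: Rle_trans (dot_le_nrm2 _) _; rewrite (nrm_nonneg h2); lra.
  have b4 : sg (y s) * sg (y s) <= (k * dot (y s) e) * (k * dot (y s) e) by apply: Rmult_le_compat; lra.
  rewrite /theta; have := Rinv_0_lt_compat _ dot_ee.
  have : dot (y s) (y s) / (dot (y s) e * dot (y s) e) <= k * k; last lra.
  apply: (Rmult_le_reg_r (dot (y s) e * dot (y s) e)); first nra.
  by rewrite (_ : _ / _ * _ = dot (y s) (y s)); [nra | field; lra].
have hX := exp_pos (- (2 * g) * (t - s)).
have -> : - (2 * g * (t - s)) = - (2 * g) * (t - s) by ring.
have q0 : 0 <= K1 / (2 * g) by apply: Rle_mult_inv_pos; lra.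
have e1 : eta * K1 / (2 * g) = eta * (K1 / (2 * g)) by field; lra.
move: hu; rewrite /u e1.
set X := exp _ in hX *; set q := K1 / (2 * g) in q0 *.
have : 0 <= eta * q by apply: Rmult_le_pos; lra.
have : theta (y s) * X <= k * k * X by apply: Rmult_le_compat_r; lra.
nra.
Qed.

Lemma exp_small c eps : 0 < c -> 0 < eps -> exists X, 0 < X /\ forall r, X <= r -> exp (- (c * r)) <= eps.
Proof.
move=> c0 e0.
have hX : 0 < / (c * eps) by apply: Rinv_0_lt_compat; exact: Rmult_lt_0_compat.
exists (/ (c * eps)); split=> // r hr.
have cr : / eps <= c * r.
  have := Rmult_le_compat_l c _ _ (Rlt_le _ _ c0) hr.
  by rewrite (_ : c * / (c * eps) = / eps); last by field; lra.
have p : 0 < / eps by exact: Rinv_0_lt_compat.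
have h1 := exp_ineq1_le (c * r).
rewrite exp_Ropp -(Rinv_inv eps); apply: Rinv_le_contravar => //; lra.
Qed.

Definition tang_sol (y y' : R -> V) := forall t,
  [/\ (forall i, derivable_pt_lim (fun t => y t i) t (y' t i)), (forall i, 0 <= y t i) & 0 < sg (y t)].

Lemma theta_to_dir (y : V) eps : 0 < eps -> (forall i, 0 <= y i) -> 0 < sg y ->
  theta y <= eps * eps / (2 * (1 + N)) -> forall i, Rabs (y i - sg y * e i) <= eps * sg y.
Proof.
move=> e0 y0 sy ht i; have N0 := pos_INR #|I|.
have := theta_dir i y0 sy.
have h1 : theta y * (2 * (1 + N)) <= eps * eps by apply: le_div_mul; lra.
have h2 : 2 * (1 + N) * theta y * (sg y * sg y) <= (eps * sg y) * (eps * sg y).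
  rewrite (_ : (eps * sg y) * (eps * sg y) = eps * eps * (sg y * sg y)); last ring.
  by apply: Rmult_le_compat_r; [nra | lra].
move=> h3; have h4 : 0 < eps * sg y by exact: Rmult_lt_0_compat.
by apply: Rabs_le; split; apply: Rnot_lt_le => h5; nra.
Qed.

Lemma tang_p (y y' : R -> V) : tang_sol y y' ->
  (forall eta, 0 < eta -> exists T, forall t, T < t -> forall i, Rabs (y' t i + Mop M (y t) i) <= eta * sg (y t)) ->
  forall eps, 0 < eps -> exists T, forall t, T < t -> forall i, Rabs (y t i - sg (y t) * e i) <= eps * sg (y t).
Proof.
move=> hy hR eps e0; case: (hp) => g0 _ _ _ _.
case: tang_bound => K [K0 hK]; have N0 := pos_INR #|I|.
pose b := eps * eps / (2 * (1 + N)).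
have b0 : 0 < b by apply: Rdiv_lt_0_compat; nra.
have q0 : 0 < b / (2 * K) by apply: Rdiv_lt_0_compat; lra.
case: (hR _ q0) => T1 hT1.
case: (@exp_small (2 * g) (b / (2 * K))) => [||X [X0 hX]]; [lra|lra|].
exists (T1 + 1 + X) => t ht; case: (hy t) => _ h2 h3; apply: theta_to_dir => //.
have := hK y y' (b / (2 * K)) (T1 + 1) t q0 ltac:(lra) => h.
apply: Rle_trans (h _) _.
  by move=> r hr; case: (hy r) => ? ? ?; split=> //; apply: hT1; lra.
have := hX (t - (T1 + 1)) ltac:(lra) => h4.
have h5 := Rmult_le_compat_l K _ _ (Rlt_le _ _ K0) h4.
rewrite -/b; have : K * (b / (2 * K)) = b / 2 by field; lra.
lra.
Qed.

(** Contraction runs forward in time, so towards minus infinity the bound is used on the window from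
    [t - X] to [t]; the uniform bound at its left end makes a fixed length [X] sufficient. *)
Lemma tang_m (y y' : R -> V) : tang_sol y y' ->
  (forall eta, 0 < eta -> exists T, forall t, t < T -> forall i, Rabs (y' t i + Mop M (y t) i) <= eta * sg (y t)) ->
  forall eps, 0 < eps -> exists T, forall t, t < T -> forall i, Rabs (y t i - sg (y t) * e i) <= eps * sg (y t).
Proof.
move=> hy hR eps e0; case: (hp) => g0 _ _ _ _.
case: tang_bound => K [K0 hK]; have N0 := pos_INR #|I|.
pose b := eps * eps / (2 * (1 + N)).
have b0 : 0 < b by apply: Rdiv_lt_0_compat; nra.
have q0 : 0 < b / (2 * K) by apply: Rdiv_lt_0_compat; lra.
case: (hR _ q0) => T1 hT1.
case: (@exp_small (2 * g) (b / (2 * K))) => [||X [X0 hX]]; [lra|lra|].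
exists T1 => t ht; case: (hy t) => _ h2 h3; apply: theta_to_dir => //.
have := hK y y' (b / (2 * K)) (t - X) t q0 ltac:(lra) => h.
apply: Rle_trans (h _) _.
  by move=> r hr; case: (hy r) => ? ? ?; split=> //; apply: hT1; lra.
have := hX (t - (t - X)) ltac:(lra) => h4.
have h5 := Rmult_le_compat_l K _ _ (Rlt_le _ _ K0) h4.
rewrite -/b; have : K * (b / (2 * K)) = b / 2 by field; lra.
lra.
Qed.

(* [y' = - M y + o(y)] is then asymptotic to [- lam (sg y) e], so [y'] has the same direction. *)
Lemma dir_of_deriv B : (forall i j, Rabs (M i j) <= B) -> lam <> 0 -> forall eps, 0 < eps ->
  exists eta, 0 < eta /\ forall y y' : V, 0 < sg y ->
    (forall i, Rabs (y' i + Mop M y i) <= eta * sg y) ->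
    (forall i, Rabs (y i - sg y * e i) <= eta * sg y) ->
    sg y' <> 0 /\ forall i, Rabs (y' i - sg y' * e i) <= eps * Rabs (sg y').
Proof.
move=> hB l0 eps e0; case: (hp) => _ ep se ee _; have N0 := pos_INR #|I|.
have B0 : 0 <= B by apply: Rle_trans (hB i0 i0); exact: Rabs_pos.
have la := Rabs_pos_lt _ l0.
pose c := 1 + N * B.
have c1 : 1 <= c by rewrite /c; nra.
pose eta := Rmin (Rabs lam / (2 * (1 + N) * c)) (Rabs lam * eps / (2 * (1 + N) * c)).
have Nc : 0 < 2 * (1 + N) * c by nra.
have eta0 : 0 < eta.
  by apply: Rmin_glb_lt; apply: Rdiv_lt_0_compat => //; nra.
have eta1 : eta * (2 * (1 + N) * c) <= Rabs lam by apply: le_div_mul => //; exact: Rmin_l.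
have eta2 : eta * (2 * (1 + N) * c) <= Rabs lam * eps by apply: le_div_mul => //; exact: Rmin_r.
exists eta; split=> // y y' sy h1 h2.
have h3 i : Rabs (y' i + lam * sg y * e i) <= c * eta * sg y.
  pose w j := y j + - sg y * e j.
  have hw : Mop M w i = Mop M y i - lam * sg y * e i by rewrite /w MopD MopZ ee; ring.
  have hw2 : Rabs (Mop M w i) <= N * (B * (eta * sg y)).
    apply: Rle_trans (bsum_abs _ _ _) _; rewrite -(rsum_const I); apply: bsum_le => j _.
    rewrite Rabs_mult; apply: Rmult_le_compat; try exact: Rabs_pos; first exact: hB.
    by rewrite /w (_ : y j + - sg y * e j = y j - sg y * e j); last ring.
  have -> : y' i + lam * sg y * e i = (y' i + Mop M y i) - Mop M w i by rewrite hw; ring.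
  apply: Rle_trans (Rabs_triang _ _) _; rewrite Rabs_Ropp.
  by have := h1 i; rewrite /c; lra.
have h4 : Rabs (sg y' + lam * sg y) <= N * (c * eta * sg y).
  have -> : sg y' + lam * sg y = sg (fun i => y' i + lam * sg y * e i) by rewrite sgD sgZ se; ring.
  by apply: Rle_trans (sg_abs _) _; exact: nrm_bound.
have es : 0 < eta * sg y by exact: Rmult_lt_0_compat.
have h5 : Rabs lam / 2 * sg y <= Rabs (sg y').
  have : Rabs (lam * sg y) <= Rabs (sg y' + lam * sg y) + Rabs (sg y').
    have := Rabs_triang (sg y' + lam * sg y) (- sg y').
    by rewrite Rabs_Ropp (_ : sg y' + lam * sg y + - sg y' = lam * sg y); last ring.
  rewrite Rabs_mult (Rabs_pos_eq (sg y)); last lra.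
  have : N * (c * eta * sg y) <= Rabs lam / 2 * sg y.
    rewrite (_ : N * (c * eta * sg y) = (eta * (N * c)) * sg y); last ring.
    apply: Rmult_le_compat_r; first lra; nra.
  lra.
have h6 : 0 < Rabs (sg y').
  apply: Rlt_le_trans h5; apply: Rmult_lt_0_compat; lra.
split; first by move=> h; rewrite h Rabs_R0 in h6; lra.
move=> i.
have -> : y' i - sg y' * e i = (y' i + lam * sg y * e i) + - ((sg y' + lam * sg y) * e i) by ring.
apply: Rle_trans (Rabs_triang _ _) _; rewrite Rabs_Ropp Rabs_mult (Rabs_pos_eq (e i)); last exact: Rlt_le.
have k1 : Rabs (sg y' + lam * sg y) * e i <= N * (c * eta * sg y).
  by have := perron_e_le1 i hp; have := ep i; have := Rabs_pos (sg y' + lam * sg y); nra.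
apply: (@Rle_trans _ ((1 + N) * (c * eta * sg y))); first by have := h3 i; lra.
apply: (@Rle_trans _ (Rabs lam * eps / 2 * sg y)).
  rewrite (_ : (1 + N) * (c * eta * sg y) = (eta * ((1 + N) * c)) * sg y); last ring.
  by apply: Rmult_le_compat_r; lra.
by nra.
Qed.
End Tang.

(** * Tangent directions of orbits, inside and at their ends *)

Section Tangents.
Variables (I : finType) (f : (I -> R) -> I -> R) (H : (I -> R) -> I -> I -> R).
Local Notation V := (I -> R).
Implicit Types x y u : V.

(* [u] is the tangent direction of the ghost circle at [x], normalised by [sg u = 1]:
   the flow direction or, at critical points, the Perron direction. *)
Definition isU x u := sg u = 1 /\
  ((~ crit f x /\ forall i, f x i = sg (f x) * u i) \/
   (crit f x /\ (forall i, 0 < u i) /\ exists lam, forall i, Mop (H x) u i = lam * u i)).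

(* [rho = 1] and [rho = -1] express one-sided C^1 smoothness of [G] at [x]. *)
Definition side (rho : R) (G : V -> Prop) x := exists u, isU x u /\
  forall eps, 0 < eps -> exists d, 0 < d /\ forall y, G y -> 0 < rho * (sg y - sg x) < d ->
    (forall i, Rabs (y i - x i - (sg y - sg x) * u i) <= eps * Rabs (sg y - sg x)) /\
    (forall u', isU y u' -> forall i, Rabs (u' i - u i) <= eps).

Lemma side_ext rho (O X : V -> Prop) x :
  (exists d, 0 < d /\ forall y, X y -> 0 < rho * (sg y - sg x) < d -> O y) ->
  side rho O x -> side rho X x.
Proof.
move=> [d0 [d00 h0]] [u [hu h]]; exists u; split=> // eps he.
case: (h eps he) => d [dp hd]; exists (Rmin d d0); split=> [|y Xy [h1 h2]]; first exact: Rmin_glb_lt.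
have k1 := Rlt_le_trans _ _ _ h2 (Rmin_l _ _).
have k2 := Rlt_le_trans _ _ _ h2 (Rmin_r _ _).
by apply: hd => //; apply: h0.
Qed.
End Tangents.

(** The piece strictly between two neighbouring critical points. [lk_lim] allows both directions of
    flow, so that a reversed link is again a link. *)
Record link (I : finType) (f : (I -> R) -> I -> R) H (Phi : R -> (I -> R) -> I -> R)
   (a b : I -> R) (O : (I -> R) -> Prop) : Prop := Link {
  lk_box : forall x, O x -> [/\ vlt a x, vlt x b & ~ crit f x];
  lk_surj : forall s, sg a < s < sg b -> exists x, O x /\ sg x = s;
  lk_lt : forall x y, O x -> O y -> sg x < sg y -> vlt x y;
  lk_eq : forall x y, O x -> O y -> sg x = sg y -> x = y;
  lk_flow : forall x t, O x -> O (Phi t x);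
  lk_lim : forall x, O x ->
    (tlim_m (fun t => Phi t x) a /\ tlim_p (fun t => Phi t x) b) \/
    (tlim_m (fun t => Phi t x) b /\ tlim_p (fun t => Phi t x) a);
  lk_side : forall x rho, O x -> rho = 1 \/ rho = -1 -> side f H rho O x;
  lk_sidea : side f H 1 O a;
  lk_sideb : side f H (-1) O b }.

Section Links.
Variables (I : finType) (i0 : I) (W : (I -> R) -> R) (f : (I -> R) -> I -> R).
Variables (H : (I -> R) -> I -> I -> R) (C : R).
Hypothesis HS : gsys W f H C.
Local Notation V := (I -> R).
Implicit Types x y z v w : V.
Local Notation N := (INR #|I|).
Variable Phi : R -> V -> V.
Hypothesis Phi0 : forall x, Phi 0 x = x.
Hypothesis PhiD : forall x t i, derivable_pt_lim (fun t => Phi t x i) t (f (Phi t x) i).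
Hypothesis HM : nondeg f H.
Local Notation crit := (crit f).
Local Notation isU := (isU f H).
Local Notation side := (side f H).

Lemma isU_unique x u u' : isU x u -> isU x u' -> u = u'.
Proof.
move=> [s1 h1] [s2 h2].
case: h1 => [[nc h1]|[c [p [l h1]]]]; case: h2 => [[nc' h2]|[c' [p' [l' h2]]]] //.
  have s0 : sg (f x) <> 0 by move=> s0; apply: nc => i; rewrite h1 s0; ring.
  by apply: functional_extensionality => i; apply: (Rmult_eq_reg_l (sg (f x))) => //; rewrite -h1 -h2.
case: (perron_at i0 HS x) => lam [e [g hp]].
case: (perron_at_unique i0 HS hp p s1 h1) => _ ->.
by case: (perron_at_unique i0 HS hp p' s2 h2) => _ ->.
Qed.

Lemma Phi_vderiv x eta : 0 < eta -> exists d, 0 < d /\ forall h, Rabs h < d ->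
  forall i, Rabs (Phi h x i - x i - h * f x i) <= eta * Rabs h.
Proof.
move=> he.
case: (@fin_delta I (fun i d => forall h, Rabs h < d -> Rabs (Phi h x i - x i - h * f x i) <= eta * Rabs h)).
- move=> i; case: (PhiD x 0 i he) => d hd; exists d; split; first exact: cond_pos.
  move=> h hh; have [->|h0] := Req_dec h 0.
    by rewrite Phi0 Rabs_R0 (_ : _ - _ - _ = 0) ?Rabs_R0; [lra|ring].
  have := hd h h0 hh; rewrite Rplus_0_l Phi0 => hx.
  have -> : Phi h x i - x i - h * f x i = ((Phi h x i - x i) / h - f x i) * h by field.
  rewrite Rabs_mult; apply: Rmult_le_compat_r; [exact: Rabs_pos | exact: Rlt_le].
- move=> i d d' hd h k hk; apply: h; lra.
by move=> d [d0 hd]; exists d; split=> // h hh i; exact: hd.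
Qed.

Section Orbit.
Variable x : V.
Hypothesis fx : forall t i, 0 <= f (Phi t x) i.
Hypothesis ncx : ~ crit x.

Lemma orbit_lt s t : s < t -> vlt (Phi s x) (Phi t x).
Proof.
move=> rt; have -> : t = (t - s) + s by ring.
rewrite (Phi_add HS Phi0 PhiD) -{1}(Phi0 (Phi s x)).
apply: (sub_lt HS Phi0 PhiD) => //; [exact: (noncrit_Phi HS Phi0 PhiD) | lra].
Qed.

Lemma orbit_sg_lt s t : s < t -> sg (Phi s x) < sg (Phi t x).
Proof.
move=> st; have h := orbit_lt st; apply: vle_sg_lt; first exact: vlt_le.
by move=> e; have := h i0; rewrite e; lra.
Qed.

Lemma orbit_sg_inv s t : sg (Phi s x) < sg (Phi t x) -> s < t.
Proof.
move=> h; apply: Rnot_le_lt => -[/orbit_sg_lt|e]; [lra | subst; lra].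
Qed.

Definition orbit y := exists t, y = Phi t x.

(** The sum of the coordinates has positive velocity [F = sg (f x)] at a regular point of a monotone
    orbit, so it may replace time as parameter, and the tangent becomes [f x / F]. *)
Lemma orbit_side_at rho : rho = 1 \/ rho = -1 -> side rho orbit x.
Proof.
move=> hrho; have N0 := pos_INR #|I|.
have f0 i : 0 <= f x i by have := fx 0 i; rewrite Phi0.
have F0 : 0 < sg (f x).
  apply: NNPP => h; apply: ncx => i; apply: (rsum_eq0 f0).
  have h2 : 0 <= sg (f x) by apply: bsum_ge0 => j _; exact: f0.
  by rewrite -/(sg (f x)); lra.
set F := sg (f x) in F0.
pose u i := f x i / F.
have u01 i : 0 <= u i <= 1.
  have h1 : f x i <= F by apply: (@rsum_term _ (f x)).
  split; first by apply: Rle_mult_inv_pos.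
  apply: (Rmult_le_reg_r F) => //; rewrite /u (_ : f x i / F * F = f x i); [lra | field; lra].
have fu i : f x i = F * u i by rewrite /u; field; lra.
exists u; split.
  split; last by left; split.
  rewrite (_ : u = fun i => / F * f x i) ?sgZ -/F; first by field; lra.
  by apply: functional_extensionality => i; rewrite /u; field; lra.
move=> eps he.
(* The first bound keeps the increment of the sum at least [F / 2 * Rabs h], which allows division
   by it; the second makes the quotient of the errors at most [eps]. *)
pose eta := Rmin (F / (2 * (N + 1))) (eps * F / (2 * (N + 1))).
have eta0 : 0 < eta by apply: Rmin_glb_lt; apply: Rdiv_lt_0_compat; nra.
have eta1 : eta * (2 * (N + 1)) <= F by apply: le_div_mul; [lra | exact: Rmin_l].
have eta2 : eta * (2 * (N + 1)) <= eps * F by apply: le_div_mul; [lra | exact: Rmin_r].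
case: (Phi_vderiv x eta0) => d1 [d10 hd1].
case: (f_cont HS x eta0) => d2 [d20 hd2].
have hd3 : exists d, 0 < d /\ forall h, Rabs h < d -> forall i, Rabs (Phi h x i - x i) < d2.
  case: (@fin_delta I (fun i d => forall h, Rabs h < d -> Rabs (Phi h x i - x i) < d2)).
  - move=> i; have := derivable_pt_lim_cont (PhiD x 0 i); move/continuity_pt_eps => /(_ d2 d20) [d [dp hd]].
    exists d; split=> // h hh; rewrite -{2}(Phi0 x); apply: hd; by rewrite Rminus_0_r.
  - move=> i d d' hd h k hk; apply: h; lra.
  by move=> d [d0 hd]; exists d; split=> // h hh i; exact: hd.
case: hd3 => d3 [d30 hd3].
pose h0 := Rmin d1 d3 / 2.
have m0 : 0 < Rmin d1 d3 by exact: Rmin_glb_lt.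
have h00 : 0 < h0 by rewrite /h0; lra.
have hh1 : h0 < d1 by have := Rmin_l d1 d3; rewrite /h0; lra.
have hh3 : h0 < d3 by have := Rmin_r d1 d3; rewrite /h0; lra.
have s1 := @orbit_sg_lt 0 h0 h00; have s2 := @orbit_sg_lt (- h0) 0 ltac:(lra).
rewrite Phi0 in s1 s2.
exists (Rmin (sg (Phi h0 x) - sg x) (sg x - sg (Phi (- h0) x))); split; first by apply: Rmin_glb_lt; lra.
move=> y [h ->] [k1 k2].
have k3 := Rlt_le_trans _ _ _ k2 (Rmin_l _ _).
have k4 := Rlt_le_trans _ _ _ k2 (Rmin_r _ _).
have hr : Rabs h < h0.
  case: hrho => e; rewrite e in k1 k2 k3 k4.
    have p1 : 0 < h by apply: orbit_sg_inv; rewrite Phi0; lra.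
    by rewrite Rabs_pos_eq; [apply: orbit_sg_inv; lra | lra].
  have p1 : h < 0 by apply: orbit_sg_inv; rewrite Phi0; lra.
  rewrite Rabs_left //.
  have : - h0 < h by apply: orbit_sg_inv; lra.
  lra.
have hD := hd1 h ltac:(lra).
have hs : Rabs (sg (Phi h x) - sg x - h * F) <= N * (eta * Rabs h).
  have -> : sg (Phi h x) - sg x - h * F = sg (fun i => Phi h x i - x i - h * f x i).
    by rewrite sgB sgB sgZ.
  by apply: Rle_trans (sg_abs _) _; exact: nrm_bound.
have ah := Rabs_pos h.
have low : F / 2 * Rabs h <= Rabs (sg (Phi h x) - sg x).
  have := Rabs_triang (sg (Phi h x) - sg x - h * F) (- (sg (Phi h x) - sg x)).
  rewrite Rabs_Ropp (_ : _ + - _ = - (h * F)); last ring.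
  rewrite Rabs_Ropp Rabs_mult (Rabs_pos_eq F); last lra.
  have : N * (eta * Rabs h) <= F / 2 * Rabs h.
    rewrite -Rmult_assoc; apply: Rmult_le_compat_r => //; nra.
  lra.
split=> [i|u' [su' [[_ hu']|[c _]]] i].
- have -> : Phi h x i - x i - (sg (Phi h x) - sg x) * u i =
     (Phi h x i - x i - h * f x i) + - ((sg (Phi h x) - sg x - h * F) * u i) by rewrite fu; ring.
  apply: Rle_trans (Rabs_triang _ _) _; rewrite Rabs_Ropp Rabs_mult (Rabs_pos_eq (u i)); last by case: (u01 i).
  have j1 := hD i; have [j2 j3] := u01 i.
  have j4 : Rabs (sg (Phi h x) - sg x - h * F) * u i <= N * (eta * Rabs h).
    by have := Rabs_pos (sg (Phi h x) - sg x - h * F); nra.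
  have j5 : (1 + N) * eta * Rabs h <= eps * (F / 2) * Rabs h by apply: Rmult_le_compat_r => //; nra.
  have j6 : eps * (F / 2 * Rabs h) <= eps * Rabs (sg (Phi h x) - sg x) by apply: Rmult_le_compat_l; lra.
  lra.
- have hc := hd2 (Phi h x) (hd3 h ltac:(lra)).
  have hsF : Rabs (sg (f (Phi h x)) - F) <= N * eta.
    by rewrite /F -sgB; apply: Rle_trans (sg_abs _) _; apply: nrm_bound => k; exact: Rlt_le.
  set G := sg (f (Phi h x)) in hu' hsF.
  have G2 : F / 2 <= G by move/Rabs_bnd: hsF; nra.
  have e1 : (u' i - u i) * G = (f (Phi h x) i - f x i) + - ((G - F) * u i) by rewrite hu' (fu i); ring.
  apply: (Rmult_le_reg_r G); first lra.
  rewrite -{1}(Rabs_pos_eq G); last lra.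
  rewrite -Rabs_mult e1; apply: Rle_trans (Rabs_triang _ _) _; rewrite Rabs_Ropp Rabs_mult (Rabs_pos_eq (u i)); last by case: (u01 i).
  have j1 := hc i; have [j2 j3] := u01 i.
  have j4 : Rabs (G - F) * u i <= N * eta by have := Rabs_pos (G - F); nra.
  have : eps * (F / 2) <= eps * G by apply: Rmult_le_compat_l; lra.
  lra.
- by case: (noncrit_Phi HS Phi0 PhiD (t := h) ncx c).
Qed.
End Orbit.

Lemma perron_isU z lam e g : crit z -> perron_data (H z) lam e g -> isU z e.
Proof. by move=> cz [_ h1 h2 h3 _]; split=> //; right; split=> //; split=> //; exists lam. Qed.

Lemma perron_ne0 z lam e g : crit z -> perron_data (H z) lam e g -> lam <> 0.
Proof.
move=> cz [_ ep _ ee _] l0; have := ep i0; rewrite (HM cz (v := e)); first lra.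
by move=> i; rewrite ee l0; ring.
Qed.

Lemma isU_close y u (e : V) eps : sg (f y) <> 0 -> ~ crit y ->
  (forall i, Rabs (f y i - sg (f y) * e i) <= eps * Rabs (sg (f y))) -> isU y u ->
  forall i, Rabs (u i - e i) <= eps.
Proof.
move=> s0 nc h [_ [[_ hu]|[c _]]] i //.
have p := Rabs_pos_lt _ s0.
apply: (Rmult_le_reg_r (Rabs (sg (f y)))) => //.
rewrite -Rabs_mult (_ : (u i - e i) * sg (f y) = f y i - sg (f y) * e i) //.
by rewrite {1}hu; ring.
Qed.

Section Het_link.
Variables (z b x : V).
Hypothesis cz : crit z.
Hypothesis cb : crit b.
Hypothesis box : forall t, vlt z (Phi t x) /\ vlt (Phi t x) b.
Hypothesis fx : forall t i, 0 <= f (Phi t x) i.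
Hypothesis ncx : ~ crit x.
Hypothesis lm : tlim_m (fun t => Phi t x) z.
Hypothesis lp : tlim_p (fun t => Phi t x) b.

Let vlt_sg y y' : vlt y y' -> sg y < sg y'.
Proof.
by move=> h; apply: vle_sg_lt; [exact: vlt_le | move=> e; have := h i0; rewrite e; lra].
Qed.

(** The displacement from [z] is a positive solution of the linearised equation up to a small
    relative error: [tang_m] gives the direction of the secants and [dir_of_deriv] that of the
    velocities. *)
Lemma het_side_low : side 1 (orbit x) z.
Proof.
case: (perron_at i0 HS z) => lam [e [g hp]].
have l0 := perron_ne0 cz hp.
exists e; split; first exact: perron_isU hp.
have hts : tang_sol (fun t i => Phi t x i - z i) (fun t => f (Phi t x)).
  move=> t; split.
  - move=> i; rewrite -(Rminus_0_r (f _ i)).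
    by apply: derivable_pt_lim_minus; [exact: PhiD | exact: derivable_pt_lim_const].
  - by move=> i; case: (box t) => /(_ i); lra.
  - by rewrite sgB; case: (box t) => /vlt_sg; lra.
have hR eta : 0 < eta -> exists T, forall t, t < T -> forall i,
    Rabs (f (Phi t x) i + Mop (H z) (fun i => Phi t x i - z i) i) <= eta * sg (fun i => Phi t x i - z i).
  move=> he; case: (expand HS z he) => d [d0 hd]; case: (lm d0) => T hT; exists T => t ht i.
  have := hd (fun i => Phi t x i - z i) (hT t ht) i.
  have -> : (fun j => z j + (Phi t x j - z j)) = Phi t x by apply: functional_extensionality => j; ring.
  rewrite cz Rminus_0_r nrm_nonneg // => k; by case: (box t) => /(_ k); lra.
move=> eps he.
case: (dir_of_deriv i0 hp (gs_C HS z) l0 he) => eta [eta0 hdir].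
have htm := tang_m i0 (H_dot_sym HS z) hp hts hR.
case: (htm eps he) => T1 hT1; case: (htm eta eta0) => T2 hT2; case: (hR eta eta0) => T3 hT3.
pose T := Rmin T1 (Rmin T2 T3).
exists (sg (Phi T x) - sg z); split; first by case: (box T) => /vlt_sg; lra.
move=> y [t ->]; rewrite Rmult_1_l => -[k1 k2].
have tT : t < T by apply: (orbit_sg_inv fx ncx); lra.
have t1 : t < T1 by apply: Rlt_le_trans tT (Rmin_l _ _).
have t2 : t < T2 by apply: Rlt_le_trans tT (Rle_trans _ _ _ (Rmin_r _ _) (Rmin_l _ _)).
have t3 : t < T3 by apply: Rlt_le_trans tT (Rle_trans _ _ _ (Rmin_r _ _) (Rmin_r _ _)).
split=> [i|u' hu' i].
  by have := hT1 t t1 i; rewrite sgB (Rabs_pos_eq (sg (Phi t x) - sg z)) //; lra.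
case: (hdir (fun i => Phi t x i - z i) (f (Phi t x))).
- by case: (hts t).
- exact: hT3.
- exact: hT2.
move=> s0 hs; apply: (isU_close s0 _ hs hu'); exact: (noncrit_Phi HS Phi0 PhiD).
Qed.

Lemma het_side_up : side (-1) (orbit x) b.
Proof.
case: (perron_at i0 HS b) => lam [e [g hp]].
have l0 := perron_ne0 cb hp.
exists e; split; first exact: perron_isU hp.
have hts : tang_sol (fun t i => b i - Phi t x i) (fun t i => - f (Phi t x) i).
  move=> t; split.
  - move=> i; rewrite -(Rminus_0_l (f _ i)).
    by apply: derivable_pt_lim_minus; [exact: derivable_pt_lim_const | exact: PhiD].
  - by move=> i; case: (box t) => _ /(_ i); lra.
  - by rewrite sgB; case: (box t) => _ /vlt_sg; lra.
have hR eta : 0 < eta -> exists T, forall t, T < t -> forall i,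
    Rabs (- f (Phi t x) i + Mop (H b) (fun i => b i - Phi t x i) i) <= eta * sg (fun i => b i - Phi t x i).
  move=> he; case: (expand HS b he) => d [d0 hd]; case: (lp d0) => T hT; exists T => t ht i.
  have := hd (fun i => Phi t x i - b i) (hT t ht) i.
  have -> : (fun j => b j + (Phi t x j - b j)) = Phi t x by apply: functional_extensionality => j; ring.
  have e1 : (fun i => Phi t x i - b i) = (fun i => -1 * (b i - Phi t x i)).
    by apply: functional_extensionality => j; ring.
  rewrite cb Rminus_0_r e1 MopZ nrmZ Rabs_Ropp Rabs_R1 Rmult_1_l nrm_nonneg => [|k]; last first.
    by case: (box t) => _ /(_ k); lra.
  by rewrite -Rabs_Ropp; rewrite (_ : - _ = - f (Phi t x) i + Mop (H b) (fun i => b i - Phi t x i) i) //; ring.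
move=> eps he.
case: (dir_of_deriv i0 hp (gs_C HS b) l0 he) => eta [eta0 hdir].
have htm := tang_p i0 (H_dot_sym HS b) hp hts hR.
case: (htm eps he) => T1 hT1; case: (htm eta eta0) => T2 hT2; case: (hR eta eta0) => T3 hT3.
pose T := Rmax T1 (Rmax T2 T3).
exists (sg b - sg (Phi T x)); split; first by case: (box T) => _ /vlt_sg; lra.
move=> y [t ->] [k1 k2].
have tT : T < t by apply: (orbit_sg_inv fx ncx); lra.
have t1 : T1 < t by apply: Rle_lt_trans (Rmax_l _ _) tT.
have t2 : T2 < t by apply: Rle_lt_trans (Rle_trans _ _ _ (Rmax_l _ _) (Rmax_r _ _)) tT.
have t3 : T3 < t by apply: Rle_lt_trans (Rle_trans _ _ _ (Rmax_r _ _) (Rmax_r _ _)) tT.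
split=> [i|u' hu' i].
  have := hT1 t t1 i; rewrite sgB (Rabs_left1 (sg (Phi t x) - sg b)); last lra.
  rewrite -Rabs_Ropp (_ : - (b i - Phi t x i - (sg b - sg (Phi t x)) * e i) = Phi t x i - b i - (sg (Phi t x) - sg b) * e i); last ring.
  by rewrite (_ : - (sg (Phi t x) - sg b) = sg b - sg (Phi t x)) //; ring.
case: (hdir (fun i => b i - Phi t x i) (fun i => - f (Phi t x) i)).
- by case: (hts t).
- exact: hT3.
- exact: hT2.
rewrite sgN => s0 hs; apply: (@isU_close (Phi t x) u' e eps _ _ _ hu'); [lra | exact: (noncrit_Phi HS Phi0 PhiD) |].
move=> j; have := hs j; rewrite Rabs_Ropp -Rabs_Ropp.
by rewrite (_ : - (- f (Phi t x) j - - sg (f (Phi t x)) * e j) = f (Phi t x) j - sg (f (Phi t x)) * e j) //; ring.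
Qed.

Lemma orbit_shift t : orbit (Phi t x) = orbit x.
Proof.
apply: functional_extensionality => y; apply: propositional_extensionality; split=> -[s ->].
  by exists (s + t); rewrite (Phi_add HS Phi0 PhiD).
by exists (s - t); rewrite -(Phi_add HS Phi0 PhiD); congr (Phi _ x); ring.
Qed.

Lemma het_link : link f H Phi z b (orbit x).
Proof.
have inv := @orbit_sg_inv x fx ncx.
split.
- move=> y [t ->]; case: (box t) => h1 h2; split=> //; exact: (noncrit_Phi HS Phi0 PhiD).
- move=> s [s1 s2].
  have lp' := @tlim_sg I (fun t => Phi t x) b lp (sg b - s) ltac:(lra).
  (* The backward limit is turned into a forward one by [t -> - t]; the intermediate value theorem
     then attains every sum between the two ends. *)
  have lm' : exists T, forall t, T < t -> Rabs (sg (Phi (- t) x) - sg z) < s - sg z.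
    apply: (@tlim_sg I (fun t => Phi (- t) x)) => [e he|]; last lra.
    by case: (lm he) => T hT; exists (- T) => t ht i; apply: hT; lra.
  case: lp' => T1 hT1; case: lm' => T2 hT2.
  pose A := - (Rmax T2 0 + 1); pose B := Rmax T1 0 + 1.
  have A0 : A < 0 by rewrite /A; have := Rmax_r T2 0; lra.
  have B0 : 0 < B by rewrite /B; have := Rmax_r T1 0; lra.
  have hA := hT2 (- A) ltac:(rewrite /A; have := Rmax_l T2 0; lra); rewrite Ropp_involutive in hA.
  have hB := hT1 B ltac:(rewrite /B; have := Rmax_l T1 0; lra).
  case: (@IVT_cor (fun t => sg (Phi t x) - s) A B) => [|||t [ht1 ht2]].
  + move=> t; apply: derivable_pt_lim_cont; apply: derivable_pt_lim_minus; first exact: sg_Phi_deriv.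
    exact: derivable_pt_lim_const.
  + lra.
  + move/Rabs_def2: hA; move/Rabs_def2: hB; nra.
  by exists (Phi t x); split; [exists t | lra].
- by move=> y y' [t ->] [t' ->] /inv; exact: orbit_lt.
- move=> y y' [t ->] [t' ->] h; have [lt|[->|gt]] := Rtotal_order t t' => //.
    by have := @orbit_sg_lt x fx ncx t t' lt; lra.
  by have := @orbit_sg_lt x fx ncx t' t gt; lra.
- by move=> y t [s ->]; exists (t + s); rewrite (Phi_add HS Phi0 PhiD).
- move=> y [s ->]; left; split=> e he.
    case: (lm he) => T hT; exists (T - s) => t ht i; rewrite -(Phi_add HS Phi0 PhiD); apply: hT; lra.
  case: (lp he) => T hT; exists (T - s) => t ht i; rewrite -(Phi_add HS Phi0 PhiD); apply: hT; lra.
- move=> y rho [t ->] hr; rewrite -(orbit_shift t); apply: orbit_side_at => //.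
    by move=> s i; rewrite -(Phi_add HS Phi0 PhiD).
  exact: (noncrit_Phi HS Phi0 PhiD).
- exact: het_side_low.
- exact: het_side_up.
Qed.
End Het_link.

Lemma link_up z b : unstable f H z -> crit b -> vlt z b ->
  (forall y, crit y -> vle z y -> vle y b -> y = z \/ y = b) -> exists O, link f H Phi z b O.
Proof.
move=> uz cb zb hno; case: (het_up i0 HS Phi0 PhiD HM uz cb zb hno) => x [h1 h2 h3 [h4 h5]].
by exists (orbit x); apply: het_link => //; case: uz.
Qed.
End Links.

Section LinkRev.
Variables (I : finType) (f : (I -> R) -> I -> R) (H : (I -> R) -> I -> I -> R).
Local Notation V := (I -> R).
Variable Phi : R -> V -> V.

(** The direction [u] itself is unchanged: the field and its sum change sign together, and at
    critical points the positive eigenvector is the same. *)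
Lemma isU_rev x u : isU f H x u <-> isU (frev f) (Hrev H) (vopp x) u.
Proof.
have cr : crit f x <-> crit (frev f) (vopp x).
  by split=> [|h]; [exact: crit_rev | rewrite -(voppK x); exact: crit_rev'].
have sf : sg (frev f (vopp x)) = - sg (f x) by rewrite /frev voppK /vopp sgN.
split=> -[s1 h]; split=> //; case: h => [[h1 h2]|[h1 [h2 h3]]].
- left; split; first by move/cr.
  by move=> i; rewrite sf /frev voppK /vopp h2; ring.
- by right; split; [exact/cr | split=> //; rewrite /Hrev voppK].
- left; split; first by move/cr.
  by move=> i; have := h2 i; rewrite sf /frev voppK /vopp; lra.
- by right; split; [exact/cr | split=> //; rewrite /Hrev voppK in h3].
Qed.

Lemma side_rev rho (G : V -> Prop) x :
  side (frev f) (Hrev H) rho G (vopp x) -> side f H (- rho) (fun y => G (vopp y)) x.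
Proof.
move=> [u [/isU_rev hu h]]; exists u; split=> // eps he; case: (h eps he) => d [d0 hd].
exists d; split=> // y Gy hy.
have e1 : sg (vopp y) - sg (vopp x) = - (sg y - sg x) by rewrite /vopp !sgN; ring.
case: (hd (vopp y) Gy); first by rewrite e1; lra.
rewrite e1 Rabs_Ropp => h1 h2; split=> [i|u' hu' i].
  have := h1 i; rewrite -Rabs_Ropp.
  by rewrite (_ : - _ = y i - x i - (sg y - sg x) * u i) //; rewrite /vopp; ring.
by apply: h2; apply/isU_rev.
Qed.

Lemma link_rev a b O : link (frev f) (Hrev H) (Phirev Phi) (vopp b) (vopp a) O ->
  link f H Phi a b (fun x => O (vopp x)).
Proof.
have sgv (x : V) : sg (vopp x) = - sg x by exact: sgN.
move=> [h1 h2 h3 h4 h5 h6 h7 h8 h9]; split.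
- move=> x /h1 [k1 k2 k3]; split; try exact: (vopp_lt _ _).2.
  by move=> c; apply: k3; exact: crit_rev.
- move=> s hs; case: (h2 (- s)); first by rewrite !sgv; lra.
  by move=> x [k1 k2]; exists (vopp x); rewrite voppK sgv k2; split=> //; ring.
- by move=> x y hx hy hs; apply: (vopp_lt _ _).2; apply: h3 => //; rewrite !sgv; lra.
- by move=> x y hx hy hs; apply: vopp_inj; apply: h4 => //; rewrite !sgv; lra.
- by move=> x t hx; have := h5 _ t hx; rewrite /Phirev voppK.
- move=> x /h6; rewrite /Phirev voppK => -[[k1 k2]|[k1 k2]].
    by right; split; [exact: (tlim_m_rev _ _).1 | exact: (tlim_p_rev _ _).1].
  by left; split; [exact: (tlim_m_rev _ _).1 | exact: (tlim_p_rev _ _).1].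
- move=> x rho hx hr; rewrite -(Ropp_involutive rho); apply: side_rev; apply: h7 => //.
  by case: hr => ->; [right | left]; ring.
- by rewrite (_ : 1 = - -1); [exact: side_rev | ring].
- by apply: side_rev.
Qed.
End LinkRev.

(** * Arcs and their periodic union *)

Definition goodcrit (I : finType) (f : (I -> R) -> I -> R) H z := stable f H z \/ index1 f H z.

Definition good (I : finType) (f : (I -> R) -> I -> R) H (Phi : R -> (I -> R) -> I -> R) x :=
  goodcrit f H x \/ (~ crit f x /\ exists a b, a <> b /\ goodcrit f H a /\ goodcrit f H b /\
    tlim_m (fun t => Phi t x) a /\ tlim_p (fun t => Phi t x) b).

Lemma goodcrit_crit (I : finType) (f : (I -> R) -> I -> R) H z : goodcrit f H z -> crit f z.
Proof. by case=> -[]. Qed.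

(* [X] is the half-open piece [[a, b)] of the ghost circle. *)
Record arc (I : finType) (f : (I -> R) -> I -> R) H (Phi : R -> (I -> R) -> I -> R)
   (a b : I -> R) (X : (I -> R) -> Prop) : Prop := Arc {
  ar_a : X a;
  ar_box : forall x, X x -> (x = a \/ vlt a x) /\ vlt x b;
  ar_surj : forall s, sg a <= s < sg b -> exists x, X x /\ sg x = s;
  ar_lt : forall x y, X x -> X y -> sg x < sg y -> vlt x y;
  ar_eq : forall x y, X x -> X y -> sg x = sg y -> x = y;
  ar_flow : forall x t, X x -> X (Phi t x);
  ar_good : forall x, X x -> good f H Phi x;
  ar_side1 : forall x, X x -> side f H 1 X x;
  ar_side2 : forall x, X x -> x <> a -> side f H (-1) X x;
  ar_sideb : side f H (-1) X b }.

Section Arcs.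
Variables (I : finType) (i0 : I) (W : (I -> R) -> R) (f : (I -> R) -> I -> R).
Variables (H : (I -> R) -> I -> I -> R) (C : R).
Hypothesis HS : gsys W f H C.
Local Notation V := (I -> R).
Implicit Types x y z v w : V.
Local Notation N := (INR #|I|).
Variable Phi : R -> V -> V.
Hypothesis Phi0 : forall x, Phi 0 x = x.
Hypothesis PhiD : forall x t i, derivable_pt_lim (fun t => Phi t x i) t (f (Phi t x) i).
Hypothesis HM : nondeg f H.
Local Notation crit := (crit f).
Local Notation side := (side f H).
Local Notation goodcrit := (goodcrit f H).

Lemma vlt_sg x y : vlt x y -> sg x < sg y.
Proof.
by move=> h; apply: vle_sg_lt; [exact: vlt_le | move=> e; have := h i0; rewrite e; lra].
Qed.

Lemma arc_of_link a b O : link f H Phi a b O -> goodcrit a -> goodcrit b -> vlt a b ->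
  arc f H Phi a b (fun x => x = a \/ O x).
Proof.
move=> [h1 h2 h3 h4 h5 h6 h7 h8 h9] ga gb ab; have sab := vlt_sg ab.
have ne : a <> b by move=> e; subst b; lra.
have sO x : O x -> sg a < sg x < sg b by move=> /h1 [k1 k2 _]; split; exact: vlt_sg.
split.
- by left.
- move=> x [->|hx]; first by split=> //; left.
  by case: (h1 x hx) => k1 k2 _; split=> //; right.
- move=> s [s1 s2]; case: s1 => [s1|<-]; last by exists a; split=> //; left.
  by case: (h2 s) => // x [k1 k2]; exists x; split=> //; right.
- move=> x y [->|hx] [->|hy] hs.
  + lra.
  + by case: (h1 y hy).
  + by have := sO x hx; lra.
  + exact: h3.
- move=> x y [->|hx] [->|hy] hs //.
  + by have := sO y hy; lra.
  + by have := sO x hx; lra.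
  + exact: h4.
- move=> x t [->|hx]; last by right; exact: h5.
  by left; rewrite (crit_fixed HS Phi0 PhiD t (goodcrit_crit ga)).
- move=> x [->|hx]; first by left.
  right; case: (h1 x hx) => _ _ nc; split=> //.
  case: (h6 x hx) => -[k1 k2]; first by exists a, b.
  by exists b, a; split=> //; exact: not_eq_sym.
- move=> x [->|hx].
    by apply: side_ext h8; exists 1; split; [lra|] => y [->|] //; lra.
  apply: side_ext (h7 x 1 hx (or_introl erefl)); exists 1; split; [lra|] => y [->|] //.
  by have := sO x hx; lra.
- move=> x [->|hx] // _.
  apply: side_ext (h7 x (-1) hx (or_intror erefl)); exists (sg x - sg a); split.
    by have := sO x hx; lra.
  by move=> y [->|] //; lra.
- apply: side_ext h9; exists (sg b - sg a); split; first lra.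
  by move=> y [->|] //; lra.
Qed.

Lemma arc_ab a b X : arc f H Phi a b X -> vlt a b.
Proof. by move=> h; case: (ar_box h (ar_a h)). Qed.

Lemma arc_sg a b X x : arc f H Phi a b X -> X x -> sg a <= sg x < sg b.
Proof.
move=> h hx; case: (ar_box h hx) => [[->|/vlt_sg h1] /vlt_sg h2]; lra.
Qed.

(** Half-open pieces meet without overlap. At the junction [b] the left tangent is the one recorded
    for the missing endpoint of [X], the right tangent belongs to [Y]. *)
Lemma arc_cat a b c X Y : arc f H Phi a b X -> arc f H Phi b c Y ->
  arc f H Phi a c (fun x => X x \/ Y x).
Proof.
move=> hX hY; have ab := arc_ab hX; have bc := arc_ab hY.
have sX x := @arc_sg _ _ _ x hX; have sY x := @arc_sg _ _ _ x hY.
have XY x y : X x -> Y y -> vlt x y.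
  move=> /(ar_box hX) [_ h1] /(ar_box hY) [[->|h2] _] //.
  exact: vlt_le_trans h1 (vlt_le h2).
split.
- by left; exact: (ar_a hX).
- move=> x [hx|hx].
    case: (ar_box hX hx) => h1 h2; split=> //; exact: vlt_le_trans h2 (vlt_le bc).
  case: (ar_box hY hx) => h1 h2; split=> //; right.
  by apply: XY => //; exact: (ar_a hX).
- move=> s hs; have [lt|ge] := Rlt_le_dec s (sg b).
    by case: (ar_surj hX (s := s)) => [|x [h1 h2]]; [lra | exists x; split=> //; left].
  by case: (ar_surj hY (s := s)) => [|x [h1 h2]]; [lra | exists x; split=> //; right].
- move=> x y [hx|hx] [hy|hy] hs.
  + exact: (ar_lt hX).
  + exact: XY.
  + by have := sX y hy; have := sY x hx; lra.
  + exact: (ar_lt hY).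
- move=> x y [hx|hx] [hy|hy] hs.
  + exact: (ar_eq hX).
  + by have := sX x hx; have := sY y hy; lra.
  + by have := sX y hy; have := sY x hx; lra.
  + exact: (ar_eq hY).
- by move=> x t [hx|hx]; [left; exact: (ar_flow hX) | right; exact: (ar_flow hY)].
- by move=> x [hx|hx]; [exact: (ar_good hX) | exact: (ar_good hY)].
- move=> x [hx|hx].
    apply: side_ext (ar_side1 hX hx); exists (sg b - sg x); split.
      by have := sX x hx; lra.
    by move=> y [] // hy; have := sY y hy; lra.
  apply: side_ext (ar_side1 hY hx); exists 1; split; first lra.
  by move=> y [] // hy; have := sX y hy; have := sY x hx; lra.
- move=> x [hx|hx] ne.
    apply: side_ext (ar_side2 hX hx ne); exists 1; split; first lra.
    by move=> y [] // hy; have := sX x hx; have := sY y hy; lra.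
  have [e|nb] := classic (x = b).
    subst x; apply: side_ext (ar_sideb hX); exists 1; split; first lra.
    by move=> y [] // hy; have := sY y hy; lra.
  apply: side_ext (ar_side2 hY hx nb); exists (sg x - sg b); split.
    case: (ar_box hY hx) => -[|/vlt_sg] //; lra.
  by move=> y [] // hy; have := sX y hy; lra.
- apply: side_ext (ar_sideb hY); exists (sg c - sg b); split; first by have := vlt_sg bc; lra.
  by move=> y [] // hy; have := sX y hy; lra.
Qed.

(** Both orbits start at the index-one point: one climbs to [b], the other descends to [a] and is
    obtained by reversal. No further critical point lies on either side within the gap. *)
Lemma gap_arc a b : gap f H a b -> exists X, arc f H Phi a b X.
Proof.
move=> hg; have [sa sb ab _] := hg.
case: (gap_index1 i0 HS Phi0 PhiD HM hg) => z [hz z1].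
have [cz az zb] := hz; have uz := interior_unstable i0 HS HM hg hz.
case: (link_up i0 HS Phi0 PhiD HM uz (proj1 sb) zb) => [y cy h1 h2|O2 hO2].
  exact: (gap_above i0 HS Phi0 PhiD HM hg hz).
have uz' : unstable (frev f) (Hrev H) (vopp z) by exact: (unstable_rev f H z).1.
case: (link_up i0 (gsys_rev HS) (Phirev0 Phi0) (PhirevD PhiD) (nondeg_rev HM) uz'
   (crit_rev (proj1 sa)) ((vopp_lt _ _).1 az)) => [y cy h1 h2|O1 hO1].
  case: (gap_below i0 HS Phi0 PhiD HM hg hz (crit_rev' cy)).
  - by apply: (vopp_le _ _).2; rewrite voppK.
  - by apply: (vopp_le _ _).2; rewrite voppK.
  - by move=> <-; left; rewrite voppK.
  - by move=> <-; right; rewrite voppK.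
have := arc_of_link (link_rev hO1) (or_introl sa) (or_intror z1) az.
have := arc_of_link hO2 (or_intror z1) (or_introl sb) zb.
by move=> h2 h1; exists (fun x => (x = a \/ O1 (vopp x)) \/ (x = z \/ O2 x)); exact: arc_cat h1 h2.
Qed.

(* Induction on the number of stable points between the endpoints; the points of [P]
   are preferred as splitting points, so that the arc passes through all of them. *)
Lemma chain (P : V -> Prop) : (forall m, P m -> stable f H m) ->
  (forall m m', P m -> P m' -> m = m' \/ vlt m m' \/ vlt m' m) ->
  forall a b, stable f H a -> stable f H b -> vlt a b ->
  exists X, arc f H Phi a b X /\ forall m, P m -> vle a m -> vlt m b -> X m.
Proof.
move=> Pst Ptot.
have main n : forall a b (L : list V), (length L <= n)%nat -> stable f H a -> stable f H b -> vlt a b ->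
   (forall y, stable f H y -> vlt a y -> vlt y b -> List.In y L) ->
   exists X, arc f H Phi a b X /\ forall m, P m -> vle a m -> vlt m b -> X m.
  elim: n => [|n IH] a b L hn sa sb ab hL.
    have hg : gap f H a b.
      split=> // y sy ay yb.
      have [->|na] := classic (y = a); first by left.
      have [->|nb] := classic (y = b); first by right.
      case: L hn hL => // _ hL; exfalso; apply: (hL y) => //.
        by apply: (crit_lt HS Phi0 PhiD) => //; [case: sa | case: sy | move=> e; exact: na].
      by apply: (crit_lt HS Phi0 PhiD) => //; [case: sy | case: sb].
    case: (gap_arc hg) => X hX; exists X; split=> // m hm am mb.
    have [_ _ _ hg'] := hg.
    case: (hg' m (Pst m hm) am (vlt_le mb)) => e; first by subst m; exact: (ar_a hX).
    by subst m; have := mb i0; lra.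
  have split_at y : stable f H y -> vlt a y -> vlt y b -> exists X Y, [/\ arc f H Phi a y X, arc f H Phi y b Y,
     (forall m, P m -> vle a m -> vlt m y -> X m) & (forall m, P m -> vle y m -> vlt m b -> Y m)].
    move=> sy ay yb.
    pose dec (x x' : V) := excluded_middle_informative (x = x').
    pose L' := List.remove dec y L.
    have hlen : (length L' <= n)%nat.
      have := List.remove_length_lt dec L y (hL y sy ay yb) => /ltP h.
      by rewrite -ltnS; apply: leq_trans h hn.
    have hin y' : stable f H y' -> vlt a y' -> vlt y' b -> y' <> y -> List.In y' L'.
      by move=> h1 h2 h3 ne; apply: List.in_in_remove => //; exact: hL.
    case: (IH a y L' hlen sa sy ay) => [y' h1 h2 h3|X [hX hX']].
      apply: hin => //; first exact: vlt_le_trans h3 (vlt_le yb).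
      by move=> e; subst y'; have := h3 i0; lra.
    case: (IH y b L' hlen sy sb yb) => [y' h1 h2 h3|Y [hY hY']].
      apply: hin => //; first exact: vlt_le_trans ay (vlt_le h2).
      by move=> e; subst y'; have := h2 i0; lra.
    by exists X, Y.
  have am_lt m : P m -> vle a m -> m <> a -> vlt a m.
    move=> hm am ne; apply: (crit_lt HS Phi0 PhiD) => //; [by case: sa | by case: (Pst m hm) | exact: not_eq_sym].
  have [[y [Py [ay yb]]]|noP] := classic (exists y, P y /\ vlt a y /\ vlt y b).
    case: (split_at y (Pst y Py) ay yb) => X [Y [hX hY hX' hY']].
    exists (fun x => X x \/ Y x); split; first exact: arc_cat hX hY.
    move=> m hm am mb; case: (Ptot m y hm Py) => [->|[lt|gt]].
    - by right; exact: (ar_a hY).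
    - by left; exact: hX'.
    - by right; apply: hY' => //; exact: vlt_le.
  (* No point of [P] lies strictly inside any more, so only [a] may have to be hit, and splitting at
     an arbitrary stable point loses nothing. *)
  have onlya m (X : V -> Prop) : X a -> P m -> vle a m -> vlt m b -> X m.
    move=> Xa hm am mb; have [->|ne] := classic (m = a) => //.
    by case: noP; exists m; split=> //; split=> //; exact: am_lt.
  have [[y [sy [ay yb]]]|noS] := classic (exists y, stable f H y /\ vlt a y /\ vlt y b).
    case: (split_at y sy ay yb) => X [Y [hX hY hX' hY']].
    exists (fun x => X x \/ Y x); split; first exact: arc_cat hX hY.
    by move=> m hm am mb; apply: (onlya m (fun x => X x \/ Y x)) => //; left; exact: (ar_a hX).
  have hg : gap f H a b.
    split=> // y sy ay yb.
    have [->|na] := classic (y = a); first by left.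
    have [->|nb] := classic (y = b); first by right.
    case: noS; exists y; split=> //; split.
      by apply: (crit_lt HS Phi0 PhiD) => //; [case: sa | case: sy | move=> e; exact: na].
    by apply: (crit_lt HS Phi0 PhiD) => //; [case: sy | case: sb].
  case: (gap_arc hg) => X hX; exists X; split=> // m hm am mb.
  by apply: (onlya m X) => //; exact: (ar_a hX).
move=> a b sa sb ab; case: (finite_crit i0 HS HM a b) => L hL.
by apply: (main (length L) a b L) => // y [cy _] /vlt_le ay /vlt_le yb; exact: hL.
Qed.

Definition minimizer m := forall y, W m <= W y.

Lemma min_crit m : minimizer m -> crit m.
Proof. by move=> h; apply: (W_stat HS Phi0 PhiD); exact: h. Qed.

(** Otherwise the positive eigenvector would be a direction of decreasing energy. *)
Lemma min_stable m : minimizer m -> stable f H m.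
Proof.
move=> h; have cm := min_crit h; case: (stable_or_unstable i0 HS HM cm) => // -[_ [lam [e [g [hp l0]]]]].
case: (hp) => _ ep _ ee _.
have De : 0 < dot e e by apply: (@dot_gt0 _ _ i0); have := ep i0; lra.
have p : 0 < - (lam * dot e e) by nra.
case: (@W_below I W f H C HS m _ (nrm e) cm p) => d [d0 hd].
have := hd e (d / 2) ltac:(lra) ltac:(lra); have := h (fun j => m j + d / 2 * e j).
move=> h1 h2; have : W (fun j => m j + d / 2 * e j) < W m; last lra.
apply: h2; have -> : Mop (H m) e = fun i => lam * e i by apply: functional_extensionality.
rewrite dotZr; lra.
Qed.

(** With [m] the minimum, [p = x - m] and [q = y - m] have disjoint supports, so the mixed second
    difference along them sees only off-diagonal Hessian entries, which are nonpositive. *)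
Lemma submodular x y : W (fun i => Rmin (x i) (y i)) + W (fun i => Rmax (x i) (y i)) <= W x + W y.
Proof.
pose m i := Rmin (x i) (y i); pose p i := x i - m i; pose q i := y i - m i.
have p0 i : 0 <= p i by rewrite /p /m; have := Rmin_l (x i) (y i); lra.
have q0 i : 0 <= q i by rewrite /q /m; have := Rmin_r (x i) (y i); lra.
have pq i : p i = 0 \/ q i = 0.
  by rewrite /p /q /m /Rmin; case: Rle_dec => _; [left | right]; ring.
have hd s : derivable_pt_lim (fun s => W (fun i => x i + s * q i) - W (fun i => m i + s * q i)) s
     (- dot (f (fun i => x i + s * q i)) q - - dot (f (fun i => m i + s * q i)) q).
  by apply: derivable_pt_lim_minus; exact: (W_line HS).
case: (@mvt _ _ 0 1 (fun c _ => hd c)) => s [hs _].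
have e1 : (fun i => x i + 1 * q i) = (fun i => Rmax (x i) (y i)).
  by apply: functional_extensionality => i; rewrite /q /m /Rmin /Rmax; case: Rle_dec => _; ring.
have e2 : (fun i => m i + 1 * q i) = y.
  by apply: functional_extensionality => i; rewrite /q; ring.
have e3 (z : V) : (fun i => z i + 0 * q i) = z.
  by apply: functional_extensionality => i; ring.
rewrite e1 e2 !e3 in hs.
suff : 0 <= dot (f (fun i => x i + s * q i)) q - dot (f (fun i => m i + s * q i)) q.
  by rewrite -/m; lra.
rewrite -dotBl; apply: bsum_ge0 => i _.
case: (f_mvt HS (fun i => m i + s * q i) (fun i => x i + s * q i) i) => r [_ ->].
rewrite -bsum_opp (Rmult_comm _ (q i)) -bsum_scal; apply: bsum_ge0 => j _.
rewrite (_ : x j + s * q j - (m j + s * q j) = p j); last by rewrite /p; ring.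
have [->|/eqP ne] := eqVneq i j.
  by case: (pq j) => ->; lra.
have := gs_off HS (seg (fun i => m i + s * q i) (fun i => x i + s * q i) r) ne.
have := p0 j; have := q0 i => k1 k2 k3.
have := Rmult_le_pos _ _ k1 k2; nra.
Qed.

(** By submodularity the componentwise minimum is again a minimizer. If it differed from both,
    strong monotonicity would put it strictly below both in every coordinate, where it equals one of
    them. *)
Lemma min_total m m' : minimizer m -> minimizer m' -> m = m' \/ vlt m m' \/ vlt m' m.
Proof.
move=> h h'.
pose l : V := fun i => Rmin (m i) (m' i).
have hl : minimizer l.
  move=> y; have := submodular m m'; rewrite -/l.
  by have := h' (fun i => Rmax (m i) (m' i)); have := h y; lra.
have lm : vle l m by move=> i; exact: Rmin_l.
have lm' : vle l m' by move=> i; exact: Rmin_r.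
have [e|ne] := classic (l = m).
  have [e'|ne'] := classic (l = m'); first by left; rewrite -e.
  right; left; rewrite -e; apply: (crit_lt HS Phi0 PhiD) => //; exact: min_crit.
have [e'|ne'] := classic (l = m').
  right; right; rewrite -e'; apply: (crit_lt HS Phi0 PhiD) => //; exact: min_crit.
have h1 := crit_lt HS Phi0 PhiD (min_crit hl) (min_crit h) lm ne.
have h2 := crit_lt HS Phi0 PhiD (min_crit hl) (min_crit h') lm' ne'.
have := h1 i0; have := h2 i0; rewrite /l /Rmin; case: Rle_dec => _; lra.
Qed.

Lemma min_exists : (forall M, exists K, forall x, W x <= M -> forall i j, Rabs (x i - x j) <= K) ->
  (forall x (n : Z), W (fun i => x i + IZR n) = W x) -> exists m, minimizer m.
Proof.
move=> hco hper; case: (hco (W (fun _ => 0))) => K hK.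
(* Integer translations bring one coordinate into [[0, 1]], and coercivity bounds the differences,
   so this sublevel set is compact and still meets every relevant orbit of translations. *)
case: (@seq_min I (fun x => W x <= W (fun _ => 0) /\ 0 <= x i0 <= 1) W (K + 1)).
- by exists (fun _ => 0); split; lra.
- move=> x i [/hK /(_ i i0) /Rabs_bnd h1 h2]; apply: Rabs_le; lra.
- move=> u l hu hl; split.
    by apply: seq_lim_le (W_vlim HS hl) _; exists 0%nat => n _; case: (hu n).
  split; first by apply: seq_lim_ge (hl i0) _; exists 0%nat => n _; case: (hu n); lra.
  by apply: seq_lim_le (hl i0) _; exists 0%nat => n _; case: (hu n); lra.
- by move=> u l; exact: (W_vlim HS).
move=> m [[m1 m2] hm]; exists m => y.
have [lt|ge] := Rlt_le_dec (W (fun _ => 0)) (W y); first lra.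
have [b1 b2] := base_Int_part (y i0).
rewrite -(hper y (- Int_part (y i0))%Z); apply: hm; rewrite hper; split=> //.
rewrite opp_IZR; lra.
Qed.
End Arcs.

(** * Symmetries: permutation of the sites followed by a translation *)

Record symm (I : finType) (W : (I -> R) -> R) (f : (I -> R) -> I -> R)
    (T : (I -> R) -> I -> R) (th : I -> I) (gm : I -> R) : Prop := Symm {
  sy_inj : injective th;
  sy_T : forall x, T x = fun i => x (th i) + gm i;
  sy_f : forall x i, f (T x) i = f x (th i);
  sy_W : forall x, W (T x) = W x }.

Section Sym.
Variables (I : finType) (i0 : I) (W : (I -> R) -> R) (f : (I -> R) -> I -> R).
Variables (H : (I -> R) -> I -> I -> R) (C : R).
Hypothesis HS : gsys W f H C.
Local Notation V := (I -> R).
Implicit Types x y z v w : V.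
Variable Phi : R -> V -> V.
Hypothesis Phi0 : forall x, Phi 0 x = x.
Hypothesis PhiD : forall x t i, derivable_pt_lim (fun t => Phi t x i) t (f (Phi t x) i).
Variables (T : V -> V) (th : I -> I) (gm : I -> R).
Hypothesis HT : symm W f T th gm.
Let thi := sy_inj HT.

Lemma sum_perm (F : V) : \rsum_i F (th i) = \rsum_i F i.
Proof. by rewrite [RHS](reindex_inj thi). Qed.

Lemma sy_sg x : sg (T x) = sg x + sg gm.
Proof. by rewrite (sy_T HT) sgD /sg (sum_perm x). Qed.

Lemma sy_le x y : vle x y -> vle (T x) (T y).
Proof. by rewrite !(sy_T HT) => h i; have := h (th i); lra. Qed.
Lemma sy_lt x y : vlt x y -> vlt (T x) (T y).
Proof. by rewrite !(sy_T HT) => h i; have := h (th i); lra. Qed.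

Lemma th_surj j : exists i, j = th i.
Proof. by exists (invF thi j); rewrite f_invF. Qed.

Lemma sy_dot v w : dot (fun i => v (th i)) (fun i => w (th i)) = dot v w.
Proof. exact: (sum_perm (fun i => v i * w i)). Qed.

Lemma sy_sg_lin v : sg (fun i => v (th i)) = sg v.
Proof. exact: sum_perm. Qed.

(** Only the equivariance of [f] is assumed; that of its derivative follows by uniqueness of
    directional derivatives. *)
Lemma sy_H x v i : Mop (H (T x)) (fun j => v (th j)) i = Mop (H x) v (th i).
Proof.
have h1 := gs_f HS (T x) (fun j => v (th j)) i.
have h2 := gs_f HS x v (th i).
have h3 : derivable_pt_lim (fun s => f (fun j => T x j + s * v (th j)) i) 0 (- \rsum_j (H x (th i) j * v j)).
  apply: derivable_pt_lim_eqf h2 => s; rewrite -(sy_f HT); congr (f _ _).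
  by apply: functional_extensionality => j; rewrite !(sy_T HT); ring.
by have := uniqueness_limite _ _ _ _ h1 h3; rewrite /Mop; lra.
Qed.

Lemma sy_crit x : crit f x <-> crit f (T x).
Proof.
split=> h i; first by rewrite (sy_f HT).
by case: (th_surj i) => j ->; rewrite -(sy_f HT).
Qed.

Lemma sy_Phi t x : Phi t (T x) = T (Phi t x).
Proof.
have h : solution f (fun t => T (Phi t x)).
  move=> s i; rewrite (sy_f HT).
  apply: (@derivable_pt_lim_eqf (fun s => Phi s x (th i) + gm i)) => [r|]; first by rewrite (sy_T HT).
  rewrite -(Rplus_0_r (f _ _)); apply: derivable_pt_lim_plus; [exact: PhiD | exact: derivable_pt_lim_const].
by rewrite (Phi_sol HS Phi0 PhiD h) Phi0.
Qed.

Lemma sy_pull v : exists v', v = fun i => v' (th i).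
Proof. by exists (fun i => v (invF thi i)); apply: functional_extensionality => i; rewrite invF_f. Qed.

Lemma sy_Q x v : dot (fun i => v (th i)) (Mop (H (T x)) (fun i => v (th i))) = dot v (Mop (H x) v).
Proof.
rewrite -[RHS]sy_dot; congr (dot _ _); apply: functional_extensionality => i; exact: sy_H.
Qed.

Lemma sy_perron x lam e g : perron_data (H x) lam e g -> perron_data (H (T x)) lam (fun i => e (th i)) g.
Proof.
move=> [g0 ep se ee [h1 h2]]; split=> //.
- by rewrite sy_sg_lin.
- by move=> i; rewrite sy_H.
split=> v; case: (sy_pull v) => v' ->; rewrite /Q sy_Q !sy_dot; first exact: h1.
exact: h2.
Qed.

Lemma sy_goodcrit x : goodcrit f H x -> goodcrit f H (T x).
Proof.
move=> [[c [lam [e [g [hp l0]]]]]|[c [lam [e [g [hp l0 hq]]]]]]; [left|right].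
  split; first exact: (sy_crit x).1.
  by exists lam, (fun i => e (th i)), g; split=> //; exact: sy_perron.
split; first exact: (sy_crit x).1.
exists lam, (fun i => e (th i)), g; split=> //; first exact: sy_perron.
by move=> v; case: (sy_pull v) => v' ->; rewrite sy_Q sy_dot; exact: hq.
Qed.

Lemma sy_tlim_m (x : R -> V) l : tlim_m x l -> tlim_m (fun t => T (x t)) (T l).
Proof.
move=> h e he; case: (h e he) => T0 hT; exists T0 => t ht i.
by have := hT t ht (th i); rewrite !(sy_T HT) (_ : _ + _ - _ = x t (th i) - l (th i)) //; ring.
Qed.
Lemma sy_tlim_p (x : R -> V) l : tlim_p x l -> tlim_p (fun t => T (x t)) (T l).
Proof.
move=> h e he; case: (h e he) => T0 hT; exists T0 => t ht i.
by have := hT t ht (th i); rewrite !(sy_T HT) (_ : _ + _ - _ = x t (th i) - l (th i)) //; ring.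
Qed.

Lemma sy_T_inj x y : T x = T y -> x = y.
Proof.
move=> h; apply: functional_extensionality => i; case: (th_surj i) => j ->.
have : T x j = T y j by rewrite h.
rewrite !(sy_T HT); lra.
Qed.

Lemma sy_good x : good f H Phi x -> good f H Phi (T x).
Proof.
move=> [h|[nc [a [b [ne [ga [gb [h1 h2]]]]]]]]; first by left; exact: sy_goodcrit.
right; split; first by move=> hc; apply: nc; exact: (sy_crit x).2.
exists (T a), (T b); split; first by move/sy_T_inj.
split; first exact: sy_goodcrit.
split; first exact: sy_goodcrit.
have e : (fun t => Phi t (T x)) = (fun t => T (Phi t x)).
  by apply: functional_extensionality => t; exact: sy_Phi.
by rewrite e; split; [exact: sy_tlim_m | exact: sy_tlim_p].
Qed.

Lemma sy_isU x u : isU f H x u <-> isU f H (T x) (fun i => u (th i)).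
Proof.
have sf : sg (f (T x)) = sg (f x).
  by rewrite -(sy_sg_lin (f x)) /sg; apply: eq_bigr => i _; rewrite (sy_f HT).
rewrite /isU sy_sg_lin sf; split=> -[s1 h]; split=> //; case: h => [[h1 h2]|[h1 [h2 [l h3]]]].
- by left; split; [move=> hc; apply: h1; exact: (sy_crit x).2 | move=> i; rewrite (sy_f HT)].
- right; split; first exact: (sy_crit x).1.
  by split=> //; exists l => i; rewrite sy_H.
- left; split; first by move=> hc; apply: h1; exact: (sy_crit x).1.
  by move=> i; case: (th_surj i) => j ->; rewrite -(sy_f HT).
- right; split; first exact: (sy_crit x).2.
  split; first by move=> i; case: (th_surj i) => j ->.
  by exists l => i; case: (th_surj i) => j ->; rewrite -sy_H.
Qed.

Lemma sy_side rho (G : V -> Prop) x : (forall y, G y -> exists y0, G y0 /\ y = T y0) ->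
  side f H rho G x -> side f H rho G (T x).
Proof.
move=> hG [u [hu h]]; exists (fun i => u (th i)); split; first exact: (sy_isU x u).1.
move=> eps he; case: (h eps he) => d [d0 hd]; exists d; split=> // y Gy.
case: (hG y Gy) => y0 [Gy0 ->]; rewrite !sy_sg (_ : sg y0 + sg gm - (sg x + sg gm) = sg y0 - sg x); last ring.
move=> hy; case: (hd y0 Gy0 hy) => h1 h2; split=> [i|u' hu' i].
  have := h1 (th i); rewrite !(sy_T HT).
  by rewrite (_ : y0 (th i) + gm i - (x (th i) + gm i) = y0 (th i) - x (th i)) //; ring.
case: (sy_pull u') => u0 e; rewrite e; apply: h2; apply: (sy_isU y0 u0).2; by rewrite -e.
Qed.

Lemma sy_minimizer m : minimizer W m -> (forall y, exists y0, y = T y0) -> minimizer W (T m).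
Proof. by move=> h hs y; case: (hs y) => y0 ->; rewrite !(sy_W HT). Qed.
End Sym.

(** * Periodic union of an arc and its parametrisation by the sum *)

Section Core.
Variables (I : finType) (i0 : I) (W : (I -> R) -> R) (f : (I -> R) -> I -> R).
Variables (H : (I -> R) -> I -> I -> R) (C : R).
Hypothesis HS : gsys W f H C.
Local Notation V := (I -> R).
Implicit Types x y z v w : V.
Variable Phi : R -> V -> V.
Hypothesis Phi0 : forall x, Phi 0 x = x.
Hypothesis PhiD : forall x t i, derivable_pt_lim (fun t => Phi t x i) t (f (Phi t x) i).
Hypothesis HM : nondeg f H.
Hypothesis Hco : forall M, exists K, forall x, W x <= M -> forall i j, Rabs (x i - x j) <= K.
Hypothesis Hper : forall x (n : Z), W (fun i => x i + IZR n) = W x.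
Variable A : Z -> V -> V.
Hypothesis A0 : forall x, A 0%Z x = x.
Hypothesis AD : forall m n x, A (m + n)%Z x = A m (A n x).
Hypothesis Asym : forall n, exists th gm, symm W f (A n) th gm.
Variable c : R.
Hypothesis c0 : 0 < c.
Hypothesis Asg : forall n x, sg (A n x) = sg x + IZR n * c.

Lemma AK n x : A (- n)%Z (A n x) = x.
Proof. by rewrite -AD Z.add_opp_diag_l A0. Qed.
Lemma AVK n x : A n (A (- n)%Z x) = x.
Proof. by rewrite -AD Z.add_opp_diag_r A0. Qed.

Lemma floor_c s b : exists n : Z, b <= s + IZR n * c < b + c.
Proof.
have [h1 h2] := base_Int_part ((s - b) / c).
exists (- Int_part ((s - b) / c))%Z; rewrite opp_IZR.
have e : (s - b) / c * c = s - b by field; lra.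
nra.
Qed.

Section Union.
Variables (a : V) (X : V -> Prop).
Hypothesis hX : arc f H Phi a (A 1%Z a) X.
Definition Gam x := exists n, X (A n x).

Lemma Gam_sub x : X x -> Gam x.
Proof. by exists 0%Z; rewrite A0. Qed.

Lemma X_sg x : X x -> sg a <= sg x < sg a + c.
Proof. by move=> /(arc_sg i0 hX); rewrite Asg; lra. Qed.

Lemma Gam_X x : Gam x -> sg a <= sg x < sg a + c -> X x.
Proof.
move=> [n hn] hx; have := X_sg hn; rewrite Asg => h.
suff -> : x = A n x by [].
have : (n = 0)%Z; last by move=> ->; rewrite A0.
have h1 : IZR n < 1 by nra.
have h2 : -1 < IZR n by nra.
have := lt_IZR n 1 h1; have := lt_IZR (-1) n h2; lia.
Qed.

Lemma Gam_A n x : Gam x -> Gam (A n x).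
Proof. by move=> [m hm]; exists (m - n)%Z; rewrite -AD; have -> : (m - n + n = m)%Z by lia. Qed.

Lemma A_up (k : nat) : vle a (A (Z.of_nat k) a).
Proof.
elim: k => [|k IH]; first by rewrite A0; exact: vle_refl.
rewrite Nat2Z.inj_succ -Z.add_1_r Z.add_comm AD.
case: (Asym 1%Z) => th [gm hs].
by apply: vle_trans (vlt_le (arc_ab hX)) _; exact: (sy_le hs).
Qed.

Lemma Gam_lt x y : Gam x -> Gam y -> sg x < sg y -> vlt x y.
Proof.
move=> Gx Gy hs.
case: (floor_c (sg x) (sg a)) => n hn; rewrite -Asg in hn.
have Xx := Gam_X (Gam_A n Gx) hn.
case: (Asym (- n)%Z) => th [gm hsy].
rewrite -(AK n x) -(AK n y); apply: (sy_lt hsy).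
have hs' : sg (A n x) < sg (A n y) by rewrite !Asg; lra.
case: (floor_c (sg (A n y)) (sg a)) => m hm; rewrite -Asg in hm.
have Xy := Gam_X (Gam_A m (Gam_A n Gy)) hm.
have m0 : (m <= 0)%Z.
  rewrite Asg in hm; have h1 : IZR m < 1 by nra.
  have := lt_IZR m 1 h1; lia.
have [e|ne] := Z.eq_dec m 0.
  by apply: (ar_lt hX) => //; rewrite e A0 in Xy.
have [k ek] : exists k : nat, (- m = 1 + Z.of_nat k)%Z.
  by exists (Z.to_nat (- m - 1)); rewrite Z2Nat.id; lia.
have h1 : vlt (A n x) (A 1%Z a) by case: (ar_box hX Xx).
apply: (vlt_le_trans h1).
have h2 : vle (A 1%Z a) (A 1%Z (A (Z.of_nat k) a)).
  by case: (Asym 1%Z) => th1 [gm1 hs1]; apply: (sy_le hs1); exact: A_up.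
apply: (vle_trans h2); rewrite -AD -ek.
have h3 : vle a (A m (A n y)).
  by case: (ar_box hX Xy) => -[->|/vlt_le] // _; exact: vle_refl.
by case: (Asym (- m)%Z) => th2 [gm2 hs2]; have := sy_le hs2 h3; rewrite AK.
Qed.

Lemma Gam_eq x y : Gam x -> Gam y -> sg x = sg y -> x = y.
Proof.
move=> Gx Gy hs.
case: (floor_c (sg x) (sg a)) => n; rewrite -Asg => hn.
have Xx := Gam_X (Gam_A n Gx) hn.
have Xy : X (A n y) by apply: Gam_X; [exact: Gam_A | rewrite Asg -hs -Asg].
rewrite -(AK n x) -(AK n y); congr (A _ _); apply: (ar_eq hX) => //.
by rewrite !Asg hs.
Qed.

Lemma Gam_surj s : exists x, Gam x /\ sg x = s.
Proof.
case: (floor_c s (sg a)) => n hn.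
case: (ar_surj hX (s := s + IZR n * c)); first by rewrite Asg; lra.
move=> x [h1 h2]; exists (A (- n)%Z x); split; first exact/Gam_A/Gam_sub.
by rewrite Asg h2 opp_IZR; ring.
Qed.

Lemma Gam_flow t x : Gam x -> Gam (Phi t x).
Proof.
move=> [n hn]; exists n; case: (Asym n) => th [gm hs].
by rewrite -(sy_Phi HS Phi0 PhiD hs); exact: (ar_flow hX).
Qed.

Lemma Gam_good x : Gam x -> good f H Phi x.
Proof.
move=> [n hn]; case: (Asym (- n)%Z) => th [gm hs].
by rewrite -(AK n x); apply: (sy_good HS Phi0 PhiD hs); exact: (ar_good hX).
Qed.

Lemma Gam_side x rho : Gam x -> rho = 1 \/ rho = -1 -> side f H rho Gam x.
Proof.
have pull n y : Gam y -> exists y0, Gam y0 /\ y = A n y0.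
  by move=> Gy; exists (A (- n)%Z y); rewrite AVK; split=> //; exact: Gam_A.
have red n y : side f H rho Gam (A n y) -> side f H rho Gam y.
  move=> h; rewrite -(AK n y); case: (Asym (- n)%Z) => th [gm hs].
  by apply: (sy_side HS hs) => //; exact: pull.
move=> [n hn] hr; apply: (red n); set y := A n x in hn *.
have hy := X_sg hn.
case: hr red => -> red.
  apply: side_ext (ar_side1 hX hn); exists (sg a + c - sg y); split; first lra.
  by move=> z Gz hz; apply: Gam_X => //; lra.
have [e|ne] := classic (y = a).
  rewrite e; apply: (red 1%Z); apply: side_ext (ar_sideb hX).
  exists c; split=> // z Gz; rewrite Asg => hz; apply: Gam_X => //; lra.
apply: side_ext (ar_side2 hX hn ne); exists (sg y - sg a); split.
  by case: (ar_box hX hn) => -[|/(vlt_sg i0)] //; lra.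
by move=> z Gz hz; apply: Gam_X => //; lra.
Qed.
End Union.

Lemma ghost_core : exists gam dgam : R -> V,
  (forall s, sg (gam s) = s) /\
  (forall i s, derivable_pt_lim (fun u => gam u i) s (dgam s i)) /\
  (forall i, continuity (fun s => dgam s i)) /\
  (forall s, sg (dgam s) = 1) /\
  (forall s s', s < s' -> vlt (gam s) (gam s')) /\
  (forall n s, exists s', A n (gam s) = gam s') /\
  (forall t s, exists s', Phi t (gam s) = gam s') /\
  (forall m, minimizer W m -> exists s, gam s = m) /\
  (forall s, good f H Phi (gam s)).
Proof.
case: (min_exists i0 HS Hco Hper) => a mina.
have Amin n m : minimizer W m -> minimizer W (A n m).
  case: (Asym n) => th [gm hs] hm; apply: (sy_minimizer hs hm) => y.
  by exists (A (- n)%Z y); rewrite AVK.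
have tot := min_total i0 HS Phi0 PhiD.
have ab : vlt a (A 1%Z a).
  have sl : sg a < sg (A 1%Z a) by rewrite Asg; lra.
  case: (tot a (A 1%Z a) mina (Amin 1%Z a mina)) => [e|[//|/(vlt_sg i0)]]; last lra.
  by rewrite -e in sl; lra.
have mst := min_stable i0 HS Phi0 PhiD HM.
case: (chain i0 HS Phi0 PhiD HM mst tot (mst a mina) (mst _ (Amin 1%Z a mina)) ab) => X [hX hmin].
have hs s := Gam_surj hX s.
pose gam s := proj1_sig (constructive_indefinite_description _ (hs s)).
have gamP s : Gam X (gam s) /\ sg (gam s) = s.
  by rewrite /gam; case: constructive_indefinite_description.
have gamE x : Gam X x -> gam (sg x) = x.
  by move=> Gx; apply: (Gam_eq hX) => //; case: (gamP (sg x)).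
have h1 s : side f H 1 (Gam X) (gam s).
  by apply: (Gam_side hX); [case: (gamP s) | left].
have h2 s : side f H (-1) (Gam X) (gam s).
  by apply: (Gam_side hX); [case: (gamP s) | right].
have both s : exists u, isU f H (gam s) u /\ forall eps, 0 < eps -> exists d, 0 < d /\ forall r, r <> s -> Rabs (r - s) < d ->
    (forall i, Rabs (gam r i - gam s i - (r - s) * u i) <= eps * Rabs (r - s)) /\
    (forall u', isU f H (gam r) u' -> forall i, Rabs (u' i - u i) <= eps).
  case: (h1 s) => u [hu k1]; case: (h2 s) => u2 [hu2 k2].
  have eu := isU_unique i0 HS hu hu2; subst u2.
  exists u; split=> // eps he; case: (k1 eps he) => d1 [d10 hd1]; case: (k2 eps he) => d2 [d20 hd2].
  exists (Rmin d1 d2); split=> [|r ne hr]; first exact: Rmin_glb_lt.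
  have r1 := Rlt_le_trans _ _ _ hr (Rmin_l _ _).
  have r2 := Rlt_le_trans _ _ _ hr (Rmin_r _ _).
  case: (gamP r) => Gr sr; case: (gamP s) => Gs ss.
  move: (hd1 (gam r) Gr) (hd2 (gam r) Gr); rewrite sr ss.
  have [lt|[e|gt]] := Rtotal_order s r.
  - by move=> + _; apply; rewrite Rabs_pos_eq in r1; lra.
  - by case: ne.
  - by move=> _; apply; rewrite Rabs_left in r2; lra.
pose dgam s := proj1_sig (constructive_indefinite_description _ (both s)).
have dgamP s : isU f H (gam s) (dgam s) /\ forall eps, 0 < eps -> exists d, 0 < d /\ forall r, r <> s -> Rabs (r - s) < d ->
    (forall i, Rabs (gam r i - gam s i - (r - s) * dgam s i) <= eps * Rabs (r - s)) /\
    (forall u', isU f H (gam r) u' -> forall i, Rabs (u' i - dgam s i) <= eps).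
  by rewrite /dgam; case: constructive_indefinite_description.
exists gam, dgam; do !split.
- by move=> s; case: (gamP s).
- move=> i s eps he; case: (dgamP s) => _ /(_ (eps / 2)) [|d [d0 hd]]; first lra.
  exists (mkposreal d d0) => h h0 /= hh.
  have hsh : s + h - s = h by ring.
  case: (hd (s + h)); [lra | by rewrite hsh|] => k _; have := k i; rewrite hsh => k1.
  have ah := Rabs_pos_lt h h0.
  have -> : (gam (s + h) i - gam s i) / h - dgam s i = (gam (s + h) i - gam s i - h * dgam s i) / h by field.
  rewrite /Rdiv Rabs_mult Rabs_inv; apply: (Rmult_lt_reg_r (Rabs h)) => //.
  rewrite Rmult_assoc Rinv_l; nra.
- move=> i s; apply/continuity_pt_eps => eps he; case: (dgamP s) => _ /(_ (eps / 2)) [|d [d0 hd]]; first lra.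
  exists d; split=> // r hr; have [->|ne] := Req_dec r s; first by rewrite Rminus_diag Rabs_R0.
  case: (hd r ne hr) => _ k; case: (dgamP r) => /k /(_ i); lra.
- by move=> s; case: (dgamP s) => -[].
- by move=> s s' lt; case: (gamP s) => G1 s1; case: (gamP s') => G2 s2; apply: (Gam_lt hX) => //; lra.
- by move=> n s; exists (sg (A n (gam s))); rewrite gamE //; apply: Gam_A; case: (gamP s).
- by move=> t s; exists (sg (Phi t (gam s))); rewrite gamE //; apply: (Gam_flow hX); case: (gamP s).
- move=> m hm; exists (sg m); apply: gamE.
  case: (floor_c (sg m) (sg a)) => n; rewrite -Asg => hn; exists n.
  case: (tot a (A n m) mina (Amin n m hm)) => [<-|[lt|/(vlt_sg i0)]]; last lra.
    exact: (ar_a hX).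
  apply: hmin; [exact: Amin | exact: vlt_le |].
  case: (tot (A n m) (A 1%Z a) (Amin n m hm) (Amin _ _ mina)) => [e|[//|/(vlt_sg i0)]].
    by rewrite e Asg in hn; lra.
  by rewrite (Asg 1%Z); lra.
- by move=> s; apply: (Gam_good hX); case: (gamP s).
Qed.
End Core.

(** * Periodic configurations *)

Section Directional.
Variable d : nat.
Implicit Types (x y v : Config d) (L M : seq (Zd d)).

Definition shiftby x (s : R) v : Config d := fun k => x k + s * v k.
Definition near_on L x y (e : R) := forall k, k \in L -> Rabs (y k - x k) < e.

Lemma dirderiv (F : Config d -> R) (G : Zd d -> Config d -> R) L x v : uniq L ->
  (forall y z : Config d, (forall k, k \in L -> y k = z k) -> F y = F z) ->
  (forall i, is_partial F i (G i)) ->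
  (forall i e, 0 < e -> exists del, 0 < del /\ forall y, near_on L x y del -> Rabs (G i y - G i x) < e) ->
  derivable_pt_lim (fun s => F (shiftby x s v)) 0 (\big[Rplus/R0]_(i <- L) (G i x * v i)).
Proof.
move=> uL hdep hpart hcont.
pose part M (s : R) : Config d := fun k => if k \in M then x k + s * v k else x k.
have key M : uniq M -> derivable_pt_lim (fun s => F (part M s)) 0 (\big[Rplus/R0]_(i <- M) (G i x * v i)).
  elim: M => [_|a M IH /andP[aM uM]].
    rewrite big_nil; apply: (@derivable_pt_lim_eqf (fct_cte (F x))); last exact: derivable_pt_lim_const.
    by move=> s.
  rewrite big_cons Rplus_comm.
  apply: (@derivable_pt_lim_eqf (plus_fct (fun s => F (part M s)) (fun s => F (part (a :: M) s) - F (part M s)))).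
    by move=> s; rewrite /plus_fct; ring.
  apply: derivable_pt_lim_plus; first exact: IH.
  move=> e he.
  have va : 0 < Rabs (v a) + 1 by have := Rabs_pos (v a); lra.
  case: (hcont a (e / (Rabs (v a) + 1))) => [|del [del0 hdel]]; first exact: Rdiv_lt_0_compat.
  pose B := \big[Rplus/R0]_(i <- L) Rabs (v i) + Rabs (v a) + 1.
  have vB i : i \in L -> Rabs (v i) < B.
    move=> iL.
    have e1 : \big[Rplus/R0]_(i <- L) Rabs (v i) = Rabs (v i) + \big[Rplus/R0]_(y <- rem i L) Rabs (v y).
      by rewrite (big_rem i iL).
    have : 0 <= \big[Rplus/R0]_(y <- rem i L) Rabs (v y) by apply: bsum_ge0 => j _; exact: Rabs_pos.
    by have := Rabs_pos (v a); rewrite /B e1; lra.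
  have B0 : 0 < B.
    have : 0 <= \big[Rplus/R0]_(i <- L) Rabs (v i) by apply: bsum_ge0 => j _; exact: Rabs_pos.
    by rewrite /B; have := Rabs_pos (v a); lra.
  exists (mkposreal (del / B) (Rdiv_lt_0_compat _ _ del0 B0)) => h h0 /= hh.
  have hB : Rabs h * B < del.
    have := Rmult_lt_compat_r B _ _ B0 hh; by rewrite (_ : del / B * B = del); last by field; lra.
  have ea s : part (a :: M) s = upd (part M s) a (x a + s * v a).
    apply: functional_extensionality => k; rewrite /part /upd inE; case: eqP => [->|] //.
  have eb s : part M s = upd (part M s) a (x a).
    apply: functional_extensionality => k; rewrite /part /upd; case: eqP => [->|] //.
    by rewrite (negbTE aM).
  have hd c : derivable_pt_lim (fun c => F (upd (part M h) a c)) c (G a (upd (part M h) a c)).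
    have := hpart a (upd (part M h) a c); rewrite (_ : upd (part M h) a c a = c); last by rewrite /upd eqxx.
    apply: derivable_pt_lim_eqf => t; congr (F _).
    by apply: functional_extensionality => k; rewrite /upd; case: eqP.
  case: (@mvt _ _ (x a) (x a + h * v a) (fun c _ => hd c)) => c [hc1 hc2].
  rewrite -ea -eb in hc1.
  have -> : part (a :: M) (0 + h) = part (a :: M) h by rewrite Rplus_0_l.
  have -> : part M (0 + h) = part M h by rewrite Rplus_0_l.
  have z0 : part (a :: M) 0 = part M 0.
    by apply: functional_extensionality => k; rewrite /part; do 2!case: ifP => _; ring.
  rewrite z0 Rminus_diag hc1.
  have -> : (G a (upd (part M h) a c) * (x a + h * v a - x a) - 0) / h - G a x * v a =
     (G a (upd (part M h) a c) - G a x) * v a by field.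
  rewrite Rabs_mult.
  have hG : Rabs (G a (upd (part M h) a c) - G a x) < e / (Rabs (v a) + 1).
    apply: hdel => k kL; rewrite /upd /part; case: eqP => [->|_].
      apply: Rle_lt_trans hB.
      have : Rabs (c - x a) <= Rabs h * Rabs (v a).
        rewrite -Rabs_mult; move: hc2; rewrite /Rmin /Rmax; case: Rle_dec => ? ?.
          by rewrite !Rabs_pos_eq; lra.
        by rewrite !Rabs_left1; lra.
      have : Rabs (v a) <= B.
        have : 0 <= \big[Rplus/R0]_(i <- L) Rabs (v i) by apply: bsum_ge0 => j _; exact: Rabs_pos.
        rewrite /B; lra.
      have := Rabs_pos h; nra.
    case: ifP => _; last by rewrite Rminus_diag Rabs_R0.
    rewrite (_ : x k + h * v k - x k = h * v k) ?Rabs_mult; last ring.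
    apply: Rle_lt_trans hB; apply: Rmult_le_compat_l; first exact: Rabs_pos.
    by apply: Rlt_le; exact: vB.
  have p := Rabs_pos (v a).
  apply: (@Rle_lt_trans _ (e / (Rabs (v a) + 1) * Rabs (v a))).
    by apply: Rmult_le_compat_r; lra.
  apply: (Rmult_lt_reg_r (Rabs (v a) + 1)) => //.
  rewrite (_ : _ * _ * _ = e * Rabs (v a)); [nra | field; lra].
apply: derivable_pt_lim_eqf (key L uL) => s; apply: hdep => k kL.
by rewrite /part kL.
Qed.
End Directional.

Lemma IntR0 : IntR 0%rg = 0. Proof. by []. Qed.
Lemma IntR1 : IntR 1%rg = 1. Proof. by []. Qed.

Lemma IntR_S z : IntR (z + 1)%rg = IntR z + 1.
Proof.
case: z => n.
  have -> : (Posz n + 1)%rg = Posz n.+1 by rewrite -addn1 PoszD.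
  by rewrite /IntR S_INR.
case: n => [|n].
  by rewrite (_ : (Negz 0 + 1)%rg = 0%rg) //= ; lra.
have -> : (Negz n.+1 + 1)%rg = Negz n.
  by rewrite !NegzE -[in LHS]addn1 PoszD GRing.opprD -GRing.addrA GRing.addNr GRing.addr0.
by rewrite /IntR (S_INR n.+1); lra.
Qed.

Lemma IntRD a b : IntR (a + b)%rg = IntR a + IntR b.
Proof.
elim/int_rect: b => [|n IH|n IH]; first by rewrite GRing.addr0 IntR0 Rplus_0_r.
  by rewrite -addn1 PoszD GRing.addrA !IntR_S IH; ring.
have e z : IntR (z - 1)%rg = IntR z - 1.
  have := IntR_S (z - 1)%rg; rewrite GRing.subrK => ->; ring.
by rewrite -addn1 PoszD GRing.opprD GRing.addrA !e IH /Rminus Rplus_assoc.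
Qed.

Lemma lattice_ind d (P : Zd d -> Prop) : P 0%rg -> (forall u v, P u -> P v -> P (u + v)%rg) ->
  (forall a, P (delta_mx ord0 a)) -> (forall a, P (- delta_mx ord0 a)%rg) -> forall u, P u.
Proof.
move=> P0 PD P1 PN u; rewrite (matrix_sum_delta u); apply: big_ind => // i _.
apply: big_ind => // j _; rewrite (ord1 i).
elim/int_rect: (u _ _) => [|n IH|n IH]; first by rewrite GRing.scale0r.
  by rewrite -(addn1 n) PoszD GRing.scalerDl GRing.scale1r; exact: PD.
by rewrite -(addn1 n) PoszD GRing.opprD GRing.scalerDl GRing.scaleN1r; exact: PD.
Qed.

Lemma norm1_0 d : norm1 (0%rg : Zd d) = 0%nat.
Proof. by rewrite /norm1 big1 // => a _; rewrite mxE. Qed.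

Lemma norm1N d (u : Zd d) : norm1 (- u)%rg = norm1 u.
Proof. by rewrite /norm1; apply: eq_bigr => a _; rewrite mxE abszN. Qed.

Lemma norm1_delta d (a : 'I_d) : norm1 (delta_mx ord0 a : Zd d) = 1%nat.
Proof.
rewrite /norm1 (bigD1 a) //= mxE !eqxx /= big1 // => b /negbTE h.
by rewrite mxE h andbF.
Qed.

Lemma norm1_triang d (u v : Zd d) : (norm1 (u + v)%rg <= norm1 u + norm1 v)%nat.
Proof.
rewrite /norm1 -big_split /=; apply: leq_sum => a _; rewrite mxE.
have := leqD_dist (u ord0 a) 0%rg (- v ord0 a)%rg.
by rewrite GRing.opprK GRing.subr0 GRing.add0r.
Qed.

Section Ball.
Variables (d : nat) (r : R).

Definition ball0 : seq (Zd d) :=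
  [seq box_pt (Defs.rad r) f | f <- index_enum {ffun 'I_d -> 'I_(Nat.add (Nat.mul 2 (Defs.rad r)) 1)}
     & Nat.leb (norm1 (box_pt (Defs.rad r) f)) (Defs.rad r)].

Lemma box_pt_inj N : injective (@box_pt d N).
Proof.
move=> f g /rowP h; apply/ffunP => a; apply: val_inj.
have := h a; rewrite !mxE => /(congr1 (fun z => z + N%:Z)%rg); rewrite !GRing.subrK.
by case.
Qed.

Lemma ball0_uniq : uniq ball0.
Proof. by rewrite map_inj_uniq; [rewrite filter_uniq // index_enum_uniq | exact: box_pt_inj]. Qed.

Lemma box_pt_ex N (k : Zd d) : (norm1 k <= N)%nat -> exists f, k = @box_pt d N f.
Proof.
move=> h.
have hb a : (absz (k ord0 a) <= N)%nat.
  by apply: leq_trans h; rewrite /norm1 (bigD1 a) //= leq_addr.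
have hk a : (absz (k ord0 a + N%:Z)%rg < Nat.add (Nat.mul 2 N) 1)%nat.
  have : (Nat.add (Nat.mul 2 N) 1 = (N + N).+1)%nat by rewrite -plusE; lia.
  move=> ->; rewrite ltnS.
  have := leqD_dist (k ord0 a) 0%rg (- N%:Z)%rg.
  rewrite GRing.opprK GRing.subr0 GRing.add0r absz_nat => h'.
  by apply: leq_trans h' _; rewrite leq_add2r.
exists [ffun a => Ordinal (hk a)]; apply/rowP => a; rewrite !mxE ffunE /=.
have p : (0 <= k ord0 a + N%:Z)%rg.
  have := hb a; case: (k ord0 a) => n //= hn.
  rewrite NegzE GRing.addrC Num.Theory.subr_ge0 /=; exact: hn.
by rewrite gez0_abs // GRing.addrK.
Qed.

Lemma mem_ball0 k : (k \in ball0) = (norm1 k <= Defs.rad r)%nat.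
Proof.
apply/mapP/idP => [[f]|h].
  by rewrite mem_filter => /andP[/PeanoNat.Nat.leb_le/leP h _] ->.
case: (box_pt_ex h) => f e; exists f => //.
rewrite mem_filter mem_index_enum andbT -e; exact/PeanoNat.Nat.leb_le/leP.
Qed.

Lemma ball0N : perm_eq [seq (- k)%rg | k <- ball0] ball0.
Proof.
apply: uniq_perm; first by rewrite map_inj_uniq ?ball0_uniq //; exact: GRing.oppr_inj.
  exact: ball0_uniq.
move=> k; apply/mapP/idP => [[k' hk ->]|h]; first by rewrite mem_ball0 norm1N -mem_ball0.
by exists (- k)%rg; rewrite ?GRing.opprK // mem_ball0 norm1N -mem_ball0.
Qed.

Lemma gradWE (dS : Zd d -> Zd d -> Config d -> R) x i :
  gradW r dS x i = \big[Rplus/R0]_(b <- ball0) dS (i + b)%rg i x.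
Proof. by rewrite /ball0 big_map big_filter. Qed.

Lemma rad_le (n : nat) : 0 < r -> (INR n <= r <-> (n <= Defs.rad r)%nat).
Proof.
move=> r0; rewrite /Defs.rad; have [h1 h2] := base_Int_part r.
have ip : (0 <= Int_part r)%Z.
  have h3 : -1 < IZR (Int_part r) by lra.
  by have := lt_IZR (-1) _ h3; lia.
have e : INR (Z.to_nat (Int_part r)) = IZR (Int_part r) by rewrite INR_IZR_INZ Z2Nat.id.
split=> h.
  apply/leP; apply: INR_le.
  have h4 : IZR (Z.of_nat n) < IZR (Int_part r + 1) by rewrite -INR_IZR_INZ plus_IZR; lra.
  rewrite e INR_IZR_INZ; apply: IZR_le; have := lt_IZR _ _ h4; lia.
have : INR n <= INR (Z.to_nat (Int_part r)) by apply: le_INR; exact/leP.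
lra.
Qed.

Definition ballat (j : Zd d) : seq (Zd d) := [seq (j + b)%rg | b <- ball0].

Lemma ballat_uniq j : uniq (ballat j).
Proof. by rewrite map_inj_uniq ?ball0_uniq //; exact: GRing.addrI. Qed.

Lemma mem_ballat j k : 0 < r -> (k \in ballat j) <-> in_ball r j k.
Proof.
move=> r0; rewrite /in_ball rad_le // -mem_ball0 /vsub; split.
  by move/mapP => [b hb ->]; rewrite GRing.addrC GRing.addKr.
by move=> h; apply/mapP; exists (k - j)%rg => //; rewrite GRing.addrC GRing.subrK.
Qed.
End Ball.

Section TauGrad.
Variables (d : nat) (r : R) (S : Zd d -> Config d -> R).
Variables (dS : Zd d -> Zd d -> Config d -> R) (d2S : Zd d -> Zd d -> Zd d -> Config d -> R).
Hypothesis hA : condA r S dS d2S.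
Hypothesis hB : condB S.

Lemma tau_upd (k : Zd d) l x (i : Zd d) h : tau k l (upd x (i + k)%rg h) = upd (tau k l x) i (h + IntR l).
Proof.
apply: functional_extensionality => j; rewrite /tau /upd /vadd.
by rewrite (eqtype.inj_eq (@GRing.addIr _ k)); case: eqP.
Qed.

Lemma dS_tau (j i k : Zd d) l x : dS j i (tau k l x) = dS (j + k)%rg (i + k)%rg x.
Proof.
case: hA => _ [_ [hd _]].
have h1 := hd (j + k)%rg (i + k)%rg x.
have h2 := hd j i (tau k l x).
have h3 : derivable_pt_lim (fun h => S j (upd (tau k l x) i (h + IntR l))) (x (i + k)%rg) (dS j i (tau k l x)).
  by apply: (@derivable_pt_lim_addc (fun h => S j (upd (tau k l x) i h))).
have h4 : derivable_pt_lim (fun h => S j (upd (tau k l x) i (h + IntR l))) (x (i + k)%rg) (dS (j + k)%rg (i + k)%rg x).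
  by apply: derivable_pt_lim_eqf h1 => h; rewrite -tau_upd hB.
exact: uniqueness_limite h3 h4.
Qed.

Lemma gradW_tau k l x i : gradW r dS (tau k l x) i = gradW r dS x (i + k)%rg.
Proof.
rewrite !gradWE; apply: eq_bigr => b _; rewrite dS_tau; congr (dS _ _ _).
by rewrite GRing.addrAC.
Qed.

Lemma cont_ball_dep F (j : Zd d) x y : cont_ball r j F -> (forall k, in_ball r j k -> x k = y k) -> F x = F y.
Proof.
move=> h e; apply: NNPP => ne.
case: (h y (Rabs (F x - F y))) => [|del [d0 hd]]; first exact/Rabs_pos_lt/Rminus_eq_contra.
have := hd x; move=> H; have : Rabs (F x - F y) < Rabs (F x - F y); last lra.
by apply: H => k hk; rewrite e // Rminus_diag Rabs_R0.
Qed.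

Lemma S_dir j x v : derivable_pt_lim (fun s => S j (shiftby x s v)) 0
  (\big[Rplus/R0]_(b <- ball0 d r) (dS j (j + b)%rg x * v (j + b)%rg)).
Proof.
case: hA => r0 [hdep [hd [_ [hc _]]]].
have := @dirderiv d (S j) (dS j) (ballat r j) x v (ballat_uniq r j).
rewrite big_map; apply.
- by move=> y z h; apply: hdep => k /(mem_ballat j k r0); exact: h.
- by move=> i; exact: hd.
- move=> i e he; case: (hc j i x e he) => del [d0 hdel]; exists del; split=> // y hy.
  by apply: hdel => k /(mem_ballat j k r0); exact: hy.
Qed.

Lemma dS_dir j i x v : derivable_pt_lim (fun s => dS j i (shiftby x s v)) 0
  (\big[Rplus/R0]_(b <- ball0 d r) (d2S j i (j + b)%rg x * v (j + b)%rg)).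
Proof.
case: hA => r0 [_ [_ [hd [hc1 hc]]]].
have := @dirderiv d (dS j i) (d2S j i) (ballat r j) x v (ballat_uniq r j).
rewrite big_map; apply.
- by move=> y z h; apply: (cont_ball_dep (hc1 j i)) => k /(mem_ballat j k r0); exact: h.
- by move=> k; exact: hd.
- move=> k e he; case: (hc j i k x e he) => del [d0 hdel]; exists del; split=> // y hy.
  by apply: hdel => k' /(mem_ballat j k' r0); exact: hy.
Qed.

Lemma d2S_out j i k x : ~ in_ball r j k -> d2S j i k x = 0.
Proof.
move=> hk; case: hA => _ [_ [_ [hd [hc1 _]]]].
apply: (uniqueness_limite _ _ _ _ (hd j i k x)).
apply: (@derivable_pt_lim_eqf (fct_cte (dS j i x))); last exact: derivable_pt_lim_const.
move=> h; apply: (cont_ball_dep (hc1 j i)) => k' hk'; rewrite /upd; case: eqP => // e.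
by case: hk; rewrite -e.
Qed.
End TauGrad.

Section PeriodAlgebra.
Import Order.TTheory GRing.Theory Num.Theory.
Local Open Scope ring_scope.
Variable d : nat.
Variables (omega : 'rV[rat]_d) (p : 'M[int]_d) (q : 'rV[int]_d).
Hypothesis hp : principal_periods omega p q.

Definition per (n : 'rV[int]_d) : Zd d := n *m p^T.
Definition qper (n : 'rV[int]_d) : int := (n *m q^T) 0 0.

Lemma perD m n : per (m + n) = per m + per n. Proof. exact: mulmxDl. Qed.
Lemma qperD m n : qper (m + n) = qper m + qper n. Proof. by rewrite /qper mulmxDl mxE. Qed.
Lemma perN n : per (- n) = - per n. Proof. exact: mulNmx. Qed.
Lemma qperN n : qper (- n) = - qper n. Proof. by rewrite /qper mulNmx mxE. Qed.
Lemma per0 : per 0 = 0. Proof. exact: mul0mx. Qed.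
Lemma qper0 : qper 0 = 0. Proof. by rewrite /qper mul0mx mxE. Qed.

Lemma per_delta j : per (delta_mx ord0 j) = pcol p j.
Proof. by rewrite /per -rowE; apply/rowP => i; rewrite !mxE. Qed.
Lemma qper_delta j : qper (delta_mx ord0 j) = q ord0 j.
Proof. by rewrite /qper -rowE !mxE. Qed.

Definition slope (k : Zd d) (l : int) : rat := \sum_(a < d) (k 0 a)%:~R * omega 0 a + l%:~R.

Lemma slopeD k l k' l' : slope (k + k') (l + l') = slope k l + slope k' l'.
Proof.
rewrite /slope addrACA -big_split /= -rmorphD; congr (_ + _).
by apply: eq_bigr => a _; rewrite mxE rmorphD mulrDl.
Qed.

Lemma slopeZ m k l : slope (m *: k) (m * l) = m%:~R * slope k l.
Proof.
rewrite /slope mulrDr mulr_sumr rmorphM; congr (_ + _).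
by apply: eq_bigr => a _; rewrite mxE rmorphM mulrA.
Qed.

Lemma slopeB k l k' l' : slope (k - k') (l - l') = slope k l - slope k' l'.
Proof.
have := slopeZ (-1) k' l'; rewrite scaleN1r !mulN1r => h.
by rewrite slopeD h.
Qed.

Lemma slope_per k l : slope k l = 0 -> exists n, k = per n /\ l = qper n.
Proof. by move=> h; case: hp => _ /(_ k l h) [n [hn _]]; exists n. Qed.

Lemma omega_denominator : exists D : int, 0 < D /\ forall a, exists z : int, D%:~R * omega 0 a = z%:~R.
Proof.
exists (\prod_(a < d) denq (omega 0 a)); split; first by apply: prodr_gt0 => a _; exact: denq_gt0.
move=> a; rewrite (bigD1 a) //= mulrC rmorphM mulrA.
exists (numq (omega 0 a) * \prod_(i < d | i != a) denq (omega 0 i)).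
rewrite rmorphM; congr (_ * _).
by rewrite -{1}(divq_num_den (omega 0 a)) divfK // intr_eq0 denq_eq0.
Qed.

Lemma scaled_slope D : (forall a, exists z : int, D%:~R * omega 0 a = z%:~R) ->
  forall k l, exists z : int, D%:~R * slope k l = z%:~R.
Proof.
move=> hD k l; apply/intrP; rewrite mulrDr mulr_sumr; apply: rpredD.
  apply: rpred_sum => a _; rewrite mulrCA; apply: rpredM; first exact: intr_int.
  exact/intrP/hD.
by rewrite -rmorphM; exact: intr_int.
Qed.

Notation toQ := (map_mx (fun z : int => z%:~R : rat)).

Lemma p_unit : (toQ p)^T \in unitmx.
Proof.
case: omega_denominator => D [D0 hD].
have row_ex a : exists n : 'rV[int]_d, D *: delta_mx ord0 a = per n.
  case: (hD a) => z hz.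
  case: (@slope_per (D *: delta_mx ord0 a) (- z)) => [|n [h _]]; last by exists n.
  rewrite /slope (bigD1 a) //= big1 => [|b /negbTE hb]; last by rewrite !mxE hb andbF mulr0 mul0r.
  by rewrite !mxE !eqxx mulr1 addr0 hz rmorphN subrr.
pose nr a := proj1_sig (constructive_indefinite_description _ (row_ex a)).
have nrP a : D *: delta_mx ord0 a = per (nr a).
  by rewrite /nr; case: constructive_indefinite_description.
pose M : 'M[int]_d := \matrix_(a, b) nr a 0 b.
have hM : M *m p^T = D%:M.
  apply/row_matrixP => a; rewrite row_mul rowE.
  have -> : delta_mx ord0 a *m M = nr a by rewrite -rowE; apply/rowP => b; rewrite !mxE.
  by rewrite -/(per _) -nrP rowE mul_mx_scalar.
have hQ : (D%:~R^-1 *: toQ M) *m (toQ p)^T = 1%:M.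
  rewrite -scalemxAl map_trmx -map_mxM hM map_scalar_mx.
  by rewrite -scalemx1 scalerA mulVf ?scale1r // intr_eq0 gt_eqF.
by case: (mulmx1_unit hQ).
Qed.

Lemma toQ_per n : toQ (per n) = toQ n *m (toQ p)^T.
Proof. by rewrite /per map_mxM map_trmx. Qed.

Lemma Bp_decompose k : exists b n, inBp p b /\ k = b + per n.
Proof.
pose t := toQ k *m invmx (toQ p)^T.
pose n : 'rV[int]_d := map_mx (@Num.floor rat) t.
exists (k - per n), n; rewrite subrK; split=> //.
exists (t - toQ n); split.
  move=> j; rewrite !mxE; have := floor_itv (t ord0 j); rewrite mxE.
  move=> /andP[h1 h2]; rewrite subr_ge0; split=> //.
  by rewrite ltrBlDl; move: h2; rewrite rmorphD.
rewrite mulmxBl mulmxKV ?p_unit // -toQ_per.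
by apply/rowP => j; rewrite !mxE rmorphB.
Qed.

Lemma Bp_unique b b' n n' : inBp p b -> inBp p b' -> b + per n = b' + per n' -> b = b' /\ n = n'.
Proof.
move=> [t [ht et]] [t' [ht' et']] e.
have e1 : t + toQ n = t' + toQ n'.
  have inj (u v : 'rV[rat]_d) : u *m (toQ p)^T = v *m (toQ p)^T -> u = v.
    by move=> h; rewrite -(mulmxK p_unit u) h mulmxK // p_unit.
  apply: inj; rewrite !mulmxDl -!toQ_per -et -et'.
  have tD (u v : 'rV[int]_d) : toQ u + toQ v = toQ (u + v) by apply/rowP => i; rewrite !mxE rmorphD.
  by rewrite !tD e.
have en : n = n'.
  apply/rowP => j.
  have [h1 h2] := ht j; have [h1' h2'] := ht' j.
  have := congr1 (fun u : 'rV[rat]_d => u ord0 j) e1; rewrite /= !mxE => h.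
  have hn : (n ord0 j)%:~R - (n' ord0 j)%:~R = t' ord0 j - t ord0 j :> rat.
    by rewrite -(addKr (t ord0 j) ((n ord0 j)%:~R)) h addrA addrK addrC.
  have k1 : ((n ord0 j - n' ord0 j)%:~R : rat) < 1%:~R.
    rewrite rmorphB hn; apply: le_lt_trans h2'; by rewrite gerBl.
  have k2 : ((-1)%:~R : rat) < (n ord0 j - n' ord0 j)%:~R.
    rewrite rmorphB hn rmorphN; apply: lt_le_trans (_ : - t ord0 j <= _); first by rewrite ltrN2.
    by rewrite lerDr.
  rewrite ltr_int in k1; rewrite ltr_int in k2.
  apply/eqP; rewrite -subr_eq0; move: k1 k2; case: (n ord0 j - n' ord0 j) => [[|m]|[|m]] //.
by split=> //; move: e; rewrite en => /addIr.
Qed.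

(* [slope] maps [Z^d x Z] onto a cyclic group, generated by the value at [(k0, l0)]. *)
Lemma shift_generator : exists k0 l0, (forall k l, exists m : int, slope (k - m *: k0) (l - m * l0) = 0) /\
  exists m : int, 0 < m /\ slope (0 - m *: k0) (1 - m * l0) = 0.
Proof.
case: omega_denominator => D [D0 hD]; have hv := scaled_slope hD.
have Dn0 : (D%:~R : rat) != 0 by rewrite intr_eq0 gt_eqF.
have s01 : slope 0 1 = 1.
  by rewrite /slope big1 ?add0r // => a _; rewrite mxE mul0r.
pose P (n : nat) := (0 < n)%nat /\ exists k l, D%:~R * slope k l = (n%:Z)%:~R.
pose Pb n : bool := if excluded_middle_informative (P n) then true else false.
have PbP n : reflect (P n) (Pb n).
  by rewrite /Pb; case: excluded_middle_informative => h; constructor.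
have exP : exists n, Pb n.
  exists (absz D); apply/PbP; split; first by rewrite absz_gt0 gt_eqF.
  by exists 0, 1; rewrite s01 mulr1 gez0_abs // ltW.
case: (ex_minnP exP) => g /PbP [g0 [k0 [l0 hg]]] gmin.
have key k l z : D%:~R * slope k l = z%:~R -> D%:~R * slope (k - (divz z g%:Z) *: k0) (l - (divz z g%:Z) * l0) = (modz z g%:Z)%:~R.
  move=> hz; rewrite slopeB slopeZ mulrBr hz mulrCA hg -rmorphM -rmorphB; congr (_ %:~R).
have gz : g%:Z != 0 by rewrite -lt0n in g0 *; case: (g) g0.
have zero k l z : D%:~R * slope k l = z%:~R -> (modz z g%:Z) = 0.
  move=> hz; have hk := key k l z hz.
  have h1 : 0 <= modz z g%:Z by exact: modz_ge0.
  have h2 : ((modz z g%:Z) < g%:Z) by apply: ltz_pmod; case: (g) g0.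
  case e : (modz z g%:Z) h1 h2 hk => [[|n]|n] // _ h2 hk.
  have : (g <= n.+1)%nat by apply: gmin; apply/PbP; split=> //; eexists; eexists; exact: hk.
  by rewrite leqNgt; move: h2; rewrite ltz_nat => ->.
exists k0, l0; split.
  move=> k l; case: (hv k l) => z hz; exists (divz z g%:Z).
  have := key k l z hz; rewrite (zero k l z hz) => /eqP; rewrite mulf_eq0 (negbTE Dn0) /= => /eqP //.
have hz : D%:~R * slope 0 1 = D%:~R by rewrite s01 mulr1.
exists (divz D g%:Z); split; last first.
  by have := key 0 1 D hz; rewrite (zero 0 1 D hz) => /eqP; rewrite mulf_eq0 (negbTE Dn0) /= => /eqP.
have eD := divz_eq D g%:Z; rewrite (zero 0 1 D hz) addr0 in eD.
have gp : 0 < g%:Z by case: (g) g0.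
by rewrite eD pmulr_lgt0 in D0.
Qed.
End PeriodAlgebra.

Lemma Rmult_assoc_ssr : associative Rmult.
Proof. by move=> x y z; rewrite Rmult_assoc. Qed.
HB.instance Definition _ :=
  Monoid.isComLaw.Build R 1 Rmult Rmult_assoc_ssr Rmult_comm Rmult_1_l.

Section NormX.
Variable d : nat.
Implicit Types (z w : Config d).

Definition wt (k : Zd d) := (/ 2) ^ norm1 k.

Lemma wt_gt0 k : 0 < wt k.
Proof. by apply: pow_lt; lra. Qed.

Lemma sub_sum_le (s t : seq (Zd d)) (F : Zd d -> R) : uniq s -> uniq t -> {subset s <= t} -> (forall k, 0 <= F k) ->
  \big[Rplus/R0]_(k <- s) F k <= \big[Rplus/R0]_(k <- t) F k.
Proof.
move=> us ut st F0.
have hperm : perm_eq s [seq k <- t | k \in s].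
  apply: uniq_perm => //; first exact: filter_uniq.
  by move=> k; rewrite mem_filter; case h : (k \in s) => //=; rewrite st.
rewrite (perm_big _ hperm) big_filter [X in _ <= X](bigID (fun k => k \in s)) /=.
rewrite -[X in X <= _]Rplus_0_r; apply: Rplus_le_compat_l; exact: bsum_ge0.
Qed.

Lemma normX_add z w A B : normX_le z A -> normX_le w B -> normX_le (fun i => z i + w i) (A + B).
Proof.
move=> hz hw s us; apply: Rle_trans (Rplus_le_compat _ _ _ _ (hz s us) (hw s us)).
rewrite /Rsum_seq -bsum_add; apply: bsum_le => i _.
have := wt_gt0 i; rewrite /wt; have := Rabs_triang (z i) (w i); nra.
Qed.

Lemma normX_scal c z A : normX_le z A -> normX_le (fun i => c * z i) (Rabs c * A).
Proof.
move=> hz s us; apply: Rle_trans (Rmult_le_compat_l _ _ _ (Rabs_pos c) (hz s us)).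
by rewrite /Rsum_seq -bsum_scal; apply: bsum_le => i _; rewrite Rabs_mult; apply: Req_le; ring.
Qed.

Lemma normX_mono z w A : (forall i, Rabs (z i) <= Rabs (w i)) -> normX_le w A -> normX_le z A.
Proof.
move=> h hw s us; apply: Rle_trans (hw s us); apply: bsum_le => i _.
by apply: Rmult_le_compat_l => //; exact: Rlt_le (wt_gt0 i).
Qed.

Lemma normX_weak z A B : A <= B -> normX_le z A -> normX_le z B.
Proof. by move=> h hz s us; apply: Rle_trans (hz s us) h. Qed.

Lemma normX_coord z A i : normX_le z A -> wt i * Rabs (z i) <= A.
Proof. by move=> /(_ [:: i] erefl); rewrite /Rsum_seq big_seq1. Qed.

Lemma normX_ge0 z A : normX_le z A -> 0 <= A.
Proof. by move=> /(_ [::] erefl); rewrite /Rsum_seq big_nil. Qed.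

Lemma normX_shift u z A : normX_le z A -> normX_le (fun i => z (i + u)%rg) (2 ^ norm1 u * A).
Proof.
move=> hz s us.
have us' : uniq [seq (i + u)%rg | i <- s] by rewrite map_inj_uniq //; exact: GRing.addIr.
have p2 : 0 <= 2 ^ norm1 u by apply: pow_le; lra.
apply: Rle_trans (Rmult_le_compat_l _ _ _ p2 (hz _ us')).
rewrite /Rsum_seq big_map -bsum_scal; apply: bsum_le => i _.
rewrite -Rmult_assoc; apply: Rmult_le_compat_r; first exact: Rabs_pos.
have h : (norm1 (i + u)%rg <= norm1 i + norm1 u)%nat by exact: norm1_triang.
have e1 : (/ 2) ^ norm1 i = 2 ^ norm1 u * (/ 2) ^ (norm1 i + norm1 u).
  have -> : (norm1 i + norm1 u)%nat = Nat.add (norm1 u) (norm1 i) by rewrite addnC.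
  rewrite pow_add -Rmult_assoc -Rpow_mult_distr Rinv_r; last lra.
  by rewrite pow1 Rmult_1_l.
rewrite e1; apply: Rmult_le_compat_l => //.
set a := norm1 _ in h *; set b := (norm1 i + norm1 u)%nat in h *.
rewrite !pow_inv; apply: Rinv_le_contravar; first by apply: pow_lt; lra.
by apply: Rle_pow; [lra | exact/leP].
Qed.

Lemma geom_sum n : \big[Rplus/R0]_(m < n) (2 / 3) ^ m <= 3.
Proof.
suff -> : \big[Rplus/R0]_(m < n) (2 / 3) ^ m = 3 - 3 * (2 / 3) ^ n.
  by have := pow_le (2 / 3) n ltac:(lra); lra.
elim: n => [|n IH]; first by rewrite big_ord0 /=; ring.
by rewrite big_ord_recr /= IH; field.
Qed.

Lemma row_sum N : \big[Rplus/R0]_(m : 'I_(Nat.add (Nat.mul 2 N) 1)) (2 / 3) ^ absz (((m : nat)%:Z - N%:Z)%rg) <= 6.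
Proof.
pose F (m : nat) := (2 / 3) ^ absz ((m%:Z - N%:Z)%rg).
have e : (Nat.add (Nat.mul 2 N) 1 = N + N.+1)%nat by rewrite -plusE; lia.
have -> : \big[Rplus/R0]_(m : 'I_(Nat.add (Nat.mul 2 N) 1)) (2 / 3) ^ absz (((m : nat)%:Z - N%:Z)%rg) =
   \big[Rplus/R0]_(0 <= m < (N + N.+1)%nat) F m by rewrite big_mkord -e.
rewrite (@big_cat_nat _ _ _ N) //=; last by rewrite leq_addr.
have h1 : \big[Rplus/R0]_(0 <= m < N) F m <= 3.
  rewrite big_nat_rev big_mkord; apply: Rle_trans (geom_sum N); apply: bsum_le => m _.
  rewrite /F add0n.
  have -> : absz ((N - m.+1)%nat%:Z - N%:Z)%rg = m.+1.
    by rewrite -subzn // GRing.addrAC GRing.subrr GRing.sub0r abszN.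
  have := pow_le (2 / 3) m ltac:(lra); rewrite /=; lra.
have h2 : \big[Rplus/R0]_(N <= m < (N + N.+1)%nat) F m <= 3.
  rewrite -{1}(add0n N) (addnC N N.+1) big_addn addnK big_mkord; apply: Rle_trans (geom_sum N.+1); apply: bsum_le => m _.
  rewrite /F PoszD GRing.addrK /=; lra.
lra.
Qed.

Lemma lattice_sum : exists M, forall s : seq (Zd d), uniq s -> \big[Rplus/R0]_(k <- s) (2 / 3) ^ norm1 k <= M.
Proof.
exists (\big[Rmult/1]_(a < d) 6) => s us.
pose N := (\max_(k <- s) norm1 k)%nat.
pose n := Nat.add (Nat.mul 2 N) 1.
pose t := [seq @box_pt d N f | f <- index_enum {ffun 'I_d -> 'I_n}].
have ut : uniq t by rewrite map_inj_uniq; [exact: index_enum_uniq | exact: box_pt_inj].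
have st : {subset s <= t}.
  move=> k hk; case: (@box_pt_ex d N k); first exact: leq_bigmax_seq.
  by move=> f ->; apply: map_f; exact: mem_index_enum.
apply: Rle_trans (sub_sum_le us ut st _) _; first by move=> k; apply: pow_le; lra.
rewrite big_map.
have -> : \big[Rplus/R0]_(f : {ffun 'I_d -> 'I_n}) (2 / 3) ^ norm1 (@box_pt d N f) =
   \big[Rplus/R0]_(f : {ffun 'I_d -> 'I_n}) \big[Rmult/1]_(a < d) (2 / 3) ^ absz (((f a : nat)%:Z - N%:Z)%rg).
  apply: eq_bigr => f _; rewrite /norm1.
  rewrite (big_morph (fun m => (2 / 3) ^ m) (id1 := 1) (op1 := Rmult)) //.
    by apply: eq_bigr => a _; rewrite mxE.
  by move=> x y; exact: pow_add.
rewrite -(bigA_distr_bigA (fun (a : 'I_d) (m : 'I_n) => (2 / 3) ^ absz (((m : nat)%:Z - N%:Z)%rg))).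
have : 0 <= \big[Rmult/1]_(a < d) \big[Rplus/R0]_(m < n) (2 / 3) ^ absz (((m : nat)%:Z - N%:Z)%rg) <= \big[Rmult/1]_(a < d) 6.
  elim/big_ind2: _ => [|x1 x2 y1 y2 h1 h2|a _]; first lra.
    split; first by apply: Rmult_le_pos; lra.
    by apply: Rmult_le_compat; lra.
  split; last exact: row_sum.
  by apply: bsum_ge0 => m _; apply: pow_le; lra.
by case.
Qed.

Lemma inX_linear z A B : 0 <= A -> 0 <= B -> (forall k, Rabs (z k) <= A + B * INR (norm1 k)) -> inX z.
Proof.
move=> A0 B0 hz; case: lattice_sum => M hM; exists ((A + 3 * B) * M) => s us.
apply: Rle_trans (Rmult_le_compat_l (A + 3 * B) _ _ _ (hM s us)); last lra.
rewrite /Rsum_seq -bsum_scal; apply: bsum_le => k _.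
have bern n : INR n <= 3 * (4 / 3) ^ n /\ 1 <= (4 / 3) ^ n.
  elim: n => [|n [IH1 IH2]]; first by rewrite /=; lra.
  by rewrite S_INR /=; lra.
case: (bern (norm1 k)) => b1 b2.
have e1 : (2 / 3) ^ norm1 k = (/ 2) ^ norm1 k * (4 / 3) ^ norm1 k.
  by rewrite -Rpow_mult_distr; congr (_ ^ _); field.
rewrite e1 (_ : (A + 3 * B) * _ = (/ 2) ^ norm1 k * ((A + 3 * B) * (4 / 3) ^ norm1 k)); last ring.
apply: Rmult_le_compat_l; first exact: Rlt_le (wt_gt0 k).
apply: Rle_trans (hz k) _; nra.
Qed.

(* Gronwall for the weighted norm: [z] stays below [e exp((L + 1) t)] for every [e > 0]. *)
Lemma zero_of_lip (L : R) (z : R -> Config d) : 0 <= L -> (forall i, z 0 i = 0) ->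
  (forall t, inX (z t)) ->
  (forall t M e, 0 < e -> normX_le (z t) M -> exists del, 0 < del /\ forall h, h <> 0 -> Rabs h < del ->
     normX_le (fun i => z (t + h) i - z t i) (Rabs h * (L * M + e))) ->
  forall t i, 0 <= t -> z t i = 0.
Proof.
move=> L0 z0 zX hz.
have main e T : 0 < e -> 0 <= T -> normX_le (z T) (e * exp ((L + 1) * T)).
  move=> he T0; pose phi t := e * exp ((L + 1) * t).
  have phi0 t : 0 < phi t by apply: Rmult_lt_0_compat => //; exact: exp_pos.
  have phim s t : s <= t -> phi s <= phi t.
    move=> st; apply: Rmult_le_compat_l; first lra.
    have [lt|->] : s < t \/ s = t by lra.
      by apply: Rlt_le; apply: exp_increasing; nra.
    lra.
  pose good t := 0 <= t <= T /\ forall s, 0 <= s <= t -> normX_le (z s) (phi s).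
  have g0 : good 0.
    split; first lra; move=> s hs; have -> : s = 0 by lra.
    move=> l _; rewrite /Rsum_seq big1; first exact: Rlt_le.
    by move=> i _; rewrite z0 Rabs_R0 Rmult_0_r.
  case: (completeness good) => [||m [m1 m2]].
  - by exists T => t [ht _]; lra.
  - by exists 0.
  have mT : 0 <= m <= T.
    by split; [exact: m1 | apply: m2 => t [ht _]; lra].
  have below s : 0 <= s < m -> normX_le (z s) (phi s).
    move=> hs; apply: NNPP => hn.
    have : m <= s; last lra.
    apply: m2 => t [ht gt]; apply: Rnot_lt_le => lt; apply: hn; apply: gt; lra.
  have atm : normX_le (z m) (phi m).
    have [e0|m0] : m = 0 \/ 0 < m by lra.
      by rewrite e0; case: g0 => _; apply; lra.
    case: (zX m) => M hM; have M0 := normX_ge0 hM.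
    case: (hz m M 1 Rlt_0_1 hM) => del [del0 hdel].
    move=> l ul; apply: Rnot_lt_le => lt.
    set S1 := Rsum_seq _ _ in lt.
    pose k := Rmin (Rmin (del / 2) (m / 2)) ((S1 - phi m) / (2 * (L * M + 1))).
    have LM : 0 < L * M + 1 by nra.
    have k0 : 0 < k by do 2?apply: Rmin_glb_lt; try lra; apply: Rdiv_lt_0_compat; lra.
    have k1 : k <= del / 2 by apply: Rle_trans (Rmin_l _ _) (Rmin_l _ _).
    have k2 : k <= m / 2 by apply: Rle_trans (Rmin_l _ _) (Rmin_r _ _).
    have k3 : k * (2 * (L * M + 1)) <= S1 - phi m by apply: le_div_mul; [lra | exact: Rmin_r].
    have h1 := hdel (- k) ltac:(lra); rewrite Rabs_Ropp (Rabs_pos_eq k) in h1; last lra.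
    have h2 := normX_add (below (m + - k) ltac:(lra)) (normX_scal (-1) (h1 ltac:(lra))).
    have := h2 l ul; rewrite Rabs_Ropp Rabs_R1.
    have -> : Rsum_seq l (fun i => (/ 2) ^ norm1 i * Rabs (z (m + - k) i + -1 * (z (m + - k) i - z m i))) = S1.
      apply: eq_bigr => i _; congr (_ * Rabs _); ring.
    have := phim (m + - k) m ltac:(lra); nra.
  have goodm : good m.
    split=> // s hs; have [lt|->] : s < m \/ s = m by lra.
      by apply: below; lra.
    exact: atm.
  have [<-|lt] : m = T \/ m < T by lra.
    exact: atm.
  exfalso; case: (hz m (phi m) (phi m) (phi0 m) atm) => del [del0 hdel].
  pose k := Rmin (del / 2) (T - m).
  have k0 : 0 < k by apply: Rmin_glb_lt; lra.
  have k1 : k <= del / 2 by exact: Rmin_l.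
  have k2 : k <= T - m by exact: Rmin_r.
  have : m + k <= m; last lra.
  apply: m1; split; first lra.
  move=> s hs; have [le|gt] := Rle_lt_dec s m; first by case: goodm => _; apply; lra.
  have h1 := hdel (s - m) ltac:(lra); rewrite Rabs_pos_eq in h1; last lra.
  have := normX_add atm (h1 ltac:(lra)) => h2.
  apply: (@normX_weak _ (phi m + (s - m) * (L * phi m + phi m))).
    have -> : phi s = phi (m + (s - m)) by congr (phi _); ring.
    rewrite /phi (_ : (L + 1) * (m + (s - m)) = (L + 1) * m + (L + 1) * (s - m)) ?exp_plus; last ring.
    have := exp_ineq1_le ((L + 1) * (s - m)); have := phi0 m; rewrite /phi.
    set X := exp ((L + 1) * m); set Y := exp _ => q1 q2.
    have : e * X * (1 + (L + 1) * (s - m)) <= e * X * Y by apply: Rmult_le_compat_l; lra.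
    lra.
  apply: normX_mono h2 => i; apply: Req_le; congr (Rabs _).
  by rewrite (_ : m + (s - m) = s); ring.
move=> t i t0; apply: NNPP => ne.
have p := Rabs_pos_lt _ ne; have w0 := wt_gt0 i; have X0 := exp_pos ((L + 1) * t).
have p2 : 0 < wt i * Rabs (z t i) by exact: Rmult_lt_0_compat.
have e0 : 0 < wt i * Rabs (z t i) / (2 * exp ((L + 1) * t)) by apply: Rdiv_lt_0_compat; lra.
have := normX_coord i (main _ t e0 t0).
have -> : wt i * Rabs (z t i) / (2 * exp ((L + 1) * t)) * exp ((L + 1) * t) = wt i * Rabs (z t i) / 2 by field; lra.
lra.
Qed.
End NormX.

Section FlowX.
Variables (d : nat) (r : R) (S : Zd d -> Config d -> R).
Variables (dS : Zd d -> Zd d -> Config d -> R) (d2S : Zd d -> Zd d -> Zd d -> Config d -> R).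
Hypothesis hA : condA r S dS d2S.
Hypothesis hB : condB S.
Hypothesis hE : condE d2S.
Implicit Types x y : Config d.

Lemma dS_lip C j i x y : (forall j i k x, Rabs (d2S j i k x) <= C) ->
  Rabs (dS j i y - dS j i x) <= \big[Rplus/R0]_(b <- ball0 d r) (C * Rabs (y (j + b)%rg - x (j + b)%rg)).
Proof.
move=> hC; pose v k := y k - x k.
have hd s : derivable_pt_lim (fun s => dS j i (shiftby x s v)) s
    (\big[Rplus/R0]_(b <- ball0 d r) (d2S j i (j + b)%rg (shiftby x s v) * v (j + b)%rg)).
  apply/derivable_pt_lim_shift; apply: derivable_pt_lim_eqf (dS_dir hA j i (shiftby x s v) v) => t.
  by congr (dS _ _ _); apply: functional_extensionality => k; rewrite /shiftby; ring.
case: (@mvt _ _ 0 1 (fun c _ => hd c)) => s [hs _].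
have e0 : shiftby x 0 v = x by apply: functional_extensionality => k; rewrite /shiftby; ring.
have e1 : shiftby x 1 v = y by apply: functional_extensionality => k; rewrite /shiftby /v; ring.
rewrite e0 e1 Rminus_0_r Rmult_1_r in hs; rewrite hs.
apply: Rle_trans (bsum_abs _ _ _) _; apply: bsum_le => b _; rewrite Rabs_mult.
apply: Rmult_le_compat_r; [exact: Rabs_pos | exact: hC].
Qed.

Lemma gradW_lip : exists L, 0 <= L /\ forall x y M, normX_le (fun i => y i - x i) M ->
  normX_le (fun i => gradW r dS y i - gradW r dS x i) (L * M).
Proof.
case: hE => C hC'; have C0 : 0 <= C by apply: Rle_trans (hC' 0%rg 0%rg 0%rg (fun _ => 0)); exact: Rabs_pos.
exists (\big[Rplus/R0]_(b <- ball0 d r) \big[Rplus/R0]_(b' <- ball0 d r) (C * 2 ^ norm1 (b + b')%rg)).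
split.
  by apply: bsum_ge0 => b _; apply: bsum_ge0 => b' _; apply: Rmult_le_pos => //; apply: pow_le; lra.
move=> x y M hM s us.
apply: (@Rle_trans _ (\big[Rplus/R0]_(i <- s) \big[Rplus/R0]_(b <- ball0 d r) \big[Rplus/R0]_(b' <- ball0 d r)
   ((/ 2) ^ norm1 i * (C * Rabs (y (i + b + b')%rg - x (i + b + b')%rg))))).
  apply: bsum_le => i _.
  have -> : \big[Rplus/R0]_(b <- ball0 d r) \big[Rplus/R0]_(b' <- ball0 d r)
   ((/ 2) ^ norm1 i * (C * Rabs (y (i + b + b')%rg - x (i + b + b')%rg))) =
    (/ 2) ^ norm1 i * \big[Rplus/R0]_(b <- ball0 d r) \big[Rplus/R0]_(b' <- ball0 d r)
   (C * Rabs (y (i + b + b')%rg - x (i + b + b')%rg)).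
    by rewrite -bsum_scal; apply: eq_bigr => b _; rewrite -bsum_scal.
  apply: Rmult_le_compat_l; first exact: Rlt_le (wt_gt0 i).
  rewrite !gradWE -bsum_minus; apply: Rle_trans (bsum_abs _ _ _) _; apply: bsum_le => b _.
  exact: dS_lip.
rewrite exchange_big -bsum_scalr; apply: bsum_le => b _ /=.
rewrite exchange_big -bsum_scalr; apply: bsum_le => b' _ /=.
have := normX_shift (b + b')%rg hM us; rewrite /Rsum_seq => h.
have := Rmult_le_compat_l C _ _ C0 h; rewrite -bsum_scal -(Rmult_assoc C (2 ^ _)); apply: Rle_trans.
apply: bsum_le => i _; rewrite GRing.addrA.
by rewrite -!Rmult_assoc (Rmult_comm C); apply: Rle_refl.
Qed.

Definition Xsol (z : R -> Config d) := forall t, inX (z t) /\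
  forall eps, 0 < eps -> exists delta, 0 < delta /\
    forall h, h <> 0 -> Rabs h < delta ->
      normX_le (fun i => (z (t + h) i - z t i) / h + gradW r dS (z t) i) eps.

Lemma Xsol_unique z1 z2 : Xsol z1 -> Xsol z2 -> z1 0 = z2 0 -> forall t, z1 t = z2 t.
Proof.
move=> h1 h2 e0; case: gradW_lip => L [L0 hL].
pose z t : Config d := fun i => z1 t i - z2 t i.
have zX t : inX (z t).
  case: (h1 t) => -[M1 hM1] _; case: (h2 t) => -[M2 hM2] _; exists (M1 + Rabs (-1) * M2).
  apply: normX_mono (normX_add hM1 (normX_scal (-1) hM2)) => i.
  by apply: Req_le; congr (Rabs _); rewrite /z; ring.
have hz t M e : 0 < e -> normX_le (z t) M -> exists del, 0 < del /\ forall h, h <> 0 -> Rabs h < del ->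
     normX_le (fun i => z (t + h) i - z t i) (Rabs h * (L * M + e)).
  move=> he hM.
  case: (h1 t) => _ /(_ (e / 2)) [|d1 [d10 hd1]]; first lra.
  case: (h2 t) => _ /(_ (e / 2)) [|d2 [d20 hd2]]; first lra.
  exists (Rmin d1 d2); split=> [|h h0 hh]; first exact: Rmin_glb_lt.
  have k1 := hd1 h h0 (Rlt_le_trans _ _ _ hh (Rmin_l _ _)).
  have k2 := hd2 h h0 (Rlt_le_trans _ _ _ hh (Rmin_r _ _)).
  have k3 : normX_le (fun i => gradW r dS (z2 t) i - gradW r dS (z1 t) i) (L * M).
    apply: hL; apply: normX_mono hM => i; rewrite -Rabs_Ropp; apply: Req_le; congr (Rabs _).
    by rewrite /z; ring.
  have k4 := normX_add k3 (normX_add k1 (normX_scal (-1) k2)).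
  rewrite Rabs_Ropp Rabs_R1 in k4.
  apply: (@normX_weak _ _ (Rabs h * (L * M + (e / 2 + 1 * (e / 2))))).
    by apply: Req_le; congr (_ * _); field.
  apply: normX_mono (normX_scal h k4) => i; apply: Req_le; congr (Rabs _).
  by rewrite /z; field.
move=> t; apply: functional_extensionality => i; suff : z t i = 0 by rewrite /z; lra.
have [le|lt] := Rle_lt_dec 0 t.
  apply: (@zero_of_lip d L z) => //.
  by move=> k; rewrite /z e0; ring.
rewrite -(Ropp_involutive t); apply: (@zero_of_lip d L (fun t => z (- t))) => //.
- by move=> k; rewrite /z Ropp_0 e0; ring.
- move=> s M e he hM; case: (hz (- s) M e he hM) => del [del0 hdel]; exists del; split=> // h h0 hh.
  have := hdel (- h) ltac:(lra); rewrite Rabs_Ropp => /(_ hh) h3.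
  by apply: normX_mono h3 => k; rewrite (_ : - (s + h) = - s + - h); [lra | ring].
- lra.
Qed.

Lemma inX_const c : inX (fun _ : Zd d => c).
Proof.
apply: (@inX_linear d _ (Rabs c) 0); [exact: Rabs_pos | lra |].
by move=> k; have := pos_INR (norm1 k); lra.
Qed.

Lemma inX_tau k l x : inX x -> inX (tau k l x).
Proof.
move=> [M hM]; case: (inX_const (IntR l)) => M' hM'; exists (2 ^ norm1 k * M + M').
exact: normX_add (normX_shift k hM) hM'.
Qed.

Lemma Xsol_tau k l z : Xsol z -> Xsol (fun t => tau k l (z t)).
Proof.
move=> hz t; case: (hz t) => zX hd; split; first exact: inX_tau.
move=> e he; have p2 : 0 < 2 ^ norm1 k by apply: pow_lt; lra.
case: (hd (e / 2 ^ norm1 k)) => [|del [del0 hdel]]; first exact: Rdiv_lt_0_compat.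
exists del; split=> // h h0 hh.
have := normX_shift k (hdel h h0 hh).
rewrite (_ : 2 ^ norm1 k * (e / 2 ^ norm1 k) = e); last by field; lra.
apply: normX_mono => i; rewrite (gradW_tau hA hB) /tau /vadd; apply: Req_le; congr (Rabs (_ / _ + _)).
ring.
Qed.
End FlowX.

Lemma Rabs_dist3 a b c : Rabs (a - c) <= Rabs (a - b) + Rabs (b - c).
Proof. by have := Rabs_triang (a - b) (b - c); rewrite (_ : a - b + (b - c) = a - c) //; ring. Qed.

Definition cnt (I : finType) (F : (I -> R) -> R) x := forall e, 0 < e -> exists d, 0 < d /\
  forall y, (forall i, Rabs (y i - x i) < d) -> Rabs (F y - F x) < e.

Lemma cnt_const (I : finType) c (x : I -> R) : cnt (fun _ => c) x.
Proof. by move=> e he; exists 1; split; [lra | move=> y _; rewrite Rminus_diag Rabs_R0]. Qed.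

Lemma cnt_sum (I : finType) (J : Type) (s : seq J) (F : J -> (I -> R) -> R) x :
  (forall j, cnt (F j) x) -> cnt (fun y => \big[Rplus/R0]_(j <- s) F j y) x.
Proof.
move=> h; elim: s => [|a s IH] e he.
  by exists 1; split; [lra | move=> y _; rewrite !big_nil Rminus_diag Rabs_R0].
case: (h a (e / 2)) => [|d1 [d10 h1]]; first lra.
case: (IH (e / 2)) => [|d2 [d20 h2]]; first lra.
exists (Rmin d1 d2); split=> [|y hy]; first exact: Rmin_glb_lt.
rewrite !big_cons.
have k1 := h1 y (fun i => Rlt_le_trans _ _ _ (hy i) (Rmin_l _ _)).
have k2 := h2 y (fun i => Rlt_le_trans _ _ _ (hy i) (Rmin_r _ _)).
set A := \big[_/_]_(_ <- _) _ in k2 *; set B := \big[_/_]_(_ <- _) _ in k2 *.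
rewrite (_ : F a y + A - (F a x + B) = (F a y - F a x) + (A - B)); last ring.
by apply: Rle_lt_trans (Rabs_triang _ _) _; lra.
Qed.

Section Periodic.
Variables (d : nat) (r : R) (S : Zd d -> Config d -> R).
Variables (dS : Zd d -> Zd d -> Config d -> R) (d2S : Zd d -> Zd d -> Zd d -> Config d -> R).
Variables (omega : 'rV[rat]_d) (p : 'M[int]_d) (q : 'rV[int]_d) (bp : seq (Zd d)).
Hypothesis hA : condA r S dS d2S.
Hypothesis hB : condB S.
Hypothesis hC : condC S.
Hypothesis hD : condD d2S.
Hypothesis hE : condE d2S.
Hypothesis hp : principal_periods omega p q.
Hypothesis hbp : enumerates_Bp p bp.

Local Notation I := 'I_(size bp).
Local Notation V := (I -> R).
Local Notation X := (inXpq p q).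
Implicit Types (x y : Config d) (xx yy v w : V) (i j : I) (k u : Zd d).

Lemma tau_tau k l k' l' x : tau k l (tau k' l' x) = tau (k + k')%rg (l + l')%rg x.
Proof.
apply: functional_extensionality => i; rewrite /tau /vadd IntRD GRing.addrA.
by rewrite Rplus_assoc (Rplus_comm (IntR l')).
Qed.

Lemma tau0 x : tau (0%rg : Zd d) 0%rg x = x.
Proof.
by apply: functional_extensionality => i; rewrite /tau /vadd GRing.addr0 IntR0 Rplus_0_r.
Qed.

Lemma tau_inv k l x y : tau k l x = y -> tau (- k)%rg (- l)%rg y = x.
Proof. by move=> <-; rewrite tau_tau !GRing.addNr tau0. Qed.

Lemma X_per x n : X x -> tau (per p n) (qper q n) x = x.
Proof.
move=> hx; elim/lattice_ind: n => [|m n hm hn|a|a].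
- by rewrite per0 qper0 tau0.
- by rewrite perD qperD -tau_tau hn hm.
- by rewrite per_delta qper_delta; exact: hx.
- by rewrite perN qperN; apply: tau_inv; rewrite per_delta qper_delta; exact: hx.
Qed.

Lemma X_per_at x n k : X x -> x (k + per p n)%rg = x k - IntR (qper q n).
Proof. by move=> hx; rewrite -{2}(X_per n hx) /tau /vadd; ring. Qed.

Lemma tangent_per (v : Config d) n k : tangent p v -> v (k + per p n)%rg = v k.
Proof.
move=> hv; move: k; elim/lattice_ind: n => [|m n hm hn|a|a] k.
- by rewrite per0 GRing.addr0.
- by rewrite perD GRing.addrA hn hm.
- by rewrite per_delta; exact: hv.
- rewrite perN per_delta -[in RHS](GRing.subrK (pcol p a) k); symmetry; exact: hv.
Qed.

Lemma X_slope x k l : X x -> slope omega k l = 0%rg -> tau k l x = x.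
Proof. by move=> hx /(slope_per hp) [n [-> ->]]; exact: X_per. Qed.

Lemma X_tau x k l : X x -> X (tau k l x).
Proof. by move=> hx j; rewrite tau_tau GRing.addrC (GRing.addrC (q _ _)) -tau_tau hx. Qed.

Definition pt i : Zd d := tnth (in_tuple bp) i.

Lemma rep_ex k : exists im : I * 'rV[int]_d, k = (pt im.1 + per p im.2)%rg.
Proof.
case: (Bp_decompose hp k) => b [n [hb ->]].
case: hbp => _ /(_ b) [_ /(_ hb) hb'].
have hi : (index b bp < size bp)%nat by rewrite index_mem.
by exists (Ordinal hi, n); rewrite /pt (tnth_nth b) /= nth_index.
Qed.

Definition rep k := proj1_sig (constructive_indefinite_description _ (rep_ex k)).
Definition repi k := (rep k).1.
Definition repn k := (rep k).2.

Lemma repP k : k = (pt (repi k) + per p (repn k))%rg.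
Proof. by rewrite /repi /repn /rep; case: constructive_indefinite_description. Qed.

Lemma rep_unique i j n m : (pt i + per p n)%rg = (pt j + per p m)%rg -> i = j /\ n = m.
Proof.
case: hbp => hu hm.
have inB l : inBp p (pt l) by apply/hm; exact: mem_tnth.
move=> /(Bp_unique hp (inB i) (inB j)) [e ->]; split=> //.
apply: val_inj; apply/eqP; rewrite -(nth_uniq 0%rg (ltn_ord i) (ltn_ord j) hu).
by move: e; rewrite /pt !(tnth_nth 0%rg) => ->.
Qed.

Lemma rep_eq k i n : k = (pt i + per p n)%rg -> repi k = i /\ repn k = n.
Proof. by move=> e; apply: rep_unique; rewrite -repP. Qed.

Lemma repi_pt i : repi (pt i) = i /\ repn (pt i) = 0%rg.
Proof. by apply: rep_eq; rewrite per0 GRing.addr0. Qed.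

Lemma repi_per k n : repi (k + per p n)%rg = repi k /\ repn (k + per p n)%rg = (repn k + n)%rg.
Proof. by apply: rep_eq; rewrite perD GRing.addrA -repP. Qed.

Definition i0 : I := repi 0%rg.

Definition E xx : Config d := fun k => xx (repi k) - IntR (qper q (repn k)).
Definition Ev v : Config d := fun k => v (repi k).
Definition Rs x : V := fun i => x (pt i).

Lemma RsE xx : Rs (E xx) = xx.
Proof.
apply: functional_extensionality => i; rewrite /Rs /E; case: (repi_pt i) => -> ->.
by rewrite qper0 IntR0; ring.
Qed.

Lemma E_X xx : X (E xx).
Proof.
move=> a; apply: functional_extensionality => k; rewrite /tau /vadd /E.
rewrite -per_delta -qper_delta; case: (repi_per k (delta_mx ord0 a)) => -> ->.
by rewrite qperD IntRD; ring.
Qed.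

Lemma ERs x : X x -> E (Rs x) = x.
Proof.
by move=> hx; apply: functional_extensionality => k; rewrite /E /Rs -X_per_at // -repP.
Qed.

Lemma Ev_tangent v : tangent p (Ev v).
Proof. by move=> a k; rewrite /Ev /vadd -per_delta; case: (repi_per k (delta_mx ord0 a)) => ->. Qed.

Lemma EvRs (v : Config d) : tangent p v -> Ev (Rs v) = v.
Proof.
move=> hv; apply: functional_extensionality => k.
by rewrite /Ev /Rs -(tangent_per (repn k) (pt (repi k)) hv) -repP.
Qed.

Lemma E_line xx s v : shiftby (E xx) s (Ev v) = E (fun i => xx i + s * v i).
Proof. by apply: functional_extensionality => k; rewrite /shiftby /E /Ev; ring. Qed.

Lemma E_inj xx yy : E xx = E yy -> xx = yy.
Proof. by move=> h; rewrite -(RsE xx) h RsE. Qed.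

Lemma rep_shift_inj u : injective (fun i => repi (pt i + u)%rg).
Proof.
move=> i j e; have h1 := repP (pt i + u)%rg; have h2 := repP (pt j + u)%rg.
rewrite e in h1.
set m := repi (pt j + u)%rg in h1 h2.
set n1 := repn (pt i + u)%rg in h1; set n2 := repn (pt j + u)%rg in h2.
have : (pt i + per p n2)%rg = (pt j + per p n1)%rg.
  apply: (@GRing.addIr _ u); rewrite GRing.addrAC h1 (GRing.addrAC (pt j)) h2.
  by rewrite -!GRing.addrA; congr (_ + _)%rg; rewrite GRing.addrC.
by case/rep_unique.
Qed.

Lemma period_sum (h : Zd d -> R) u : (forall k n, h (k + per p n)%rg = h k) ->
  \rsum_i h (pt i + u)%rg = \rsum_i h (pt i).
Proof.
move=> hh.
rewrite [RHS](reindex_inj (@rep_shift_inj u)); apply: eq_bigr => i _.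
by rewrite {1}(repP (pt i + u)%rg) hh.
Qed.

Definition Wx xx := \rsum_i S (pt i) (E xx).
Definition fx xx : V := fun i => - gradW r dS (E xx) (pt i).
Definition Hx xx i j := \big[Rplus/R0]_(b <- ball0 d r) \big[Rplus/R0]_(b' <- ball0 d r)
  (if repi (pt i + b + b')%rg == j then d2S (pt i + b)%rg (pt i) (pt i + b + b')%rg (E xx) else 0).

Lemma WpqE x : Wpq S bp x = \rsum_i S (pt i) x.
Proof. by rewrite /Wpq /Rsum_seq big_tnth. Qed.

Lemma dS_per x k u n : X x -> dS (k + per p n)%rg (u + per p n)%rg x = dS k u x.
Proof. by move=> hx; rewrite -(dS_tau hA hB k u (per p n) (qper q n)) X_per. Qed.

Lemma W_grad x v : X x -> derivable_pt_lim (fun s => \rsum_i S (pt i) (shiftby x s (Ev v))) 0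
  (\rsum_i (gradW r dS x (pt i) * v i)).
Proof.
move=> hx; apply: derivable_pt_lim_eql; last first.
  apply: derivable_pt_lim_sum => i _; exact: (S_dir hA (pt i) x (Ev v)).
rewrite exchange_big /=.
transitivity (\big[Rplus/R0]_(b <- ball0 d r) \rsum_i (dS (pt i - b)%rg (pt i) x * v i)).
  apply: eq_bigr => b _.
  rewrite -(@period_sum (fun k => dS k (k + b)%rg x * Ev v (k + b)%rg) (- b)%rg).
    apply: eq_bigr => i _; rewrite GRing.subrK; congr (_ * _).
    by rewrite /Ev; case: (repi_pt i) => ->.
  move=> k n; rewrite GRing.addrAC dS_per // ; congr (_ * _).
  by apply: tangent_per; exact: Ev_tangent.
rewrite exchange_big /=; apply: eq_bigr => i _.
rewrite bsum_scalr; congr (_ * _); rewrite gradWE -(perm_big _ (ball0N d r)) big_map /=.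
by apply: eq_bigr => b _; rewrite GRing.opprK.
Qed.

Lemma gsW xx v : derivable_pt_lim (fun s => Wx (fun i => xx i + s * v i)) 0 (- dot (fx xx) v).
Proof.
apply: derivable_pt_lim_eql; last first.
  apply: derivable_pt_lim_eqf (@W_grad (E xx) v (E_X xx)) => s.
  by rewrite /Wx; apply: eq_bigr => i _; rewrite E_line.
by rewrite /dot -bsum_opp; apply: eq_bigr => i _; rewrite /fx; ring.
Qed.

Lemma gsf xx v i : derivable_pt_lim (fun s => fx (fun j => xx j + s * v j) i) 0
  (- \rsum_j (Hx xx i j * v j)).
Proof.
apply: (@derivable_pt_lim_eqf (fun s => - \big[Rplus/R0]_(b <- ball0 d r)
   dS (pt i + b)%rg (pt i) (shiftby (E xx) s (Ev v)))).
  by move=> s; rewrite /fx gradWE E_line.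
apply: derivable_pt_lim_opp; apply: derivable_pt_lim_eql; last first.
  by apply: derivable_pt_lim_sum => b _; exact: (dS_dir hA).
rewrite /Hx.
transitivity (\rsum_j \big[Rplus/R0]_(b <- ball0 d r) \big[Rplus/R0]_(b' <- ball0 d r)
   ((if repi (pt i + b + b')%rg == j then d2S (pt i + b)%rg (pt i) (pt i + b + b')%rg (E xx) else 0) * v j)); last first.
  by apply: eq_bigr => j _; rewrite -bsum_scalr; apply: eq_bigr => b _; rewrite -bsum_scalr.
rewrite [RHS]exchange_big /=; apply: eq_bigr => b _.
rewrite [RHS]exchange_big /=; apply: eq_bigr => b' _.
rewrite /Ev -(@rsum_delta _ (fun j => d2S (pt i + b)%rg (pt i) (pt i + b + b')%rg (E xx) * v j) (repi (pt i + b + b')%rg)).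
by apply: eq_bigr => j _; rewrite eq_sym; case: eqP => _; ring.
Qed.

Lemma E_close xx yy k : E yy k - E xx k = yy (repi k) - xx (repi k).
Proof. by rewrite /E; ring. Qed.

Lemma gsHc xx e : 0 < e -> exists d, 0 < d /\ forall yy, (forall i, Rabs (yy i - xx i) < d) ->
  forall i j, Rabs (Hx yy i j - Hx xx i j) < e.
Proof.
move=> he.
have h i j : cnt (fun yy => Hx yy i j) xx.
  apply: cnt_sum => b; apply: cnt_sum => b'; case: eqP => _; last exact: cnt_const.
  move=> e1 he1; case: hA => _ [_ [_ [_ [_ hc]]]].
  case: (hc (pt i + b)%rg (pt i) (pt i + b + b')%rg (E xx) e1 he1) => d1 [d10 hd1].
  by exists d1; split=> // yy hy; apply: hd1 => k _; rewrite E_close.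
case: (@fin_delta (prod I I : finType) (fun ij d => forall yy, (forall i, Rabs (yy i - xx i) < d) ->
    Rabs (Hx yy ij.1 ij.2 - Hx xx ij.1 ij.2) < e)).
- by move=> [i j]; case: (h i j e he) => d1 [d10 hd1]; exists d1.
- move=> ij d1 d2 hd hP yy hy; apply: hP => i; have := hy i; lra.
by move=> d1 [d10 hd1]; exists d1; split=> // yy hy i j; exact: (hd1 (i, j)).
Qed.

Lemma gsC : exists C, forall xx i j, Rabs (Hx xx i j) <= C.
Proof.
case: hE => C hC'; pose n := INR (size (ball0 d r)).
have C0 : 0 <= C by apply: Rle_trans (hC' 0%rg 0%rg 0%rg (fun _ => 0)); exact: Rabs_pos.
have bound (s : seq (Zd d)) (F : Zd d -> R) B : (forall b, Rabs (F b) <= B) ->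
   Rabs (\big[Rplus/R0]_(b <- s) F b) <= INR (size s) * B.
  move=> hF; apply: Rle_trans (bsum_abs _ _ _) _; elim: s => [|a s IH].
    by rewrite big_nil Rmult_0_l; lra.
  by rewrite big_cons [size _]/= S_INR; have := hF a; lra.
exists (n * (n * C)) => xx i j; rewrite /Hx /n; apply: (bound (ball0 d r)) => b; apply: (bound (ball0 d r)) => b'.
by case: eqP => _; [exact: hC' | rewrite Rabs_R0].
Qed.

Lemma Hx_term xx i j b b' : i <> j -> repi (pt i + b + b')%rg = j ->
  d2S (pt i + b)%rg (pt i) (pt i + b + b')%rg (E xx) <= 0.
Proof.
move=> ne hj; case: hD => h _; apply: h => e; apply: ne.
by rewrite -hj -e; case: (repi_pt i).
Qed.

Lemma bsum_le0 (s : seq (Zd d)) (F : Zd d -> R) : (forall b, F b <= 0) -> \big[Rplus/R0]_(b <- s) F b <= 0.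
Proof.
move=> h; have := bsum_ge0 s (P := xpredT) (F := fun b => - F b); rewrite bsum_opp => H.
by have := H (fun b _ => ltac:(have := h b; lra)); lra.
Qed.

Lemma gsoff xx i j : i <> j -> Hx xx i j <= 0.
Proof.
move=> ne; apply: bsum_le0 => b; apply: bsum_le0 => b'.
by case: eqP => [e|_]; [exact: (Hx_term xx ne e) | lra].
Qed.

Lemma d2S_neighbor k u : norm1 u = 1%nat -> u \in ball0 d r /\ forall x, d2S k k (k + u)%rg x < 0.
Proof.
move=> hu; have neg x : d2S k k (k + u)%rg x < 0.
  by case: hD => _ h; apply: h; rewrite /vsub -norm1N GRing.opprB GRing.addrC GRing.addKr.
split=> //; rewrite mem_ball0; apply: NNPP => h.
have := neg (fun _ => 0); rewrite (d2S_out hA); first lra.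
case: hA => r0 _; rewrite /in_ball rad_le // /vsub GRing.addrC GRing.addKr => h2; exact: h.
Qed.

Lemma ball0_0 : 0%rg \in ball0 d r.
Proof. by rewrite mem_ball0 norm1_0. Qed.

Lemma bsum_lt0 (s : seq (Zd d)) (F : Zd d -> R) b : b \in s -> (forall b, F b <= 0) -> F b < 0 -> \big[Rplus/R0]_(b <- s) F b < 0.
Proof.
move=> hb h hlt.
have e : \big[Rplus/R0]_(b <- s) F b = F b + \big[Rplus/R0]_(b <- rem b s) F b by rewrite (big_rem b hb).
rewrite e; apply: (@Rle_lt_trans _ (F b + 0)); last lra.
apply: Rplus_le_compat_l; exact: (bsum_le0 (rem b s) h).
Qed.

Lemma gsirr (A : I -> Prop) : (exists i, A i) -> (exists j, ~ A j) ->
  exists i j, A i /\ ~ A j /\ forall xx, Hx xx i j < 0.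
Proof.
move=> [i hi] [j hj]; apply: NNPP => hn.
have step u k : norm1 u = 1%nat -> A (repi k) -> A (repi (k + u)%rg).
  move=> hu hk; apply: NNPP => hku; apply: hn; exists (repi k), (repi (k + u)%rg); do 2!split=> //.
  move=> xx; have [ub neg] := d2S_neighbor (pt (repi k)) hu.
  have ne : repi k <> repi (k + u)%rg by move=> e; apply: hku; rewrite -e.
  have ej : repi (pt (repi k) + 0 + u)%rg = repi (k + u)%rg.
    rewrite GRing.addr0 {2}(repP k) GRing.addrAC.
    by case: (repi_per (pt (repi k) + u)%rg (repn k)).
  have le0 b b' : (if repi (pt (repi k) + b + b')%rg == repi (k + u)%rg then
       d2S (pt (repi k) + b)%rg (pt (repi k)) (pt (repi k) + b + b')%rg (E xx) else 0) <= 0.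
    by case: eqP => [e|_]; [exact: (Hx_term xx ne e) | lra].
  apply: (bsum_lt0 ball0_0) => [b|]; first exact: bsum_le0.
  apply: (bsum_lt0 ub) => [b|]; first exact: le0.
  by rewrite ej eqxx GRing.addr0; exact: neg.
have all u : forall k, A (repi k) -> A (repi (k + u)%rg).
  elim/lattice_ind: u => [|u v hu hv|a|a] k hk.
  - by rewrite GRing.addr0.
  - by rewrite GRing.addrA; apply: hv; exact: hu.
  - by apply: step => //; exact: norm1_delta.
  - by apply: step => //; rewrite norm1N; exact: norm1_delta.
apply: hj; have := all (pt j - pt i)%rg (pt i).
by rewrite GRing.addrC GRing.subrK; case: (repi_pt i) => -> _; case: (repi_pt j) => -> _; apply.
Qed.

Lemma gsys_pq : exists C, gsys Wx fx Hx C.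
Proof.
case: gsC => C hC'; exists C; split.
- exact: gsW.
- exact: gsf.
- exact: gsHc.
- exact: hC'.
- exact: gsoff.
- exact: gsirr.
Qed.

Lemma W_coercive M : exists K, forall xx, Wx xx <= M -> forall i j, Rabs (xx i - xx j) <= K.
Proof.
have lb i : exists m, forall x, m <= S (pt i) x by case: (hC (pt i)).
pose m i := proj1_sig (constructive_indefinite_description _ (lb i)).
have mP i x : m i <= S (pt i) x by rewrite /m; case: constructive_indefinite_description.
pose M' := M + \rsum_i Rabs (m i).
have SM xx i : Wx xx <= M -> S (pt i) (E xx) <= M'.
  move=> hW.
  have h1 j : 0 <= S (pt j) (E xx) + Rabs (m j).
    by have := mP j (E xx); have := Rle_abs (- m j); rewrite Rabs_Ropp; lra.
  have := @rsum_term _ (fun j => S (pt j) (E xx) + Rabs (m j)) i h1.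
  rewrite bsum_add -/(Wx xx) /M'; have := Rabs_pos (m i); lra.
have step u : norm1 u = 1%nat -> exists K, forall xx, Wx xx <= M -> forall k, Rabs (E xx (k + u)%rg - E xx k) <= K.
  move=> hu.
  have hK i : exists K, forall x, K < Rabs (x (pt i + u)%rg - x (pt i)) -> M' < S (pt i) x.
    case: (hC (pt i)) => _ h; case: (h (pt i + u)%rg _ M') => [|K hK]; last by exists K.
    by rewrite /vsub GRing.addrC GRing.addKr.
  pose K i := proj1_sig (constructive_indefinite_description _ (hK i)).
  have KP i x : K i < Rabs (x (pt i + u)%rg - x (pt i)) -> M' < S (pt i) x.
    by rewrite /K; case: constructive_indefinite_description => K' h; exact: h.
  exists (\rsum_i Rabs (K i)) => xx hW k.
  rewrite {1 2}(repP k) GRing.addrAC !(X_per_at _ _ (E_X xx)).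
  have e3 a b c : a - c - (b - c) = a - b by ring.
  rewrite e3.
  have h1 : Rabs (K (repi k)) <= \rsum_i Rabs (K i).
    by apply: (@rsum_term _ (fun i => Rabs (K i))) => j; exact: Rabs_pos.
  apply: Rnot_lt_le => lt.
  have h2 := KP (repi k) (E xx); have h3 := SM xx (repi k) hW.
  have := Rle_abs (K (repi k)) => h4.
  by have := h2 (Rle_lt_trans _ _ _ (Rle_trans _ _ _ h4 h1) lt); lra.
have all u : exists K, forall xx, Wx xx <= M -> forall k, Rabs (E xx (k + u)%rg - E xx k) <= K.
  elim/lattice_ind: u => [|u v [K1 h1] [K2 h2]|a|a].
  - by exists 0 => xx _ k; rewrite GRing.addr0 Rminus_diag Rabs_R0; lra.
  - exists (K1 + K2) => xx hW k; have k1 := h1 xx hW k; have k2 := h2 xx hW (k + u)%rg.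
    rewrite GRing.addrA Rplus_comm; apply: Rle_trans (Rabs_dist3 _ (E xx (k + u)%rg) _) _.
    exact: Rplus_le_compat.
  - by apply: step; exact: norm1_delta.
  - by apply: step; rewrite norm1N; exact: norm1_delta.
pose K i j := proj1_sig (constructive_indefinite_description _ (all (pt i - pt j)%rg)).
have KP i j xx k : Wx xx <= M -> Rabs (E xx (k + (pt i - pt j))%rg - E xx k) <= K i j.
  by rewrite /K; case: constructive_indefinite_description => K' h hW; exact: h.
exists (\rsum_i \rsum_j Rabs (K i j)) => xx hW i j.
have := KP i j xx (pt j) hW; rewrite GRing.addrC GRing.subrK.
have -> : E xx (pt i) = xx i by rewrite -{2}(RsE xx).
have -> : E xx (pt j) = xx j by rewrite -{2}(RsE xx).
have h1 : Rabs (K i j) <= \rsum_j Rabs (K i j).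
  by apply: (@rsum_term _ (fun j => Rabs (K i j))) => j'; exact: Rabs_pos.
have h2 : \rsum_j Rabs (K i j) <= \rsum_i \rsum_j Rabs (K i j).
  by apply: (@rsum_term _ (fun i => \rsum_j Rabs (K i j))) => i'; apply: bsum_ge0 => j' _; exact: Rabs_pos.
have := Rle_abs (K i j); lra.
Qed.

Lemma norm1_step k n : norm1 k = n.+1 -> exists a, exists u, (u = delta_mx ord0 a \/ u = - delta_mx ord0 a)%rg /\ norm1 (k - u)%rg = n.
Proof.
move=> hk.
have [a ha] : exists a, k ord0 a != 0%rg.
  apply: NNPP => h; have : norm1 k = 0%nat; last by rewrite hk.
  rewrite /norm1 big1 // => a _; case: (eqVneq (k ord0 a) 0%rg) => [-> //|ne].
  by case: h; exists a.
have dec (u : Zd d) : (forall b, u ord0 b = if b == a then u ord0 a else 0%rg) ->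
    (absz (k ord0 a)).-1 = absz (k ord0 a - u ord0 a)%rg -> norm1 (k - u)%rg = n.
  move=> hu he; have := hk; rewrite /norm1 (bigD1 a) //= [in X in _ -> X](bigD1 a) //= !mxE -he.
  have -> : (\sum_(i < d | i != a) absz ((k - u)%rg ord0 i))%nat = (\sum_(i < d | i != a) absz (k ord0 i))%nat.
    by apply: eq_bigr => b /negbTE hb; rewrite !mxE hu hb GRing.oppr0 GRing.addr0.
  have : (0 < absz (k ord0 a))%nat by rewrite absz_gt0.
  by case: (absz (k 0%rg a)) => // m _ h; exact: (congr1 predn h).
exists a; case e : (k ord0 a) ha dec => [[|m]|m] // _ dec.
  exists (delta_mx ord0 a); split; first by left.
  apply: dec => [b|]; first by rewrite !mxE !eqxx /=; case: eqP.
  by rewrite mxE !eqxx /= subn1.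
exists (- delta_mx ord0 a)%rg; split; first by right.
apply: dec => [b|]; first by rewrite !mxE !eqxx /=; case: eqP => //; rewrite GRing.oppr0.
rewrite !mxE !eqxx /= NegzE GRing.opprK -[in RHS](addn1 m) PoszD GRing.opprD -GRing.addrA GRing.addNr GRing.addr0.
by rewrite abszN.
Qed.

Lemma E_inX xx : inX (E xx).
Proof.
have one u : exists K, 0 <= K /\ forall k, Rabs (E xx (k + u)%rg - E xx k) <= K.
  exists (\rsum_i Rabs (E xx (pt i + u)%rg - E xx (pt i))); split.
    by apply: bsum_ge0 => i _; exact: Rabs_pos.
  move=> k; rewrite {1 2}(repP k) GRing.addrAC !(X_per_at _ _ (E_X xx)).
  have e3 a b c : a - c - (b - c) = a - b by ring.
  rewrite e3; apply: (@rsum_term _ (fun i => Rabs (E xx (pt i + u)%rg - E xx (pt i)))) => j.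
  exact: Rabs_pos.
have [K [K0 hK]] : exists K, 0 <= K /\ forall a u, (u = delta_mx ord0 a \/ u = - delta_mx ord0 a)%rg ->
   forall k, Rabs (E xx (k + u)%rg - E xx k) <= K.
  pose Kf u := proj1_sig (constructive_indefinite_description _ (one u)).
  have KP u : 0 <= Kf u /\ forall k, Rabs (E xx (k + u)%rg - E xx k) <= Kf u.
    by rewrite /Kf; case: constructive_indefinite_description.
  pose g (a : 'I_d) := Kf (delta_mx ord0 a) + Kf (- delta_mx ord0 a)%rg.
  have g0 a : 0 <= g a by have [? _] := KP (delta_mx ord0 a); have [? _] := KP (- delta_mx ord0 a)%rg; rewrite /g; lra.
  exists (\rsum_a g a); split; first by apply: bsum_ge0.
  move=> a u hu k; apply: (@Rle_trans _ (g a)); last exact: (@rsum_term _ g).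
  have [p1 q1] := KP (delta_mx ord0 a); have [p2 q2] := KP (- delta_mx ord0 a)%rg.
  by case: hu => ->; [have := q1 k | have := q2 k]; rewrite /g; lra.
have lin n : forall k, norm1 k = n -> Rabs (E xx k - E xx 0%rg) <= K * INR n.
  elim: n => [|n IH] k hk.
    have -> : k = 0%rg.
      apply/rowP => a; rewrite mxE; apply/eqP; rewrite -absz_eq0.
      by move/eqP: hk; rewrite /norm1 sum_nat_eq0 => /forallP /(_ a).
    by rewrite Rminus_diag Rabs_R0 /=; lra.
  case: (norm1_step hk) => a [u [hu hn]].
  have h1 := IH _ hn; have h2 := hK a u hu (k - u)%rg; rewrite GRing.subrK in h2.
  apply: Rle_trans (Rabs_dist3 _ (E xx (k - u)%rg) _) _; rewrite S_INR; lra.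
apply: (@inX_linear d _ (Rabs (E xx 0%rg)) K) => //; first exact: Rabs_pos.
move=> k; have h := lin _ k erefl.
rewrite (_ : E xx k = E xx 0%rg + (E xx k - E xx 0%rg)); last ring.
by apply: Rle_trans (Rabs_triang _ _) _; lra.
Qed.

Variable Psi : R -> Config d -> Config d.
Hypothesis hPsi : is_flow r dS Psi.

Lemma Psi_Xsol x : inX x -> Xsol r dS (fun t => Psi t x).
Proof. by move=> hx; case: (hPsi hx). Qed.

Lemma Psi_X t x : X x -> X (Psi t x).
Proof.
move=> hx a; have ix : inX x by rewrite -(ERs hx); exact: E_inX.
apply: (Xsol_unique hA hE (Xsol_tau hA hB (pcol p a) (q ord0 a) (Psi_Xsol ix)) (Psi_Xsol ix)).
by case: (hPsi ix) => -> _; exact: hx.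
Qed.

Definition Phi t xx : V := Rs (Psi t (E xx)).

Lemma E_Phi t xx : E (Phi t xx) = Psi t (E xx).
Proof. by rewrite /Phi ERs //; apply: Psi_X; exact: E_X. Qed.

Lemma Phi_0 xx : Phi 0 xx = xx.
Proof. by rewrite /Phi; case: (hPsi (E_inX xx)) => -> _; exact: RsE. Qed.

Lemma Phi_D xx t i : derivable_pt_lim (fun t => Phi t xx i) t (fx (Phi t xx) i).
Proof.
move=> e he; case: (hPsi (E_inX xx)) => _ /(_ t) [_ hd].
have w0 := wt_gt0 (pt i).
case: (hd (wt (pt i) * (e / 2))) => [|del [del0 hdel]]; first by apply: Rmult_lt_0_compat; lra.
exists (mkposreal del del0) => h h0 /= hh.
have := normX_coord (pt i) (hdel h h0 hh); rewrite /fx E_Phi /Phi /Rs /Rminus Ropp_involutive => hx.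
have := Rmult_le_reg_l _ _ _ w0 hx; lra.
Qed.

Lemma Wpq_E xx : Wpq S bp (E xx) = Wx xx.
Proof. exact: WpqE. Qed.

Lemma dd_W xx v D : dd (Wpq S bp) (E xx) (Ev v) D <-> D = - dot (fx xx) v.
Proof.
have h : dd (Wpq S bp) (E xx) (Ev v) (- dot (fx xx) v).
  apply: derivable_pt_lim_eqf (gsW xx v) => s.
  by rewrite -[LHS]/(Wpq S bp (shiftby (E xx) s (Ev v))) E_line Wpq_E.
by split=> [h2|-> //]; exact: uniqueness_limite h2 h.
Qed.

Lemma critical_E xx : critical p q (Wpq S bp) (E xx) <-> crit fx xx.
Proof.
split=> [[_ h]|h].
  have := (dd_W xx (fx xx) 0).1 (h _ (Ev_tangent _)) => h0.
  by apply: dot_eq0; lra.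
split; first exact: E_X.
move=> v hv; rewrite -(EvRs hv); apply/dd_W.
have -> : dot (fx xx) (Rs v) = 0 by apply: big1 => i _; rewrite h; ring.
ring.
Qed.

Lemma hess_E xx v w h : hess_is p q (Wpq S bp) (E xx) (Ev v) (Ev w) h <-> h = dot v (Mop (Hx xx) w).
Proof.
have hd : derivable_pt_lim (fun s => - dot (fx (fun i => xx i + s * w i)) v) 0 (dot v (Mop (Hx xx) w)).
  apply: derivable_pt_lim_eql; last first.
    apply: derivable_pt_lim_opp; apply: derivable_pt_lim_sum => i _.
    by apply: derivable_pt_lim_scal_right; exact: gsf.
  by rewrite -bsum_opp; apply: eq_bigr => i _; rewrite /Mop; ring.
split.
  move=> [g [hg h2]].
  have gE yy : g (E yy) = - dot (fx yy) v by apply: (dd_W yy v _).1; apply: hg; exact: E_X.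
  apply: uniqueness_limite h2 _; apply: derivable_pt_lim_eqf hd => s.
  by rewrite -[LHS]/(g (shiftby (E xx) s (Ev w))) E_line gE.
move=> ->; exists (fun y => - dot (fx (Rs y)) v); split.
  by move=> y hy; rewrite -{1}(ERs hy); apply/dd_W.
apply: derivable_pt_lim_eqf hd => s.
by rewrite -[LHS]/(- dot (fx (Rs (shiftby (E xx) s (Ev w)))) v) E_line RsE.
Qed.

Lemma ipBp_Ev v w : ipBp bp (Ev v) (Ev w) = dot v w.
Proof.
rewrite /ipBp /Rsum_seq big_tnth; apply: eq_bigr => i _.
by rewrite -/(pt i) /Ev; case: (repi_pt i) => ->.
Qed.

Lemma Hx_sym xx v w : dot v (Mop (Hx xx) w) = dot w (Mop (Hx xx) v).
Proof. by case: gsys_pq => C hS; exact: (H_dot_sym hS). Qed.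

Lemma eigvec_E xx lam v : hess_eigvec p q bp (Wpq S bp) (E xx) lam (Ev v) <->
  (exists i, v i <> 0) /\ forall i, Mop (Hx xx) v i = lam * v i.
Proof.
split=> [[_ [[k hk] h]]|[[i hi] h]].
  split; first by exists (repi k).
  pose w i := Mop (Hx xx) v i - lam * v i.
  have wE i : w i = Mop (Hx xx) v i - lam * v i by [].
  have := (hess_E xx v w _).1 (h _ (Ev_tangent w)); rewrite ipBp_Ev Hx_sym => e.
  have wz : dot w w = 0.
    have : dot w w = dot w (Mop (Hx xx) v) - lam * dot v w.
      by rewrite (dotC v) -dotZr -dotBr; apply: eq_bigr => i _; rewrite wE.
    lra.
  by move=> i; have := dot_eq0 wz i; rewrite wE; lra.
split; first exact: Ev_tangent.
split; first by exists (pt i); rewrite /Ev; case: (repi_pt i) => ->.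
move=> w hw; rewrite -(EvRs hw); apply/hess_E; rewrite ipBp_Ev Hx_sym (dotC v) -dotZr.
by apply: eq_bigr => j _; rewrite h.
Qed.

Lemma eig_Q xx mu v : (forall i, Mop (Hx xx) v i = mu * v i) -> dot v (Mop (Hx xx) v) = mu * dot v v.
Proof. by move=> h; rewrite -dotZr; apply: eq_bigr => i _; rewrite h. Qed.

Lemma stable_index0 xx : stable fx Hx xx -> morse_index p q bp (Wpq S bp) (E xx) 0.
Proof.
move=> [_ [lam [e [g [[_ _ _ _ [hq _]] l0]]]]].
exists (fun _ _ => 0); split; first by case.
split; first by move=> c _ [].
move=> mu v mu0 hv; have tv := proj1 hv; rewrite -(EvRs tv) in hv.
case/eigvec_E: hv => -[i hi] hm.
have := hq (Rs v); rewrite /Q (eig_Q hm); have := dot_gt0 hi; nra.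
Qed.

Lemma index1_index1 xx : index1 fx Hx xx -> morse_index p q bp (Wpq S bp) (E xx) 1.
Proof.
move=> [_ [lam [e [g [[_ ep _ ee _] l0 hq]]]]].
have De : 0 < dot e e by apply: (@dot_gt0 _ _ i0); have := ep i0; lra.
exists (fun _ => Ev e); split.
  move=> _; exists lam; split=> //; apply/eigvec_E; split=> //.
  by exists i0; have := ep i0; lra.
split.
  move=> c hc a; have := hc (pt i0); rewrite big_ord_recl big_ord0 Rplus_0_r /Ev.
  case: (repi_pt i0) => -> _; rewrite (ord1 a) => h; have := ep i0.
  have [//|ne] := Req_dec (c ord0) 0; by case/Rmult_integral: h => //; lra.
move=> mu v mu0 hv; have tv := proj1 hv; rewrite -(EvRs tv) in hv *.
case/eigvec_E: hv => -[i hi] hm; set vv := Rs v in hi hm *.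
have hmix : mu * dot vv e = lam * dot vv e.
  have -> : mu * dot vv e = dot e (Mop (Hx xx) vv).
    by rewrite (dotC vv) -dotZr; apply: eq_bigr => j _; rewrite hm.
  by rewrite Hx_sym -dotZr; apply: eq_bigr => j _; rewrite ee.
have [d0|dn0] := Req_dec (dot vv e) 0.
  by have := hq vv d0; rewrite (eig_Q hm); have := dot_gt0 hi; nra.
have el : mu = lam by exact: Rmult_eq_reg_r hmix dn0.
pose c := dot vv e / dot e e.
pose w j := vv j + - c * e j.
have we : dot w e = 0 by rewrite /w dotDl dotZl /c; field; lra.
have wm j : Mop (Hx xx) w j = mu * w j.
  by rewrite /w MopD MopZ hm ee -el; ring.
have wz : dot w w = 0.
  by have := hq w we; rewrite (eig_Q wm); have := dot_ge0 w; nra.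
exists (fun _ => c) => k; rewrite big_ord_recl big_ord0 Rplus_0_r /Ev.
have := dot_eq0 wz (repi k); rewrite /w; lra.
Qed.

Lemma goodcrit_E xx : goodcrit fx Hx xx -> critical p q (Wpq S bp) (E xx) /\
  (morse_index p q bp (Wpq S bp) (E xx) 0 \/ morse_index p q bp (Wpq S bp) (E xx) 1).
Proof.
move=> h; split; first by apply/critical_E; exact: goodcrit_crit h.
by case: h => h; [left; exact: stable_index0 | right; exact: index1_index1].
Qed.

Lemma morse_nondeg : morse p q (Wpq S bp) -> nondeg fx Hx.
Proof.
move=> hm z cz v hv i.
have h := hm (E z) ((critical_E z).2 cz) (Ev v) (Ev_tangent v).
have : Ev v (pt i) = 0; last by rewrite /Ev; case: (repi_pt i) => ->.
apply: h => w hw; rewrite -(EvRs hw); apply/hess_E; rewrite Hx_sym.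
by rewrite /dot big1 // => j _; rewrite hv; ring.
Qed.

Lemma gradW_per x u n : X x -> gradW r dS x (u + per p n)%rg = gradW r dS x u.
Proof. by move=> hx; rewrite -(gradW_tau hA hB (per p n) (qper q n)) X_per. Qed.

Lemma S_per x u n : X x -> S (u + per p n)%rg x = S u x.
Proof. by move=> hx; rewrite -{2}(X_per n hx) hB. Qed.

Definition act k l xx : V := Rs (tau k l (E xx)).

Lemma E_act k l xx : E (act k l xx) = tau k l (E xx).
Proof. by rewrite /act ERs //; apply: X_tau; exact: E_X. Qed.

Lemma act_symm k l : exists th gm, symm Wx fx (act k l) th gm.
Proof.
exists (fun i => repi (pt i + k)%rg), (fun i => IntR l - IntR (qper q (repn (pt i + k)%rg))); split.
- exact: rep_shift_inj.
- by move=> xx; apply: functional_extensionality => i; rewrite /act /Rs /tau /vadd /E; ring.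
- move=> xx i; rewrite /fx E_act (gradW_tau hA hB); congr (- _).
  by rewrite {1}(repP (pt i + k)%rg) gradW_per //; exact: E_X.
- move=> xx; rewrite /Wx E_act -(@period_sum (fun u => S u (E xx)) k).
    by apply: eq_bigr => i _; rewrite hB.
  by move=> u n; apply: S_per; exact: E_X.
Qed.

Lemma additive_Z (a : Z -> R) : (forall m n, a (m + n)%Z = a m + a n) -> forall n, a n = IZR n * a 1%Z.
Proof.
move=> h; have a0 : a 0%Z = 0 by have := h 0%Z 0%Z; rewrite Z.add_0_r; lra.
apply: Z.peano_ind => [|n IH|n IH]; first by rewrite a0; ring.
  by rewrite -Z.add_1_r h IH plus_IZR; ring.
have := h (Z.pred n) 1%Z; rewrite Z.add_1_r Z.succ_pred IH -Z.sub_1_r minus_IZR; lra.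
Qed.

Lemma IntR_int_of_Z n : IntR (int_of_Z n) = IZR n.
Proof.
rewrite (@additive_Z (fun n => IntR (int_of_Z n))) => [|m k].
  by rewrite (_ : IntR (int_of_Z 1) = 1) ?Rmult_1_r.
by rewrite (_ : int_of_Z (m + k) = (int_of_Z m + int_of_Z k)%rg) ?IntRD //; exact: GRing.rmorphD.
Qed.

Lemma tlim_E_p (y : R -> V) l k : tlim_p y l -> lim_pinf (fun t => E (y t) k) (E l k).
Proof.
move=> h e he; case: (h e he) => T hT; exists T => t ht; rewrite E_close; exact: hT.
Qed.
Lemma tlim_E_m (y : R -> V) l k : tlim_m y l -> lim_minf (fun t => E (y t) k) (E l k).
Proof.
move=> h e he; case: (h e he) => T hT; exists T => t ht; rewrite E_close; exact: hT.
Qed.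

Lemma ghost_pq : morse p q (Wpq S bp) ->
  exists G : Config d -> Prop,
    ghost_circle Psi G /\
    (forall x, G x -> inXpq p q x) /\
    C1_curve G /\
    (forall x, inXpq p q x -> (forall y, inXpq p q y -> Wpq S bp x <= Wpq S bp y) -> G x) /\
    (forall x, G x ->
       (critical p q (Wpq S bp) x /\
          (morse_index p q bp (Wpq S bp) x 0 \/ morse_index p q bp (Wpq S bp) x 1))
       \/
       (~ critical p q (Wpq S bp) x /\
        exists a b : Config d,
          a <> b /\
          critical p q (Wpq S bp) a /\
          (morse_index p q bp (Wpq S bp) a 0 \/ morse_index p q bp (Wpq S bp) a 1) /\
          critical p q (Wpq S bp) b /\
          (morse_index p q bp (Wpq S bp) b 0 \/ morse_index p q bp (Wpq S bp) b 1) /\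
          (forall i : Zd d, lim_minf (fun t => Psi t x i) (a i)) /\
          (forall i : Zd d, lim_pinf (fun t => Psi t x i) (b i)))).
Proof.
move=> /morse_nondeg HM; case: gsys_pq => C HS.
case: (shift_generator omega) => k0 [l0 [hgen [m0 [m00 hm0]]]].
pose A (n : Z) xx := act (int_of_Z n *: k0)%rg (int_of_Z n * l0)%rg xx.
have zD m n : int_of_Z (m + n) = (int_of_Z m + int_of_Z n)%rg by exact: GRing.rmorphD.
have A0 xx : A 0%Z xx = xx.
  by rewrite /A /act (_ : int_of_Z 0 = 0%rg) // GRing.scale0r GRing.mul0r tau0 RsE.
have AD m n xx : A (m + n)%Z xx = A m (A n xx).
  by apply: E_inj; rewrite /A !E_act tau_tau zD GRing.scalerDl GRing.mulrDl.
have Asym n : exists th gm, symm Wx fx (A n) th gm by exact: act_symm.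
pose a n := sg (A n (fun _ => 0)).
have aP n xx : sg (A n xx) = sg xx + a n.
  case: (Asym n) => th [gm hs]; rewrite /a !(sy_sg hs).
  have -> : sg (fun _ : I => 0) = 0 by apply: big1.
  lra.
have aD m n : a (m + n)%Z = a m + a n.
  have := aP (m + n)%Z (fun _ => 0); rewrite AD !aP.
  have -> : sg (fun _ : I => 0) = 0 by apply: big1.
  lra.
have Asg n xx : sg (A n xx) = sg xx + IZR n * a 1%Z by rewrite aP (additive_Z aD).
have shiftE k l xx m : slope omega (k - m *: k0)%rg (l - m * l0)%rg = 0%rg ->
    tau k l (E xx) = E (A (Z_of_int m) xx).
  move=> hs; rewrite /A E_act Z_of_intK.
  have := X_slope (X_tau (m *: k0)%rg (m * l0)%rg (E_X xx)) hs.
  by rewrite tau_tau !GRing.subrK.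
have c0 : 0 < a 1%Z.
  have h1 := aP (Z_of_int m0) (fun _ => 0); rewrite (additive_Z aD) in h1.
  have h2 : A (Z_of_int m0) (fun _ => 0) = fun _ => 1.
    apply: E_inj; rewrite -(shiftE 0%rg 1%rg) //.
    apply: functional_extensionality => k; rewrite /tau /vadd GRing.addr0 IntR1 /E; ring.
  have h0 : sg (fun _ : I => 0) = 0 by apply: big1.
  have h3 : 0 < sg (fun _ : I => 1) by apply: (@rsum_gt0 _ _ i0) => [j|]; lra.
  rewrite h2 h0 in h1.
  have h4 : 0 < IZR (Z_of_int m0).
    case: m0 m00 {hm0 h1 h2} => // m hm.
    by rewrite -[Z_of_int _]/(Z.of_nat m) -INR_IZR_INZ; apply: lt_0_INR; exact/ltP.
  nra.
have Hper xx n : Wx (fun i => xx i + IZR n) = Wx xx.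
  rewrite /Wx.
  have -> : E (fun i => xx i + IZR n) = tau 0%rg (int_of_Z n) (E xx).
    by apply: functional_extensionality => k; rewrite /tau /vadd GRing.addr0 IntR_int_of_Z /E; ring.
  by apply: eq_bigr => i _; rewrite hB /vadd GRing.addr0.
case: (ghost_core i0 HS Phi_0 Phi_D HM W_coercive Hper A0 AD Asym c0 Asg)
  => gam [dgam [g1 [g2 [g3 [g4 [g5 [g6 [g7 [g8 g9]]]]]]]]].
have gcont s k e : 0 < e -> exists del, 0 < del /\ forall s', Rabs (s' - s) < del ->
    Rabs (E (gam s') k - E (gam s) k) < e.
  move=> he; have := derivable_pt_lim_cont (g2 (repi k) s); move/continuity_pt_eps => /(_ e he) [del [d0 hd]].
  by exists del; split=> // s' hs; rewrite E_close; exact: hd.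
have gconts s (F : seq (Zd d)) e : 0 < e -> exists del, 0 < del /\ forall s', Rabs (s' - s) < del ->
    forall k, k \in F -> Rabs (E (gam s') k - E (gam s) k) < e.
  move=> he; elim: F => [|k F [d1 [d10 h1]]]; first by exists 1; split; [lra|].
  case: (gcont s k e he) => d2 [d20 h2]; exists (Rmin d1 d2); split=> [|s' hs k']; first exact: Rmin_glb_lt.
  rewrite inE => /orP[/eqP->|hk].
    by apply: h2; exact: Rlt_le_trans hs (Rmin_r _ _).
  by apply: h1 => //; exact: Rlt_le_trans hs (Rmin_l _ _).
pose G x := exists s, x = E (gam s).
have Gorder s s' : s < s' -> sll (E (gam s)) (E (gam s')).
  move=> lt k; have := g5 s s' lt (repi k); have := E_close (gam s) (gam s') k; lra.
exists G; split; last split; last split; last split.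
- split; first by exists (E (gam 0)), 0.
  split.
    move=> x hx; exists (sg (Rs x)); set s := sg (Rs x).
    apply: functional_extensionality => k; apply: NNPP => ne.
    have he := Rabs_pos_lt _ (Rminus_eq_contra _ _ ne); set e := Rabs _ in he.
    case: (gcont s k (e / 2)) => [|del [del0 hdel]]; first lra.
    have N0 := pos_INR #|I|.
    pose e' := Rmin (e / 2) (del / (INR #|I| + 1)).
    have e'0 : 0 < e' by apply: Rmin_glb_lt; [lra | apply: Rdiv_lt_0_compat; lra].
    case: (hx (k :: [seq pt i | i <- enum I]) e' e'0) => y [[s' ->] hy].
    have h1 := hy k (mem_head _ _).
    have h2 : Rabs (s' - s) <= INR #|I| * e'.
      rewrite -(g1 s') /s -sgB; apply: Rle_trans (sg_abs _) _; apply: nrm_bound => i.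
      rewrite -{1}(RsE (gam s')); apply: Rlt_le; apply: hy; rewrite inE; apply/orP; right.
      by apply: map_f; rewrite mem_enum.
    have h3 : e' * (INR #|I| + 1) <= del by apply: le_div_mul; [lra | exact: Rmin_r].
    have h4 := hdel s' ltac:(nra).
    have h5 : e' <= e / 2 by exact: Rmin_l.
    have := Rabs_dist3 (x k) (E (gam s') k) (E (gam s) k).
    rewrite -/e (Rabs_minus_sym (x k)); lra.
  split.
    move=> U U' oU oU' cov dis.
    apply: NNPP => hn.
    have [s1 hs1] : exists s, ~ U (E (gam s)).
      apply: NNPP => h; apply: hn; left => x [s ->]; apply: NNPP => h2; apply: h; by exists s.
    have [s2 hs2] : exists s, ~ U' (E (gam s)).
      apply: NNPP => h; apply: hn; right => x [s ->]; apply: NNPP => h2; apply: h; by exists s.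
    pose c t := s2 + t * (s1 - s2).
    have op (P : Config d -> Prop) : open_pw P -> forall t, 0 <= t <= 1 -> P (E (gam (c t))) ->
       exists del, 0 < del /\ forall t', 0 <= t' <= 1 -> Rabs (t' - t) < del -> P (E (gam (c t'))).
      move=> oP t _ ht; case: (oP _ ht) => F [e [he hF]].
      case: (gconts (c t) F e he) => del [del0 hdel].
      have p0 : 0 < Rabs (s1 - s2) + 1 by have := Rabs_pos (s1 - s2); lra.
      exists (del / (Rabs (s1 - s2) + 1)); split=> [|t' _ ht']; first exact: Rdiv_lt_0_compat.
      apply: hF => k hk; apply: hdel => //.
      rewrite (_ : c t' - c t = (t' - t) * (s1 - s2)) ?Rabs_mult; last by rewrite /c; ring.
      have := Rmult_lt_compat_r _ _ _ p0 ht'.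
      rewrite (_ : del / _ * _ = del); last by field; lra.
      by have := Rabs_pos (t' - t); nra.
    case: (@connected01 (fun t => U (E (gam (c t)))) (fun t => U' (E (gam (c t))))).
    - exact: op.
    - exact: op.
    - by move=> t _; apply: dis; exists (c t).
    - rewrite (_ : c 0 = s2); last by rewrite /c; ring.
      by case: (cov (E (gam s2))) => //; exists s2.
    - rewrite (_ : c 1 = s1); last by rewrite /c; ring.
      by case: (cov (E (gam s1))) => //; exists s1.
    by move=> t [_ [n1 n2]]; case: (cov (E (gam (c t)))) => //; exists (c t).
  split.
    move=> x y [s ->] [s' ->]; have [lt|[->|gt]] := Rtotal_order s s'.
    - by left; exact: Gorder.
    - by right; left.
    - by right; right; exact: Gorder.
  split.
    move=> k l x [s ->]; case: (hgen k l) => m hm; rewrite (shiftE k l (gam s) m hm).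
    by case: (g6 (Z_of_int m) s) => s' ->; exists s'.
  move=> t; split=> [x [s ->]|y [s ->]].
    by rewrite -E_Phi; case: (g7 t s) => s' ->; exists s'.
  exists (Psi (- t) (E (gam s))); split.
    by rewrite -E_Phi; case: (g7 (- t) s) => s' ->; exists s'.
  by rewrite -E_Phi -E_Phi (PhiVK HS Phi_0 Phi_D).
- by move=> x [s ->]; exact: E_X.
- exists (fun s => E (gam s)), (fun s => Ev (dgam s)); do !split.
  + move=> k s; rewrite /E -(Rminus_0_r (Ev _ _)).
    by apply: derivable_pt_lim_minus; [exact: g2 | exact: derivable_pt_lim_const].
  + by move=> k; exact: g3.
  + move=> s; apply: NNPP => h; have := g4 s.
    have -> : sg (dgam s) = 0.
      apply: big1 => i _; apply: NNPP => ne; apply: h; exists (pt i).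
      by rewrite /Ev; case: (repi_pt i) => ->.
    lra.
  + by move=> s s' /E_inj e; rewrite -(g1 s) e g1.
  + by move=> [s ->]; exists s.
  + by move=> [s <-]; exists s.
- move=> x hx hmin; case: (g8 (Rs x)) => [yy|s hs].
    by rewrite -!Wpq_E ERs //; apply: hmin; exact: E_X.
  by exists s; rewrite hs ERs.
- move=> x [s ->]; case: (g9 s) => [h|[nc [xa [xb [ne [ga [gb [lm lp]]]]]]]].
    by left; exact: goodcrit_E.
  right; split; first by move/critical_E.
  case: (goodcrit_E ga) => ca ia; case: (goodcrit_E gb) => cb ib.
  exists (E xa), (E xb); split; first by move/E_inj.
  do 4!split=> //; split=> i.
    have -> : (fun t => Psi t (E (gam s)) i) = (fun t => E (Phi t (gam s)) i).
      by apply: functional_extensionality => t; rewrite E_Phi.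
    exact: tlim_E_m.
  have -> : (fun t => Psi t (E (gam s)) i) = (fun t => E (Phi t (gam s)) i).
    by apply: functional_extensionality => t; rewrite E_Phi.
  exact: tlim_E_p.
Qed.
End Periodic.

Theorem mainTheorem15 (d : nat) (r : R) (S : Zd d -> Config d -> R)
    (dS : Zd d -> Zd d -> Config d -> R)
    (d2S : Zd d -> Zd d -> Zd d -> Config d -> R)
    (Psi : R -> Config d -> Config d)
    (omega : 'rV[rat]_d) (p : 'M[int]_d) (q : 'rV[int]_d) (bp : seq (Zd d)) :
  condA r S dS d2S -> condB S -> condC S -> condD d2S -> condE d2S ->
  is_flow r dS Psi ->
  principal_periods omega p q ->
  enumerates_Bp p bp ->
  morse p q (Wpq S bp) ->
  exists G : Config d -> Prop,
    ghost_circle Psi G /\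
    (forall x, G x -> inXpq p q x) /\
    C1_curve G /\
    (forall x, inXpq p q x -> (forall y, inXpq p q y -> Wpq S bp x <= Wpq S bp y) -> G x) /\
    (forall x, G x ->
       (critical p q (Wpq S bp) x /\
          (morse_index p q bp (Wpq S bp) x 0 \/ morse_index p q bp (Wpq S bp) x 1))
       \/
       (~ critical p q (Wpq S bp) x /\
        exists a b : Config d,
          a <> b /\
          critical p q (Wpq S bp) a /\
          (morse_index p q bp (Wpq S bp) a 0 \/ morse_index p q bp (Wpq S bp) a 1) /\
          critical p q (Wpq S bp) b /\
          (morse_index p q bp (Wpq S bp) b 0 \/ morse_index p q bp (Wpq S bp) b 1) /\
          (forall i, lim_minf (fun t => Psi t x i) (a i)) /\
          (forall i, lim_pinf (fun t => Psi t x i) (b i)))).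
Proof.
move=> hA hB hC hD hE hPsi hp hbp hM.
exact: (ghost_pq hA hB hC hD hE hp hbp hPsi hM).
Qed.
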